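(* Let $K$ be a field of characteristic zero, let $n\ge 1$, let $\sigma\in \mathrm{End}_K(P_n)$ be a Jacobian map of the polynomial algebra $P_n=K[x_1,\ldots,x_n]$, and let $d:=\deg(\sigma)$. Let ${}^{\sigma}P_n$ be the $A_n$-module obtained by twisting the $A_n$-module $P_n$ by the extension of $\sigma$ to the Weyl algebra $A_n$ described in the context. Then: 1. The $A_n$-module ${}^{\sigma}P_n$ is holonomic, hence of finite length and 1-generated as an $A_n$-module. 2. $l_{A_n}({}^{\sigma}P_n)\le m^n$, where $m:=\max\{d,\,(d-1)^{n-1}-1\}$.
   Context: $K$ is a field of characteristic zero and $K^\times=K\setminus\{0\}$. $P_n=K[x_1,\ldots,x_n]$ is the polynomial algebra and $\mathrm{End}_K(P_n)$ is the monoid of its $K$-algebra endomorphisms. For $\sigma\in\mathrm{End}_K(P_n)$ put $x_i':=\sigma(x_i)$; the Jacobian matrix of $\sigma$ is $\mathcal J(\sigma)=\big(\partial x_i'/\partial x_j\big)_{i,j}$, and $\sigma$ is called a Jacobian map if $\det\mathcal J(\sigma)\in K^\times$. The degree of $\sigma$ is $\deg(\sigma):=\max\{\deg(x_i') : i=1,\ldots,n\}$ (total degree of polynomials). The Weyl algebra $A_n=\mathcal D(P_n)$ is the ring of differential operators on $P_n$, i.e. the $K$-algebra generated by $x_1,\ldots,x_n,\partial_1,\ldots,\partial_n$ subject to $[x_i,x_j]=0$, $[\partial_i,\partial_j]=0$, $[\partial_i,x_j]=\delta_{ij}$, where $\partial_i=\partial/\partial x_i$ and $[a,b]=ab-ba$.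 $P_n$ is a left $A_n$-module in the natural way. Each Jacobian map $\sigma$ extends to a $K$-algebra endomorphism (also denoted $\sigma$) of $A_n$ by $x_i\mapsto x_i'$, $\partial_i\mapsto\partial_i'$, where $\partial_i'$ is the $K$-derivation of $P_n$ given by $$\partial_i'(p)=\frac{1}{\det\mathcal J(\sigma)}\,\mathcal J(\sigma(x_1),\ldots,\sigma(x_{i-1}),p,\sigma(x_{i+1}),\ldots,\sigma(x_n)),\qquad p\in P_n,$$ with $\mathcal J(f_1,\ldots,f_n):=\det(\partial f_k/\partial x_j)_{k,j}$. For an algebra $A$, an endomorphism $\sigma$ of $A$ and an $A$-module $M$, the twisted module ${}^{\sigma}M$ is $M$ as a vector space with action $a\cdot m:=\sigma(a)m$. A finitely generated $A_n$-module $M$ is called holonomic if its Gelfand–Kirillov dimension is $n$. A module is 1-generated if it is cyclic. $l_{A_n}(M)$ denotes the length of an $A_n$-module $M$. *)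

(* Defs.v *)
From HB Require Import structures.
From mathcomp Require Import all_boot all_order all_algebra.
From mathcomp Require Import boolp classical_sets reals.
From mathcomp Require constructive_ereal ereal exp.
(* The notation levels of mathcomp-analysis and multinomials are incompatible. *)
Import -(notations) constructive_ereal.
From mathcomp Require Import mpoly.

Set Implicit Arguments.
Unset Strict Implicit.
Unset Printing Implicit Defensive.

Import GRing.Theory.
Local Open Scope ring_scope.
Local Open Scope quotient_scope.

Lemma mderiv_var (n : nat) (K : fieldType) (i j : 'I_n) :
  ('X_i : {mpoly K[n]})^`M(j) = (i == j)%:R.
Proof.
rewrite mderivX mnm1E; case: eqP => [->|_]; last by rewrite scale0r.
rewrite scale1r (_ : (_ - _)%MM = 0%MM) ?mpolyX0 //.
by apply/mnmP=> k; rewrite mnmBE subnn mnm0E.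
Qed.

Section WeylAlgebra.
Variables (n : nat) (K : fieldType).

Inductive weyl_term : Type :=
| WC of K
| WX of 'I_n
| WD of 'I_n
| WAdd of weyl_term & weyl_term
| WMul of weyl_term & weyl_term.

HB.instance Definition _ := gen_eqMixin weyl_term.
HB.instance Definition _ := gen_choiceMixin weyl_term.

(* The least congruence that makes the terms an associative unital K-algebra
   (with scalars embedded by WC) satisfying the Weyl relations. *)
Inductive weyl_eq : weyl_term -> weyl_term -> Prop :=
| weq_refl t : weyl_eq t t
| weq_sym s t : weyl_eq s t -> weyl_eq t s
| weq_trans s t u : weyl_eq s t -> weyl_eq t u -> weyl_eq s u
| weq_add s s' t t' :
    weyl_eq s s' -> weyl_eq t t' -> weyl_eq (WAdd s t) (WAdd s' t')
| weq_mul s s' t t' :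
    weyl_eq s s' -> weyl_eq t t' -> weyl_eq (WMul s t) (WMul s' t')
| weq_addA s t u : weyl_eq (WAdd s (WAdd t u)) (WAdd (WAdd s t) u)
| weq_addC s t : weyl_eq (WAdd s t) (WAdd t s)
| weq_add0 t : weyl_eq (WAdd (WC 0) t) t
| weq_mulA s t u : weyl_eq (WMul s (WMul t u)) (WMul (WMul s t) u)
| weq_mul0 t : weyl_eq (WMul (WC 0) t) (WC 0)
| weq_mul1 t : weyl_eq (WMul (WC 1) t) t
| weq_mulDl s t u : weyl_eq (WMul (WAdd s t) u) (WAdd (WMul s u) (WMul t u))
| weq_mulDr s t u : weyl_eq (WMul s (WAdd t u)) (WAdd (WMul s t) (WMul s u))
| weq_CD a b : weyl_eq (WC (a + b)) (WAdd (WC a) (WC b))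
| weq_CM a b : weyl_eq (WC (a * b)) (WMul (WC a) (WC b))
| weq_CC a t : weyl_eq (WMul (WC a) t) (WMul t (WC a))
| weq_XX i j : weyl_eq (WMul (WX i) (WX j)) (WMul (WX j) (WX i))
| weq_DD i j : weyl_eq (WMul (WD i) (WD j)) (WMul (WD j) (WD i))
| weq_DX i j : weyl_eq (WMul (WD i) (WX j))
                       (WAdd (WMul (WX j) (WD i)) (WC (i == j)%:R)).

Definition weyl_eqb (s t : weyl_term) : bool := `[< weyl_eq s t >].

Lemma weyl_eqb_equiv : equiv_class_of weyl_eqb.
Proof.
split=> [t|s t|t s u]; first exact/asboolP/weq_refl.
  by apply/asboolP/asboolP; apply: weq_sym.
by move=> /asboolP st /asboolP tu; apply/asboolP; apply: weq_trans st tu.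
Qed.
Canonical weyl_equiv := EquivRelPack weyl_eqb_equiv.
Canonical weyl_encModRel := defaultEncModRel weyl_eqb.

Definition weyl : Type := {eq_quot weyl_eqb}.
HB.instance Definition _ : EqQuotient weyl_term weyl_eqb weyl := EqQuotient.on weyl.
HB.instance Definition _ := Choice.on weyl.

Let wpi (t : weyl_term) : weyl := \pi_weyl t.

Let wpiP s t : weyl_eq s t -> wpi s = wpi t.
Proof. by move=> st; apply/eqmodP/asboolP. Qed.

Let wrepr t : weyl_eq (repr (wpi t)) t.
Proof. by apply/asboolP; rewrite -/(weyl_eqb _ _) -eqmodE reprK. Qed.

Let wind (P : weyl -> Prop) : (forall t, P (wpi t)) -> forall a, P a.
Proof. by move=> Pt a; rewrite -(reprK a); apply: Pt. Qed.

Definition weyl_add (a b : weyl) : weyl := \pi_weyl (WAdd (repr a) (repr b)).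
Definition weyl_mul (a b : weyl) : weyl := \pi_weyl (WMul (repr a) (repr b)).

Let waddE s t : weyl_add (wpi s) (wpi t) = wpi (WAdd s t).
Proof. by apply: wpiP; apply: weq_add. Qed.

Let wmulE s t : weyl_mul (wpi s) (wpi t) = wpi (WMul s t).
Proof. by apply: wpiP; apply: weq_mul. Qed.

Definition weyl_scalar (c : K) : weyl := \pi_weyl (WC c).
Definition weyl_opp (a : weyl) : weyl := weyl_mul (weyl_scalar (-1)) a.

Let waddA : associative weyl_add.
Proof.
elim/wind=> s; elim/wind=> t; elim/wind=> u.
by rewrite !waddE; apply/wpiP/weq_addA.
Qed.

Let waddC : commutative weyl_add.
Proof.
by elim/wind=> s; elim/wind=> t; rewrite !waddE; apply/wpiP/weq_addC.
Qed.

Let wadd0 : left_id (weyl_scalar 0) weyl_add.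
Proof. by elim/wind=> s; rewrite waddE; apply/wpiP/weq_add0. Qed.

Let wmulA : associative weyl_mul.
Proof.
elim/wind=> s; elim/wind=> t; elim/wind=> u.
by rewrite !wmulE; apply/wpiP/weq_mulA.
Qed.

Let wmul1 : left_id (weyl_scalar 1) weyl_mul.
Proof. by elim/wind=> s; rewrite wmulE; apply/wpiP/weq_mul1. Qed.

Let wCC c a : weyl_mul (weyl_scalar c) a = weyl_mul a (weyl_scalar c).
Proof. by elim/wind: a => s; rewrite !wmulE; apply/wpiP/weq_CC. Qed.

Let wmulr1 : right_id (weyl_scalar 1) weyl_mul.
Proof. by move=> a; rewrite -wCC wmul1. Qed.

Let wmulDl : left_distributive weyl_mul weyl_add.
Proof.
elim/wind=> s; elim/wind=> t; elim/wind=> u.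
by rewrite !(wmulE, waddE); apply/wpiP/weq_mulDl.
Qed.

Let wmulDr : right_distributive weyl_mul weyl_add.
Proof.
elim/wind=> s; elim/wind=> t; elim/wind=> u.
by rewrite !(wmulE, waddE); apply/wpiP/weq_mulDr.
Qed.

Let wCD c d : weyl_scalar (c + d) = weyl_add (weyl_scalar c) (weyl_scalar d).
Proof. by rewrite waddE; apply/wpiP/weq_CD. Qed.

Let wCM c d : weyl_scalar (c * d) = weyl_mul (weyl_scalar c) (weyl_scalar d).
Proof. by rewrite wmulE; apply/wpiP/weq_CM. Qed.

Let waddN : left_inverse (weyl_scalar 0) weyl_opp weyl_add.
Proof.
move=> a; rewrite /weyl_opp -{2}(wmul1 a) -wmulDl -wCD addNr.
by elim/wind: a => s; rewrite wmulE; apply/wpiP/weq_mul0.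
Qed.

HB.instance Definition _ := GRing.isZmodule.Build weyl waddA waddC wadd0 waddN.

Section Operators.
Variables (V : lmodType K) (x d : 'I_n -> V -> V).

Fixpoint term_act (t : weyl_term) (v : V) : V :=
  match t with
  | WC c => c *: v
  | WX i => x i v
  | WD i => d i v
  | WAdd s t => term_act s v + term_act t v
  | WMul s t => term_act s (term_act t v)
  end.

Record weyl_operators : Prop := WeylOperators {
  wop_x_linear : forall i, linear (x i);
  wop_d_linear : forall i, linear (d i);
  wop_xx : forall i j v, x i (x j v) = x j (x i v);
  wop_dd : forall i j v, d i (d j v) = d j (d i v);
  wop_dx : forall i j v, d i (x j v) = x j (d i v) + (i == j)%:R *: v
}.

Lemma term_act_linear : weyl_operators -> forall t, linear (term_act t).
Proof.
move=> W; elim=> [c|i|i|s IHs t IHt|s IHs t IHt] e u v /=.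
- by rewrite scalerDr !scalerA mulrC.
- exact: wop_x_linear.
- exact: wop_d_linear.
- by rewrite IHs IHt scalerDr addrACA.
- by rewrite IHt IHs.
Qed.

Lemma term_act_eq : weyl_operators ->
  forall s t, weyl_eq s t -> term_act s =1 term_act t.
Proof.
move=> W s t; have lin := term_act_linear W.
elim=> //= {s t}.
- by move=> s t _ st v; rewrite st.
- by move=> s t u _ st _ tu v; rewrite st tu.
- by move=> s s' t t' _ ss' _ tt' v; rewrite ss' tt'.
- by move=> s s' t t' _ ss' _ tt' v; rewrite tt' ss'.
- by move=> s t u v; rewrite addrA.
- by move=> s t v; rewrite addrC.
- by move=> t v; rewrite scale0r add0r.
- by move=> t v; rewrite !scale0r.
- by move=> t v; rewrite scale1r.
- by move=> s t u v; have := lin s 1 (term_act t v) (term_act u v);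
    rewrite !scale1r.
- by move=> a b v; rewrite scalerDl.
- by move=> a b v; rewrite scalerA.
- move=> a t v; have t0 : term_act t 0 = 0.
    by have := lin t (-1) 0 0; rewrite scaler0 addr0 scaleN1r addNr.
  by have := lin t a v 0; rewrite t0 !addr0.
- by move=> i j v; apply: wop_xx.
- by move=> i j v; apply: wop_dd.
- by move=> i j v; apply: wop_dx.
Qed.

Definition weyl_act (a : weyl) (v : V) : V := term_act (repr a) v.

Lemma weyl_act_pi : weyl_operators ->
  forall t v, weyl_act (\pi_weyl t) v = term_act t v.
Proof. by move=> W t v; exact: (term_act_eq W (wrepr t)). Qed.
End Operators.

Section PolynomialOperators.
Implicit Types (i j : 'I_n) (p : {mpoly K[n]}).

Definition poly_x i p := 'X_i * p.
Definition poly_d i p := p^`M(i).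

Lemma poly_operators : weyl_operators poly_x poly_d.
Proof.
rewrite /poly_x /poly_d; split=> [i c p q|i c p q|i j p|i j p|i j p].
- by rewrite mulrDr scalerAr.
- exact: linearP.
- by rewrite mulrCA.
- exact: mderiv_comm.
by rewrite mderivM mderiv_var eq_sym addrC mulr_natl scaler_nat.
Qed.
End PolynomialOperators.

Let wone_neq0 : weyl_scalar 1 != 0 :> weyl.
Proof.
apply/eqP=> e10; have := weyl_act_pi poly_operators (WC 1) 1.
rewrite -/(weyl_scalar 1) e10 (weyl_act_pi poly_operators (WC 0)) /=.
by rewrite scale0r scale1r => /esym/eqP; rewrite oner_eq0.
Qed.

HB.instance Definition _ := GRing.Zmodule_isNzRing.Build weyl
  wmulA wmul1 wmulr1 wmulDl wmulDr wone_neq0.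

Definition weyl_scale (c : K) (a : weyl) : weyl := weyl_scalar c * a.

Let wscaleA c d a : weyl_scale c (weyl_scale d a) = weyl_scale (c * d) a.
Proof. by rewrite /weyl_scale mulrA; congr (_ * _); apply/esym/wCM. Qed.
Let wscale1 : left_id 1 weyl_scale.
Proof. by move=> a; apply: wmul1. Qed.
Let wscaleDr : right_distributive weyl_scale +%R.
Proof. by move=> c a b; apply: wmulDr. Qed.
Let wscaleDl a : {morph weyl_scale^~ a : c d / c + d}.
Proof. by move=> c d; rewrite /weyl_scale -mulrDl; congr (_ * _); apply: wCD. Qed.
HB.instance Definition _ := GRing.Zmodule_isLmodule.Build K weyl
  wscaleA wscale1 wscaleDr wscaleDl.

Let wscaleAl c (a b : weyl) : c *: (a * b) = c *: a * b.
Proof. exact: wmulA. Qed.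
HB.instance Definition _ := GRing.Lmodule_isLalgebra.Build K weyl wscaleAl.

Let wscaleAr c (a b : weyl) : c *: (a * b) = a * (c *: b).
Proof.
rewrite -[c *: b]/(weyl_scalar c * b) -[LHS]/(weyl_scalar c * (a * b)) !mulrA.
by congr (_ * _); apply: wCC.
Qed.
HB.instance Definition _ := GRing.Lalgebra_isAlgebra.Build K weyl wscaleAr.

Definition weyl_x (i : 'I_n) : weyl := \pi_weyl (WX i).
Definition weyl_d (i : 'I_n) : weyl := \pi_weyl (WD i).


Lemma weyl_xx i j : weyl_x i * weyl_x j = weyl_x j * weyl_x i.
Proof. by rewrite [LHS]wmulE [RHS]wmulE; apply/wpiP/weq_XX. Qed.

Lemma weyl_dd i j : weyl_d i * weyl_d j = weyl_d j * weyl_d i.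
Proof. by rewrite [LHS]wmulE [RHS]wmulE; apply/wpiP/weq_DD. Qed.

Lemma weyl_dx i j : weyl_d i * weyl_x j = weyl_x j * weyl_d i + (i == j)%:R.
Proof.
have -> : (i == j)%:R = weyl_scalar (i == j)%:R by case: eqP.
rewrite [LHS]wmulE [X in _ = X + _]wmulE [RHS]waddE.
exact/wpiP/weq_DX.
Qed.

Section Action.
Variables (V : lmodType K) (x d : 'I_n -> V -> V).
Hypothesis W : weyl_operators x d.
Local Notation act := (weyl_act x d).

Let actE := weyl_act_pi W.

Lemma weyl_act_linear a : linear (act a).
Proof. exact: term_act_linear. Qed.

Lemma weyl_actDr a : {morph act a : u v / u + v}.
Proof. by move=> u v; have := weyl_act_linear a 1 u v; rewrite !scale1r. Qed.

Lemma weyl_actDl v : {morph act^~ v : a b / a + b}.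
Proof.
by elim/wind=> s; elim/wind=> t; rewrite [s in act s]waddE !actE.
Qed.

Lemma weyl_actM a b v : act (a * b) v = act a (act b v).
Proof.
by elim/wind: a => s; elim/wind: b => t; rewrite [s in act s]wmulE !actE.
Qed.

Lemma weyl_actC c v : act (weyl_scalar c) v = c *: v.
Proof. by rewrite actE. Qed.

Lemma weyl_act1 v : act 1 v = v.
Proof. by rewrite weyl_actC scale1r. Qed.

Lemma weyl_actZ c a v : act (c *: a) v = c *: act a v.
Proof. by rewrite weyl_actM weyl_actC. Qed.

Lemma weyl_act_x i v : act (weyl_x i) v = x i v.
Proof. by rewrite actE. Qed.

Lemma weyl_act_d i v : act (weyl_d i) v = d i v.
Proof. by rewrite actE. Qed.
End Action.

Section Lift.
Variables (B : algType K) (x d : 'I_n -> B).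

Record weyl_generators : Prop := WeylGenerators {
  wgen_xx : forall i j, x i * x j = x j * x i;
  wgen_dd : forall i j, d i * d j = d j * d i;
  wgen_dx : forall i j, d i * x j = x j * d i + (i == j)%:R
}.

Hypothesis W : weyl_generators.

Let ox i (u : B) := x i * u.
Let od i (u : B) := d i * u.

Let Wop : weyl_operators ox od.
Proof.
rewrite /ox /od; split=> [i c u v|i c u v|i j u|i j u|i j u].
- by rewrite mulrDr scalerAr.
- by rewrite mulrDr scalerAr.
- by rewrite !mulrA wgen_xx.
- by rewrite !mulrA wgen_dd.
by rewrite !mulrA wgen_dx // mulrDl scaler_nat mulr_natl.
Qed.

Let actMr a u w : weyl_act ox od a (u * w) = weyl_act ox od a u * w.
Proof.
rewrite /weyl_act; elim: (repr a) u => [c|i|i|s IHs t IHt|s IHs t IHt] u /=.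
- by rewrite scalerAl.
- by rewrite /ox mulrA.
- by rewrite /od mulrA.
- by rewrite IHs IHt mulrDl.
by rewrite IHt IHs.
Qed.

Definition weyl_lift of weyl_generators := fun a : weyl => weyl_act ox od a 1.
Local Notation lift := (weyl_lift W).

Let lift_zmod : zmod_morphism lift.
Proof.
move=> a b; rewrite /weyl_lift -scaleN1r (weyl_actDl Wop) (weyl_actZ Wop).
by rewrite scaleN1r.
Qed.
Let lift_monoid : monoid_morphism lift.
Proof.
split=> [|a b]; rewrite /weyl_lift; first by rewrite (weyl_act1 Wop).
by rewrite (weyl_actM Wop) -actMr mul1r.
Qed.
Let lift_scalable : scalable lift.
Proof. by move=> c a; rewrite /weyl_lift (weyl_actZ Wop). Qed.

HB.instance Definition _ := GRing.isZmodMorphism.Build weyl B lift lift_zmod.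
HB.instance Definition _ := GRing.isMonoidMorphism.Build weyl B lift lift_monoid.
HB.instance Definition _ := GRing.isScalable.Build K weyl B *:%R lift lift_scalable.

Lemma weyl_lift_x i : lift (weyl_x i) = x i.
Proof. by rewrite /weyl_lift (weyl_act_x Wop) /ox mulr1. Qed.

Lemma weyl_lift_d i : lift (weyl_d i) = d i.
Proof. by rewrite /weyl_lift (weyl_act_d Wop) /od mulr1. Qed.
End Lift.

(* An alias of {mpoly K[n]}, which is already an lmodType over K. *)
Definition polymod : Type := {mpoly K[n]}.
HB.instance Definition _ := GRing.Zmodule.on polymod.

Definition polymod_scale (a : weyl) (p : polymod) : polymod :=
  weyl_act poly_x poly_d a p.

Let polymodA a b p :
  polymod_scale a (polymod_scale b p) = polymod_scale (a * b) p.
Proof. by rewrite /polymod_scale (weyl_actM poly_operators). Qed.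
Let polymod1 : left_id 1 polymod_scale.
Proof. by move=> p; rewrite /polymod_scale (weyl_act1 poly_operators). Qed.
Let polymodDr : right_distributive polymod_scale +%R.
Proof. by move=> a p q; apply: (weyl_actDr poly_operators). Qed.
Let polymodDl p : {morph polymod_scale^~ p : a b / a + b}.
Proof. by move=> a b; apply: (weyl_actDl poly_operators). Qed.
HB.instance Definition _ := GRing.Zmodule_isLmodule.Build weyl polymod
  polymodA polymod1 polymodDr polymodDl.

Lemma polymod_x i (p : polymod) : weyl_x i *: p = 'X_i * (p : {mpoly K[n]}).
Proof. exact: (weyl_act_x poly_operators). Qed.

Lemma polymod_d i (p : polymod) : weyl_d i *: p = (p : {mpoly K[n]})^`M(i).
Proof. exact: (weyl_act_d poly_operators). Qed.

Definition weyl_poly (p : {mpoly K[n]}) : weyl := mmap (in_alg weyl) weyl_x p.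

Lemma weyl_poly0 : weyl_poly 0 = 0.
Proof. exact: raddf0. Qed.

Lemma weyl_polyD p q : weyl_poly (p + q) = weyl_poly p + weyl_poly q.
Proof. exact: raddfD. Qed.

Lemma weyl_polyB p q : weyl_poly (p - q) = weyl_poly p - weyl_poly q.
Proof. exact: raddfB. Qed.

Lemma weyl_poly_sum (I : Type) (r : seq I) (F : I -> {mpoly K[n]}) :
  weyl_poly (\sum_(i <- r) F i) = \sum_(i <- r) weyl_poly (F i).
Proof. exact: raddf_sum. Qed.

Lemma weyl_polyZ c p : weyl_poly (c *: p) = c *: weyl_poly p.
Proof. by rewrite /weyl_poly mmapZ mulr_algl. Qed.

Lemma weyl_poly1 : weyl_poly 1 = 1.
Proof. by rewrite /weyl_poly -mpolyC1 mmapC /= scale1r. Qed.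

Lemma weyl_polyX i : weyl_poly 'X_i = weyl_x i.
Proof. by rewrite /weyl_poly mmapX mmap1U. Qed.

Let weyl_xC i j k l : GRing.comm (weyl_x i ^+ k) (weyl_x j ^+ l).
Proof. by apply: commrX; apply/commr_sym/commrX; apply: weyl_xx. Qed.

Lemma weyl_polyM p q : weyl_poly (p * q) = weyl_poly p * weyl_poly q.
Proof.
have MX m m' : weyl_poly ('X_[m] * 'X_[m']) = weyl_poly 'X_[m] * weyl_poly 'X_[m'].
  rewrite -mpolyXD /weyl_poly !mmapX /mmap1 -prodrM_comm //.
  by apply: eq_bigr => i _; rewrite mnmDE exprD.
elim/mpolyind: p => [|c m p _ _ IHp]; first by rewrite !(weyl_poly0, mul0r).
rewrite mulrDl !weyl_polyD IHp mulrDl; congr (_ + _).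
elim/mpolyind: q {IHp p} => [|d m' q _ _ IHq]; first by rewrite !(weyl_poly0, mulr0).
rewrite mulrDr !weyl_polyD IHq mulrDr; congr (_ + _).
by rewrite -scalerAl -scalerAr !weyl_polyZ MX -scalerAl -scalerAr.
Qed.

Lemma mpoly_gen_ind (P : {mpoly K[n]} -> Prop) :
  (forall p q, P p -> P q -> P (p + q)) -> (forall c p, P p -> P (c *: p)) ->
  (forall p q, P p -> P q -> P (p * q)) ->
  P 1 -> (forall i, P 'X_i) -> forall p, P p.
Proof.
move=> PD PZ PM P1 PX; elim/mpolyind => [|c m p _ _ IHp].
  by rewrite -(scale0r 1); apply: PZ.
apply: PD => //; apply: PZ; rewrite mpolyXE_id.
apply: big_ind => // i _; elim: (m i) => [|k IHk]; first by rewrite expr0.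
by rewrite exprS; apply: PM.
Qed.

Lemma weyl_d_poly i p :
  weyl_d i * weyl_poly p = weyl_poly p * weyl_d i + weyl_poly p^`M(i).
Proof.
elim/mpoly_gen_ind: p => [p q IHp IHq|c p IHp|p q IHp IHq||j].
- by rewrite mderivD !weyl_polyD mulrDl mulrDr IHp IHq addrACA.
- by rewrite mderivZ !weyl_polyZ -scalerAr -scalerAl IHp scalerDr.
- rewrite mderivM weyl_polyD !weyl_polyM mulrA IHp mulrDl -!mulrA IHq mulrDr.
  by rewrite !mulrA -!addrA [X in _ = _ + X]addrC.
- by rewrite weyl_poly1 -mpolyC1 mderivC weyl_poly0 addr0 mul1r mulr1.
rewrite mderiv_var weyl_polyX weyl_dx eq_sym; congr (_ + _).
by case: eqP => _; rewrite ?weyl_poly1 ?weyl_poly0.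
Qed.

Lemma polymod_poly p (q : polymod) : weyl_poly p *: q = p * (q : {mpoly K[n]}).
Proof.
elim/mpoly_gen_ind: p q => [p p' IH IH'|c p IH|p p' IH IH'||i] q.
- by rewrite weyl_polyD scalerDl IH IH' mulrDl.
- rewrite weyl_polyZ -[LHS]/(weyl_act poly_x poly_d _ _).
  by rewrite (weyl_actZ poly_operators) -scalerAl -IH.
- by rewrite weyl_polyM -scalerA IH' IH mulrA.
- by rewrite weyl_poly1 scale1r mul1r.
by rewrite weyl_polyX polymod_x.
Qed.
End WeylAlgebra.

Section JacobianMaps.
Variables (n : nat) (K : fieldType).
Local Notation P := {mpoly K[n]}.

Definition jacobian_mx (f : 'I_n -> P) : 'M[P]_n := \matrix_(k, j) (f k)^`M(j).

Variable sigma : {lrmorphism P -> P}.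

Definition endo_jacobian_mx : 'M[P]_n := jacobian_mx (fun k => sigma 'X_k).

Definition jacobian_map : Prop :=
  exists2 c : K, c != 0 & \det endo_jacobian_mx = c%:MP.

Definition endo_degree : nat := \max_(i < n) (msize (sigma 'X_i)).-1.

Definition jacobian_der (i : 'I_n) (p : P) : P :=
  (\det endo_jacobian_mx)^-1 *
  \det (jacobian_mx (fun k => if k == i then p else sigma 'X_k)).

(* A derivation D of P_n, as an element of the Weyl algebra, is
   \sum_j D(x_j) d_j (see [jacobian_der_eltE]). *)
Definition jacobian_der_elt (i : 'I_n) : weyl n K :=
  \sum_j weyl_poly (jacobian_der i 'X_j) * weyl_d K j.

Let J := endo_jacobian_mx.

Lemma jacobian_derE i p :
  jacobian_der i p = \sum_j jacobian_der i 'X_j * p^`M(j).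
Proof.
have E q : jacobian_der i q = \sum_j (\det J)^-1 * (q^`M(j) * cofactor J i j).
  rewrite /jacobian_der [X in _ * X](expand_det_row _ i) mulr_sumr.
  apply: eq_bigr => j _.
  set B := jacobian_mx _.
  have -> : cofactor B i j = cofactor J i j.
    apply: (congr1 (fun X => (-1) ^+ (i + j) * \det X)).
    by apply/matrixP=> k l; rewrite !mxE eq_sym (negPf (neq_lift _ _)).
  by rewrite mxE eqxx.
rewrite E; apply: eq_bigr => j _; rewrite E (bigD1 j) //= big1 => [|k jk].
  by rewrite addr0 mderiv_var eqxx mul1r -mulrA [cofactor _ _ _ * _]mulrC.
by rewrite mderiv_var eq_sym (negPf jk) mul0r mulr0.
Qed.

Lemma jacobian_der_eltE i (p : polymod n K) :
  jacobian_der_elt i *: p = jacobian_der i p.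
Proof.
rewrite scaler_suml jacobian_derE; apply: eq_bigr => j _.
by rewrite -scalerA polymod_poly polymod_d.
Qed.

Hypothesis sJ : jacobian_map.

Let uJ : \det J \is a GRing.unit.
Proof.
have [c c0 ->] := sJ; apply/unitrP; exists (c^-1)%:MP.
by rewrite -!mpolyCM mulVf // mulfV.
Qed.

Lemma jacobian_der_sigma i k : jacobian_der i (sigma 'X_k) = (i == k)%:R.
Proof.
rewrite /jacobian_der; have [->|ik] := eqVneq i k.
  have -> : jacobian_mx (fun k0 => if k0 == k then sigma 'X_k else sigma 'X_k0)
    = J by apply/matrixP=> a b; rewrite !mxE; case: eqP => [->|].
  by rewrite mulVr.
rewrite [X in _ * X](determinant_alternate ik) ?mulr0 // => j.
by rewrite !mxE eqxx eq_sym (negPf ik).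
Qed.

Let mulrDA (A : comRingType) (a b c d e : A) :
  a * (b * c + d * e) = a * d * e + a * b * c.
Proof. by rewrite mulrDr addrC !mulrA. Qed.

Let add_uniq (V : zmodType) (a b c : V) : 0 = a + b -> 0 = a + c -> b = c.
Proof. by move=> /esym/eqP + /esym/eqP; rewrite !addr_eq0 => /eqP -> /eqP/oppr_inj. Qed.

Let unitmx_ker (A : comUnitRingType) (B : 'M[A]_n) (u : 'cV[A]_n) :
  B \in unitmx -> B *m u = 0 -> u = 0.
Proof. by move=> uB Bu; rewrite -(mulKmx uB u) Bu mulmx0. Qed.

Let mul_swap (A : nzRingType) (a d b f e : A) :
  d * b = b * d + f -> a * d * (b * e) = a * b * (d * e) + a * f * e.
Proof.
by move=> db; rewrite -mulrA (mulrA d b e) db mulrDl mulrDr !mulrA.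
Qed.

Let mul_swap1 (A : nzRingType) (a d b f : A) :
  d * b = b * d + f -> a * b = b * a -> a * d * b = b * (a * d) + a * f.
Proof. by move=> db ab; rewrite -mulrA db mulrDr !mulrA ab. Qed.

Let symm_sum (A : comRingType) (a b : 'I_n -> A) (c : 'I_n -> 'I_n -> A) :
  (forall j l, c j l = c l j) ->
  \sum_j \sum_l a j * b l * c l j = \sum_j \sum_l b j * a l * c l j.
Proof.
move=> cC; rewrite exchange_big; apply: eq_bigr => j _; apply: eq_bigr => l _.
by rewrite cC [a l * _]mulrC.
Qed.

Let symm_sum2 (A : nzRingType) (f g c : 'I_n -> 'I_n -> A) :
  (forall j l, f j l = g l j) -> (forall j l, c j l = c l j) ->
  \sum_j \sum_l f j l * c j l = \sum_j \sum_l g j l * c j l.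
Proof.
move=> fg cC; rewrite exchange_big; apply: eq_bigr => j _; apply: eq_bigr => l _.
by rewrite cC fg.
Qed.

Let derX2 i k p : jacobian_der i (jacobian_der k p) =
  (\sum_j \sum_l jacobian_der i 'X_j * jacobian_der k 'X_l * p^`M(l)^`M(j)) +
  \sum_l jacobian_der i (jacobian_der k 'X_l) * p^`M(l).
Proof.
rewrite [LHS]jacobian_derE.
transitivity (\sum_j \sum_l (jacobian_der i 'X_j * jacobian_der k 'X_l * p^`M(l)^`M(j)
   + jacobian_der i 'X_j * (jacobian_der k 'X_l)^`M(j) * p^`M(l))).
  apply: eq_bigr => j _; rewrite (jacobian_derE k p) raddf_sum mulr_sumr /=.
  apply: eq_bigr => l _; rewrite mderivM.
  exact: mulrDA.
under eq_bigr do rewrite big_split /=.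
rewrite big_split /=; congr (_ + _); rewrite exchange_big /=.
by apply: eq_bigr => l _; rewrite (jacobian_derE i) mulr_suml.
Qed.

Let der_comm i k l : jacobian_der i (jacobian_der k 'X_l) =
  jacobian_der k (jacobian_der i 'X_l).
Proof.
pose e l := jacobian_der i (jacobian_der k 'X_l)
  - jacobian_der k (jacobian_der i 'X_l).
have symm p : \sum_j \sum_l jacobian_der i 'X_j * jacobian_der k 'X_l * p^`M(l)^`M(j)
  = \sum_j \sum_l jacobian_der k 'X_j * jacobian_der i 'X_l * p^`M(l)^`M(j).
  apply: (symm_sum _ _ (c := fun s t => p^`M(s)^`M(t))) => s t.
  exact: mderiv_comm.
have e0 m : \sum_l e l * (sigma 'X_m)^`M(l) = 0.
  have z a (b : bool) : jacobian_der a b%:R = 0.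
    rewrite jacobian_derE big1 // => j _.
    by case: b; rewrite ?raddf0 -?mpolyC1 ?mderivC mulr0.
  have eik := derX2 i k (sigma 'X_m); have eki := derX2 k i (sigma 'X_m).
  rewrite -symm in eki; rewrite !jacobian_der_sigma !z in eik eki.
  rewrite /e; under eq_bigr do rewrite mulrBl.
  rewrite sumrB; apply/eqP; rewrite subr_eq0; apply/eqP.
  exact: (add_uniq eik eki).
have Je : J *m \col_l e l = 0.
  apply/matrixP=> m o; rewrite !mxE -[RHS](e0 m); apply: eq_bigr => b _.
  by rewrite !mxE mulrC.
have uJ' : J \in unitmx by rewrite unitmxE.
have /matrixP/(_ l ord0) := unitmx_ker uJ' Je; rewrite !mxE.
exact: subr0_eq.
Qed.

Lemma jacobian_generators : weyl_generators
  (fun i => weyl_poly (sigma 'X_i)) jacobian_der_elt.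
Proof.
split=> [i j|i k|i j].
- by rewrite -!weyl_polyM mulrC.
- have E a b : jacobian_der_elt a * jacobian_der_elt b =
      \sum_j \sum_l weyl_poly (jacobian_der a 'X_j * jacobian_der b 'X_l) *
         (weyl_d K j * weyl_d K l)
      + \sum_l weyl_poly (jacobian_der a (jacobian_der b 'X_l)) * weyl_d K l.
    rewrite /jacobian_der_elt mulr_suml.
    transitivity (\sum_j \sum_l
      (weyl_poly (jacobian_der a 'X_j * jacobian_der b 'X_l) *
         (weyl_d K j * weyl_d K l) +
       weyl_poly (jacobian_der a 'X_j * (jacobian_der b 'X_l)^`M(j)) *
         weyl_d K l)).
      apply: eq_bigr => j _; rewrite mulr_sumr; apply: eq_bigr => l _.
      rewrite (weyl_polyM (jacobian_der a 'X_j) (jacobian_der b 'X_l)).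
      rewrite (weyl_polyM (jacobian_der a 'X_j) _^`M(j)).
      by apply: mul_swap; apply: weyl_d_poly.
    under eq_bigr do rewrite big_split /=.
    rewrite big_split /=; congr (_ + _); rewrite exchange_big /=.
    apply: eq_bigr => l _; rewrite (jacobian_derE a) weyl_poly_sum mulr_suml.
    by [].
  apply: etrans (E i k) (etrans _ (esym (E k i))).
  apply: (congr2 +%R); last first.
    by apply: eq_bigr => l _; rewrite (der_comm i k l).
  apply: symm_sum2 => a b; last exact: weyl_dd.
  exact: (congr1 (@weyl_poly n K) (mulrC _ _)).
rewrite /jacobian_der_elt mulr_suml.
transitivity (\sum_l (weyl_poly (sigma 'X_j) *
    (weyl_poly (jacobian_der i 'X_l) * weyl_d K l) +
    weyl_poly (jacobian_der i 'X_l * (sigma 'X_j)^`M(l)))).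
  apply: eq_bigr => l _.
  rewrite (weyl_polyM (jacobian_der i 'X_l) _^`M(l)).
  apply: mul_swap1; first exact: weyl_d_poly.
  by rewrite -!weyl_polyM mulrC.
rewrite big_split /= mulr_sumr; congr (_ + _).
rewrite -weyl_poly_sum -jacobian_derE jacobian_der_sigma.
by case: eqP; rewrite ?weyl_poly1 ?weyl_poly0.
Qed.

Definition weyl_ext : weyl n K -> weyl n K := weyl_lift jacobian_generators.
HB.instance Definition _ := GRing.LRMorphism.on weyl_ext.

Lemma weyl_ext_x i : weyl_ext (weyl_x K i) = weyl_poly (sigma 'X_i).
Proof. exact: weyl_lift_x. Qed.

Lemma weyl_ext_d i : weyl_ext (weyl_d K i) = jacobian_der_elt i.
Proof. exact: weyl_lift_d. Qed.
End JacobianMaps.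

Section Modules.

Definition twisted (A : nzRingType) (s : {rmorphism A -> A}) (M : lmodType A) :
  Type := M.

Section Twist.
Variables (A : nzRingType) (s : {rmorphism A -> A}) (M : lmodType A).
HB.instance Definition _ := GRing.Zmodule.on (twisted s M).

Definition twisted_scale (a : A) (m : twisted s M) : twisted s M :=
  s a *: (m : M).

Let twistedA a b m : twisted_scale a (twisted_scale b m) = twisted_scale (a * b) m.
Proof. by rewrite /twisted_scale scalerA rmorphM. Qed.
Let twisted1 : left_id 1 twisted_scale.
Proof. by move=> m; rewrite /twisted_scale rmorph1 scale1r. Qed.
Let twistedDr : right_distributive twisted_scale +%R.
Proof. by move=> a m m'; apply: scalerDr. Qed.
Let twistedDl m : {morph twisted_scale^~ m : a b / a + b}.
Proof. by move=> a b; rewrite /twisted_scale rmorphD; apply: scalerDl. Qed.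
HB.instance Definition _ := GRing.Zmodule_isLmodule.Build A (twisted s M)
  twistedA twisted1 twistedDr twistedDl.
End Twist.

Section FiniteLength.
Variables (A : nzRingType) (M : lmodType A).

Definition finitely_generated : Prop := exists s : seq M,
  forall m, exists a : 'I_(size s) -> A, m = \sum_i a i *: s`_i.

Definition cyclic_module : Prop := exists m0 : M, forall m, exists a : A, m = a *: m0.

Record composition_series (l : nat) (S : nat -> {pred M}) : Prop := {
  cs_submod : forall i, (i <= l)%N -> GRing.submod_closed (S i);
  cs_bot : S 0%N =i pred1 0;
  cs_top : S l =i predT;
  cs_sub : forall i, (i < l)%N -> {subset S i <= S i.+1};
  cs_proper : forall i, (i < l)%N -> ~ {subset S i.+1 <= S i};
  cs_simple : forall i, (i < l)%N -> forall N : {pred M},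
    GRing.submod_closed N -> {subset S i <= N} -> {subset N <= S i.+1} ->
    {subset N <= S i} \/ {subset S i.+1 <= N}
}.

(* By the Jordan-Hoelder theorem there is at most one such l. *)
Definition has_length (l : nat) : Prop := exists S, composition_series l S.

Definition finite_length : Prop := exists l, has_length l.
End FiniteLength.

Section GelfandKirillov.
Variables (K : fieldType) (A : algType K) (M : lmodType A).

Definition lin_indep (s : seq M) : Prop :=
  forall c : 'I_(size s) -> K,
    \sum_i (c i)%:A *: s`_i = 0 -> forall i, c i = 0.

(* The K-dimension of the K-span of s, as the size of a largest independent
   subfamily. *)
Definition kdim (s : seq M) : nat :=
  \max_(b : (size s).-tuple bool | `[< lin_indep (mask b s) >]) size (mask b s).

(* A spanning family of \sum_(j <= i) V^j M_0, where V and M_0 are the K-spans of v and s. *)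
Fixpoint gk_filtration (v : seq A) (s : seq M) (i : nat) : seq M :=
  if i is j.+1 then
    gk_filtration v s j ++ [seq a *: m | a <- v, m <- gk_filtration v s j]
  else s.

Variable R : realType.

(* inf { r | f i <= i ^ r for i >> 0 } = limsup (log (f i) / log i) *)
Definition growth_degree (f : nat -> nat) : extended R :=
  ereal.ereal_inf [set x | exists2 r : R, x = EFin r &
    exists N : nat, forall i : nat,
      (N <= i)%N -> (f i)%:R <= exp.powR i%:R r]%classic.

Definition gk_dim : extended R :=
  ereal.ereal_sup [set x | exists (v : seq A) (s : seq M),
    x = growth_degree (fun i => kdim (gk_filtration v s i))]%classic.
End GelfandKirillov.

Definition holonomic (R : realType) (n : nat) (K : fieldType)
    (M : lmodType (weyl n K)) : Prop :=
  finitely_generated M /\ gk_dim M R = EFin n%:R.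
End Modules.

(* Main.v *)
(* The module M is filtered by degree: x_i' raises degrees by at most d, and d_i'
   by at most (n-1)(d-1) - 1, because its coefficients are minors of the Jacobian
   matrix.  For q outside a submodule N, the monomials of the Weyl algebra that are
   standard for q modulo N are closed under division, and by the Bernstein
   inequality they contain a full coordinate orthant of dimension n.  The strict
   inclusions of a chain of l submodules thus contribute l linearly independent
   families of about k^n / n! elements of degree at most m k + O(1), out of a space
   of dimension about (m k)^n / n!, whence l <= m^n.  Cyclicity follows from the
   simplicity of the Weyl algebra.

   This requires (n-1)(d-1) <= m + 1, which only fails for some d = 2.  In that case
   sigma is surjective (Wang), and M is simple: the identity
   F(y) - F(x) = J((x+y)/2) (y - x) shows that x_i - y_i lies in the ideal generated
   by the F_j(y) - F_j(x), so that, by descent of a linear system from K(x) to K(F),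
   each x_i is a fraction of polynomials in F; and the denominator is a constant,
   because a prime divisor of it in K[x] would contract to an ideal of K[F]
   containing two coprime polynomials. *)

Require Import Defs.
From HB Require Import structures.
From mathcomp Require Import all_boot all_order all_algebra.
From mathcomp Require Import boolp reals.
From mathcomp Require constructive_ereal ereal exp.
(* The notation levels of mathcomp-analysis and multinomials are incompatible. *)
Import -(notations) constructive_ereal ereal exp.
From mathcomp Require Import mpoly zify ring.

Set Implicit Arguments.
Unset Strict Implicit.
Unset Printing Implicit Defensive.

Import Order.TTheory GRing.Theory Num.Theory.
Local Open Scope ring_scope.
Local Open Scope quotient_scope.

(** * Normally ordered operators *)

Section Symbols.
Variables (n : nat) (K : fieldType).
Local Notation A := (weyl n K).

(** The bound [m ^ n] needs an exact leading coefficient. If each factor of a chain were only known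
    to grow like [c * k ^ n] with some [c > 0], its length would be bounded, but not by [m ^ n].
    Classically one uses that the multiplicity, read off a Hilbert polynomial, is a positive
    integer. Here an orthant of standard monomials plays that role: it has exactly ['C(n + k, n)]
    elements of degree at most [k], the growth of multiplicity one. The Bernstein inequality only
    has to exclude that every orthant of standard monomials has dimension less than [n], and a crude
    count suffices for this.

    The number [(d - 1) ^ (n - 1) - 1] enters only through [N * k <= k ^ N] for [k = d - 1] and
    [N = n - 1], where [k >= 2] is assumed. For [d = 2] one has [m = 2], while the degree estimate
    for the derivations is [n - 2], which is too large once [n > 4]; there the length is found to be
    one instead of being estimated by growth.

    Finite length and cyclicity use the growth argument with a cruder constant that works for every
    [d]. *)

Definition weyl_dpoly (p : {mpoly K[n]}) : A := mmap (in_alg A) (weyl_d K) p.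

Lemma weyl_dpoly_is_zmod : zmod_morphism weyl_dpoly.
Proof. exact: mmap_is_additive. Qed.
HB.instance Definition _ :=
  GRing.isZmodMorphism.Build {mpoly K[n]} A weyl_dpoly weyl_dpoly_is_zmod.

Lemma weyl_dpoly_monoid : monoid_morphism weyl_dpoly.
Proof.
have dC (i j : 'I_n) k l : GRing.comm (weyl_d K i ^+ k) (weyl_d K j ^+ l).
  by apply: commrX; apply/commr_sym/commrX; apply: weyl_dd.
split=> [|p q]; first by rewrite /weyl_dpoly -mpolyC1 mmapC /= scale1r.
have MX m m' : weyl_dpoly ('X_[m] * 'X_[m']) = weyl_dpoly 'X_[m] * weyl_dpoly 'X_[m'].
  rewrite -mpolyXD /weyl_dpoly !mmapX /mmap1 -prodrM_comm //.
  by apply: eq_bigr => i _; rewrite mnmDE exprD.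
have DZ c r : weyl_dpoly (c *: r) = c *: weyl_dpoly r.
  by rewrite /weyl_dpoly mmapZ mulr_algl.
elim/mpolyind: p => [|c m p _ _ IHp]; first by rewrite !(raddf0, mul0r).
rewrite mulrDl !raddfD /= IHp mulrDl; congr (_ + _).
elim/mpolyind: q {IHp p} => [|d m' q _ _ IHq]; first by rewrite !(raddf0, mulr0).
rewrite mulrDr !raddfD /= IHq mulrDr; congr (_ + _).
by rewrite -scalerAl -scalerAr !DZ MX -scalerAl -scalerAr.
Qed.
HB.instance Definition _ :=
  GRing.isMonoidMorphism.Build {mpoly K[n]} A weyl_dpoly weyl_dpoly_monoid.

Lemma weyl_dpolyZ c p : weyl_dpoly (c *: p) = c *: weyl_dpoly p.
Proof. by rewrite /weyl_dpoly mmapZ mulr_algl. Qed.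

Lemma weyl_dpolyX i : weyl_dpoly 'X_i = weyl_d K i.
Proof. by rewrite /weyl_dpoly mmapX mmap1U. Qed.

Lemma weyl_dpoly_x p i :
  weyl_dpoly p * weyl_x K i = weyl_x K i * weyl_dpoly p + weyl_dpoly p^`M(i).
Proof.
elim/mpoly_gen_ind: p => [p q IHp IHq|c p IHp|p q IHp IHq||j].
- by rewrite mderivD !raddfD /= mulrDl mulrDr IHp IHq addrACA.
- by rewrite mderivZ !weyl_dpolyZ -scalerAr -scalerAl IHp scalerDr.
- rewrite mderivM raddfD /= !rmorphM /= -mulrA IHq mulrDr !mulrA IHp mulrDl.
  by rewrite !addrA.
- by rewrite rmorph1 -mpolyC1 mderivC raddf0 addr0 mul1r mulr1.
rewrite mderiv_var weyl_dpolyX weyl_dx; congr (_ + _).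
by case: eqP => _; rewrite ?rmorph1 ?raddf0.
Qed.

Definition weyl_gen (i : 'I_(n + n)) : A :=
  match split i with inl j => weyl_x K j | inr j => weyl_d K j end.

(* The normally ordered operator, derivations to the right, with symbol [s]:
   the first [n] variables stand for the [x_i], the last [n] for the [d_i]. *)
Definition weyl_op (s : {mpoly K[n + n]}) : A := mmap (in_alg A) weyl_gen s.

Lemma weyl_op_is_zmod : zmod_morphism weyl_op.
Proof. exact: mmap_is_additive. Qed.
HB.instance Definition _ :=
  GRing.isZmodMorphism.Build {mpoly K[n + n]} A weyl_op weyl_op_is_zmod.

Lemma weyl_op_is_scalable : scalable weyl_op.
Proof. by move=> c s; rewrite /weyl_op mmapZ mulr_algl. Qed.
HB.instance Definition _ :=
  GRing.isScalable.Build K {mpoly K[n + n]} A *:%R weyl_op weyl_op_is_scalable.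

Lemma weyl_opC c : weyl_op c%:MP = c%:A.
Proof. exact: mmapC. Qed.

Lemma weyl_op_ind (P : {mpoly K[n + n]} -> Prop) :
  (forall s t, P s -> P t -> P (s + t)) -> (forall c s, P s -> P (c *: s)) ->
  (forall m, P 'X_[m]) -> forall s, P s.
Proof.
move=> PD PZ PX; elim/mpolyind=> [|c m p _ _ IH]; last by apply: PD => //; apply: PZ.
by rewrite -(scale0r 'X_[0%MM]); apply: PZ.
Qed.

Let ml (m : 'X_{1..n + n}) := [multinom m (lshift n i) | i < n].
Let mr (m : 'X_{1..n + n}) := [multinom m (rshift n i) | i < n].

Let opX m : weyl_op 'X_[m] = weyl_poly 'X_[ml m] * weyl_dpoly 'X_[mr m].
Proof.
rewrite /weyl_op /weyl_poly /weyl_dpoly !mmapX /mmap1 big_split_ord /=.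
congr (_ * _); apply: eq_bigr => i _; rewrite mnmE /weyl_gen; congr (_ ^+ _).
  by rewrite -[lshift n i]/(unsplit (inl i)) unsplitK.
by rewrite -[rshift n i]/(unsplit (inr i)) unsplitK.
Qed.

Let mlD i m : ml (U_(lshift n i) + m)%MM = (U_(i) + ml m)%MM.
Proof.
apply/mnmP=> j; rewrite !(mnmE, mnmDE); congr (_ + _)%N.
Qed.
Let mlD' i m : ml (U_(rshift n i) + m)%MM = ml m.
Proof. by apply/mnmP=> j; rewrite !(mnmE, mnmDE) eq_rlshift. Qed.
Let mrD i m : mr (U_(lshift n i) + m)%MM = mr m.
Proof. by apply/mnmP=> j; rewrite !(mnmE, mnmDE) eq_lrshift. Qed.
Let mrD' i m : mr (U_(rshift n i) + m)%MM = (U_(i) + mr m)%MM.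
Proof.
by apply/mnmP=> j; rewrite !(mnmE, mnmDE); congr (_ + _)%N; rewrite eq_rshift.
Qed.
Let mlB i m : ml (m - U_(lshift n i))%MM = (ml m - U_(i))%MM.
Proof. by apply/mnmP=> j; rewrite !(mnmE, mnmBE). Qed.
Let mlB' i m : ml (m - U_(rshift n i))%MM = ml m.
Proof. by apply/mnmP=> j; rewrite !(mnmE, mnmBE) eq_rlshift subn0. Qed.
Let mrB i m : mr (m - U_(lshift n i))%MM = mr m.
Proof. by apply/mnmP=> j; rewrite !(mnmE, mnmBE) eq_lrshift subn0. Qed.
Let mrB' i m : mr (m - U_(rshift n i))%MM = (mr m - U_(i))%MM.
Proof. by apply/mnmP=> j; rewrite !(mnmE, mnmBE) eq_rshift. Qed.

Lemma weyl_x_op i s : weyl_x K i * weyl_op s = weyl_op ('X_(lshift n i) * s).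
Proof.
elim/weyl_op_ind: s => [s t IHs IHt|c s IHs|m].
- by rewrite mulrDr !raddfD /= mulrDr IHs IHt.
- by rewrite -scalerAr !linearZ /= -IHs scalerAr.
by rewrite -mpolyXD !opX mlD mrD mpolyXD weyl_polyM weyl_polyX mulrA.
Qed.

Lemma weyl_d_op i s : weyl_d K i * weyl_op s =
  weyl_op ('X_(rshift n i) * s) + weyl_op s^`M(lshift n i).
Proof.
elim/weyl_op_ind: s => [s t IHs IHt|c s IHs|m].
- by rewrite mderivD !(mulrDr, raddfD) /= IHs IHt addrACA.
- by rewrite mderivZ -scalerAr !linearZ /= -scalerDr -IHs scalerAr.
rewrite -mpolyXD mderivX linearZ /= !opX mlD' mrD' mlB mrB.
rewrite mulrA weyl_d_poly mulrDl -mulrA; congr (_ + _).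
  by rewrite mpolyXD rmorphM /= weyl_dpolyX.
by rewrite mderivX weyl_polyZ scalerAl mnmE.
Qed.

(** Commutators with generators act on symbols as partial derivatives in the dual variable, here and
    in [weyl_op_d]. They therefore lower the order of an operator, which drives the proof of
    simplicity. *)
Lemma weyl_op_x i s :
  weyl_op s * weyl_x K i = weyl_x K i * weyl_op s + weyl_op s^`M(rshift n i).
Proof.
elim/weyl_op_ind: s => [s t IHs IHt|c s IHs|m].
- by rewrite mderivD !(mulrDr, raddfD) /= mulrDl IHs IHt addrACA.
- by rewrite mderivZ !linearZ /= -!(scalerAl, scalerAr) -scalerDr IHs.
rewrite mderivX linearZ /= !opX mlB' mrB'.
rewrite -mulrA weyl_dpoly_x mulrDr !mulrA; congr (_ + _).
  by congr (_ * _); rewrite -weyl_polyX -!weyl_polyM mulrC.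
by rewrite mderivX weyl_dpolyZ scalerAr mnmE.
Qed.

Lemma weyl_op_d i s :
  weyl_d K i * weyl_op s = weyl_op s * weyl_d K i + weyl_op s^`M(lshift n i).
Proof.
elim/weyl_op_ind: s => [s t IHs IHt|c s IHs|m].
- by rewrite mderivD !raddfD /= mulrDl mulrDr IHs IHt addrACA.
- by rewrite mderivZ !linearZ /= -!(scalerAl, scalerAr) -scalerDr IHs.
rewrite mderivX linearZ /= !opX mlB mrB.
rewrite mulrA weyl_d_poly mulrDl; congr (_ + _).
  by rewrite -!mulrA -weyl_dpolyX -!rmorphM /= mulrC.
by rewrite mderivX weyl_polyZ scalerAl mnmE.
Qed.

Let wrepr (t : weyl_term n K) : weyl_eq t (repr (\pi_(weyl n K) t : weyl n K)).
Proof. by apply/asboolP; rewrite -/(weyl_eqb _ _) -eqmodE reprK. Qed.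

Let piD (s t : weyl_term n K) :
  \pi_(weyl n K) (WAdd s t) = \pi_(weyl n K) s + \pi_(weyl n K) t :> weyl n K.
Proof. by apply/eqmodP/asboolP/weq_add; apply: wrepr. Qed.

Let piM (s t : weyl_term n K) :
  \pi_(weyl n K) (WMul s t) = (\pi_(weyl n K) s : weyl n K) * \pi_(weyl n K) t.
Proof. by apply/eqmodP/asboolP/weq_mul; apply: wrepr. Qed.

Lemma weyl_op_surj a : exists s, a = weyl_op s.
Proof.
(* Left multiplication on an arbitrary normally ordered operator, so that the induction on terms
   passes through products. *)
suff H (t : weyl_term n K) s :
    exists s', (\pi_(weyl n K) t : weyl n K) * weyl_op s = weyl_op s'.
  have [s' E] := H (repr a) 1; exists s'; rewrite -E.
  by rewrite reprK -mpolyC1 weyl_opC scale1r mulr1.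
elim: t s => [c|i|i|t1 IH1 t2 IH2|t1 IH1 t2 IH2] s.
- by exists (c *: s); rewrite linearZ.
- by exists ('X_(lshift n i) * s); rewrite -weyl_x_op.
- by exists ('X_(rshift n i) * s + s^`M(lshift n i)); rewrite raddfD /= -weyl_d_op.
- have [[s1 E1] [s2 E2]] := (IH1 s, IH2 s); exists (s1 + s2).
  by rewrite piD raddfD /= -E1 -E2 -mulrDl.
have [s2 E2] := IH2 s; have [s1 E1] := IH1 s2; exists s1.
by rewrite piM -E1 -E2 mulrA.
Qed.

End Symbols.

(** * Simplicity of the Weyl algebra *)

Section Kernel.
Variable K : fieldType.

Lemma linear_system_kernel (I J : finType) (F : I -> J -> K) :
  (#|J| < #|I|)%N ->
  exists2 c : I -> K, (exists i, c i != 0) & forall j, \sum_i c i * F i j = 0.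
Proof.
move=> ltJI.
pose M := \matrix_(i < #|I|, j < #|J|) F (enum_val i) (enum_val j).
have : kermx M != 0.
  rewrite -mxrank_eq0 mxrank_ker -lt0n subn_gt0.
  exact: leq_ltn_trans (rank_leq_col M) ltJI.
case/rowV0Pn=> v /sub_kermxP vM v0.
exists (fun i => v 0 (enum_rank i)).
  have [i vi|v00] := pickP (fun i => v 0 i != 0).
    by exists (enum_val i); rewrite enum_valK.
  by case/eqP: v0; apply/rowP=> i; rewrite mxE; apply/eqP/negbFE; exact: v00.
move=> j; have /rowP/(_ (enum_rank j)) := vM; rewrite !mxE => E.
rewrite -[RHS]E (reindex (@enum_val I predT)); last exact: onW_bij (enum_val_bij I).
by apply: eq_bigr => i _; rewrite !mxE enum_valK enum_rankK.
Qed.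
End Kernel.

Section MpolySize.
Variables (n : nat) (K : fieldType).
Implicit Types p q : {mpoly K[n]}.

Lemma msize_leP k p :
  (msize p <= k)%N <-> (forall m, m \in msupp p -> (mdeg m < k)%N).
Proof.
split=> [pk m /msize_mdeg_lt mp|H]; first exact: leq_trans mp pk.
by rewrite msizeE; apply/bigmax_leqP_seq => m mp _; apply: H.
Qed.

Lemma msizeD k p q : (msize p <= k)%N -> (msize q <= k)%N -> (msize (p + q) <= k)%N.
Proof. by move=> pk qk; apply: leq_trans (mmeasureD_le _ _ _) _; rewrite geq_max pk. Qed.

Lemma msize_sum_le (I : Type) (r : seq I) (P : pred I) (F : I -> {mpoly K[n]}) k :
  (forall i, P i -> (msize (F i) <= k)%N) ->
  (msize (\sum_(i <- r | P i) F i) <= k)%N.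
Proof.
move=> Fk; elim/big_ind: _ => [|p q|//]; first by rewrite mmeasure0.
exact: msizeD.
Qed.

Lemma msize_mderiv i p : (msize p^`M(i) <= (msize p).-1)%N.
Proof.
apply/msize_leP => m; rewrite mcoeff_msupp mcoeff_mderiv => mi.
have : (m + U_(i))%MM \in msupp p.
  by rewrite mcoeff_msupp; apply: contraNN mi => /eqP ->; rewrite mul0rn.
by move/msize_mdeg_lt; rewrite mdegD mdeg1 addn1; case: (msize p).
Qed.

Lemma msizeM_leq p q a b :
  (msize p <= a.+1)%N -> (msize q <= b.+1)%N -> (msize (p * q) <= (a + b).+1)%N.
Proof.
move=> pa qb; have [->|p0] := eqVneq p 0; first by rewrite mul0r mmeasure0.
have [->|q0] := eqVneq q 0; first by rewrite mulr0 mmeasure0.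
rewrite (msizeM p0 q0) -ltnS prednK ?addn_gt0 ?lt0n ?mmeasure_poly_eq0 ?p0 //.
by apply: leq_trans (leq_add pa qb) _; rewrite addSn addnS.
Qed.

Lemma mderiv_neq0 p : [pchar K] =i pred0 ->
  (1 < msize p)%N -> exists i, p^`M(i) != 0.
Proof.
move=> /pcharf0P cK p1; have p0 : p != 0.
  by apply: contraTneq p1 => ->; rewrite mmeasure0.
have : (0 < mdeg (mlead p))%N by rewrite -ltnS (mlead_deg p0).
rewrite lt0n mdegE sum_nat_eq0 negb_forall => /existsP[i] /=; rewrite -lt0n => mi.
exists i; apply/eqP => /(congr1 (mcoeff (mlead p - U_(i)))).
rewrite mcoeff_mderiv mcoeff0 submK ?lep1mP -?lt0n // => /eqP.
by rewrite -mulr_natl mulf_eq0 cK orFb mleadc_eq0 (negPf p0).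
Qed.

End MpolySize.

Section Submodule.
Variables (n : nat) (K : fieldType) (V : lmodType (weyl n K)) (N : {pred V}).
Hypothesis subN : GRing.submod_closed N.

Lemma submod0 : 0 \in N. Proof. exact: subN.1. Qed.

Lemma submodD u v : u \in N -> v \in N -> u + v \in N.
Proof. by move=> uN vN; rewrite -[u]scale1r; apply: subN.2. Qed.

Lemma submodZ a u : u \in N -> a *: u \in N.
Proof. by move=> uN; rewrite -[_ *: u]addr0; apply: subN.2 => //; apply: submod0. Qed.

Lemma submodB u v : u \in N -> v \in N -> u - v \in N.
Proof. by move=> uN vN; rewrite -scaleN1r; apply: submodD => //; apply: submodZ. Qed.

Lemma submod_sum (I : Type) (r : seq I) (P : pred I) (F : I -> V) :
  (forall i, P i -> F i \in N) -> \sum_(i <- r | P i) F i \in N.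
Proof.
by move=> FN; elim/big_ind: _ => //; [apply: submod0|apply: submodD].
Qed.

Lemma submodZK (c : K) u : c != 0 -> c%:A *: u \in N -> u \in N.
Proof.
move=> c0 /(submodZ (c^-1)%:A); rewrite scalerA -scalerAl mul1r scalerA mulVf //.
by rewrite !scale1r.
Qed.

Lemma submod_subK u v : u - v \in N -> v \in N -> u \in N.
Proof. by move=> uv vN; rewrite -(subrK v u); apply: submodD. Qed.
End Submodule.

Section Simplicity.
Variables (n : nat) (K : fieldType) (V : lmodType (weyl n K)) (N : {pred V}).
Hypothesis charK : [pchar K] =i pred0.
Hypothesis subN : GRing.submod_closed N.
Local Notation A := (weyl n K).

(** The commutators of [weyl_op s] with the generators also send [weyl_op t *: q] into [N], for [t]
    of degree one less. In characteristic zero one of them has a nonzero symbol unless [s] is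
    constant, so descent ends at a nonzero scalar. The degree of [t] is bounded because the
    dimension count behind the Bernstein inequality sees only finitely many orders. *)
Lemma weyl_op_killing k (s : {mpoly K[n + n]}) q :
  s != 0 -> (msize s <= k.+1)%N ->
  (forall t : {mpoly K[n + n]}, (msize t <= k.+1)%N ->
     weyl_op s *: (weyl_op t *: q) \in N) ->
  q \in N.
Proof.
elim: k s => [|k IHk] s s0 sk sN.
  have := sN 1; rewrite msize1 -mpolyC1 weyl_opC !scale1r => /(_ isT).
  move: s0; rewrite (msize1_polyC sk) weyl_opC mpolyC_eq0; set c := _@__ => c0.
  exact: submodZK.
have [s1|/mderiv_neq0-/(_ charK)[j sj0]] := leqP (msize s) 1.
  by apply: (IHk s) => // [|t tk]; [exact: leq_trans s1 _|exact: (sN t (leqW tk))].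
have sjk : (msize s^`M(j) <= k.+1)%N.
  by apply: leq_trans (msize_mderiv j s) _; rewrite -ltnS; case: (msize s) sk.
apply: (IHk _ sj0 sjk) => t tk.
have Xt i : (msize ('X_i * t) <= k.+2)%N.
  by rewrite -[k.+1]add1n; apply: msizeM_leq => //; rewrite msizeX mdeg1.
case: (split_ordP j) sj0 sjk => i -> sj0 sjk.
  have -> : weyl_op s^`M(lshift n i) = weyl_d K i * weyl_op s - weyl_op s * weyl_d K i.
    by rewrite weyl_op_d addrC addKr.
  rewrite scalerBl -!scalerA; apply: submodB => //.
    by apply: submodZ => //; apply: sN; exact: leqW.
  rewrite [weyl_d K i *: _]scalerA weyl_d_op; rewrite -raddfD /=; apply: sN.
  apply: msizeD => //; apply: leq_trans (msize_mderiv _ t) _.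
  exact: leq_trans (leq_pred _) (leqW tk).
have -> : weyl_op s^`M(rshift n i) = weyl_op s * weyl_x K i - weyl_x K i * weyl_op s.
  by rewrite weyl_op_x addrC addKr.
rewrite scalerBl -!scalerA; apply: submodB => //.
  by rewrite [weyl_x K i *: _]scalerA weyl_x_op; apply: sN.
by apply: submodZ => //; apply: sN; exact: leqW.
Qed.

(** The operators [a] with [a A q] inside [N] form a two-sided ideal, which is zero or
    everything. *)
Lemma weyl_simple (a : A) q :
  a != 0 -> (forall b, a *: (b *: q) \in N) -> q \in N.
Proof.
have [s ->] := weyl_op_surj a => s0 H.
apply: (@weyl_op_killing (msize s) s) => //.
by apply: contraNneq s0 => ->; rewrite raddf0.
Qed.
End Simplicity.

(** Normally ordered monomials are independent: if two symbols gave the same operator, their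
    difference would kill the whole regular module, and [weyl_op_killing] would put 1 into the zero
    submodule. *)
Lemma weyl_op_inj (n : nat) (K : fieldType) : [pchar K] =i pred0 ->
  injective (@weyl_op n K).
Proof.
move=> cK s t /eqP; rewrite -subr_eq0 -raddfB => /eqP/= E.
apply/eqP; rewrite -subr_eq0; apply/negPn/negP => st0.
have sub0 : GRing.submod_closed (pred1 (0 : (weyl n K)^o)).
  split=> [|a u v]; rewrite !inE // => /eqP -> /eqP ->.
  by rewrite scaler0 addr0.
have : (1 : (weyl n K)^o) \in pred1 0.
  apply: (weyl_op_killing cK sub0 st0 (leqnSn _)) => r _.
  by rewrite E scale0r inE.
by rewrite inE oner_eq0.
Qed.

(** * Standard monomials and the Bernstein inequality *)

Lemma weyl_opM (n : nat) (K : fieldType) k (s t : {mpoly K[n + n]}) :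
  (msize s <= k.+1)%N ->
  exists2 r, weyl_op s * weyl_op t = weyl_op r & (msize r <= k + msize t)%N.
Proof.
have sum_op (u : {mpoly K[n + n]}) l :
    (forall m, m \in msupp u -> exists2 r : {mpoly K[n + n]},
      weyl_op 'X_[m] * weyl_op t = weyl_op r & (msize r <= l)%N) ->
    exists2 r, weyl_op u * weyl_op t = weyl_op r & (msize r <= l)%N.
  move=> /(_ _ _)/cid2-H.
  pose f m := if pselect (m \in msupp u) is left ms then s2val (H m ms) else 0.
  have fP m (ms : m \in msupp u) :
      weyl_op 'X_[m] * weyl_op t = weyl_op (f m) /\ (msize (f m) <= l)%N.
    by rewrite /f; case: pselect => // ms'; case: (H m ms').
  exists (\sum_(m <- msupp u) u@_m *: f m).
    rewrite {1}[u]mpolyE !raddf_sum mulr_suml /= !big_seq.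
    apply: eq_bigr => m ms; rewrite !linearZ /= -scalerAl.
    by have [-> _] := fP m ms.
  rewrite big_seq; apply: msize_sum_le => m ms.
  by apply: leq_trans (msizeZ_le _ _) _; have [] := fP m ms.
elim: k s => [|k IHk] s sk.
  exists (s@_0%MM *: t); last exact: msizeZ_le.
  by rewrite {1}(msize1_polyC sk) weyl_opC mulr_algl linearZ.
apply: sum_op => m /msize_mdeg_lt ms.
have mk : (mdeg m <= k.+1)%N by rewrite -ltnS; apply: leq_trans sk.
have [m0|] := boolP (mdeg m == 0)%N.
  move: m0; rewrite mdeg_eq0 => /eqP ->; exists t; last exact: leq_addl.
  by rewrite mpolyX0 -mpolyC1 weyl_opC scale1r mul1r.
rewrite mdegE sum_nat_eq0 negb_forall => /existsP[j] /=; rewrite -lt0n => mj.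
have Em : (U_(j) + (m - U_(j)))%MM = m by rewrite addmC submK // lep1mP -lt0n.
move: (m - U_(j))%MM Em => m' Em; rewrite -Em.
have mk' : (msize ('X_[m'] : {mpoly K[n + n]}) <= k.+1)%N.
  by rewrite msizeX ltnS; move: mk; rewrite -Em mdegD mdeg1.
have [r Er rk] := IHk _ mk'.
have Xr i : (msize ('X_i * r) <= k.+1 + msize t)%N.
  have [->|r0] := eqVneq r 0; first by rewrite mulr0 mmeasure0.
  have X0 : 'X_i != 0 :> {mpoly K[n + n]} by rewrite -(mmeasure_poly_eq0 mdeg) msizeX.
  by rewrite (msizeM X0 r0) msizeX mdeg1 addSn.
case: (split_ordP j) => i ->.
  by exists ('X_(lshift n i) * r) => //; rewrite mpolyXD -weyl_x_op -mulrA Er weyl_x_op.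
have mk'' := leq_trans (msize_mderiv (lshift n i) _) (leq_trans (leq_pred _) mk').
have [r' Er' rk'] := IHk _ mk''.
exists ('X_(rshift n i) * r + r^`M(lshift n i) - r').
  rewrite mpolyXD; have /esym/(canRL (addrK _)) -> := weyl_d_op i ('X_[m'] : {mpoly K[_]}).
  by rewrite mulrBl -mulrA Er Er' weyl_d_op raddfB raddfD.
apply: msizeD; last by rewrite mmeasureN; apply: leq_trans rk' _; rewrite leq_add2r.
apply: msizeD => //; apply: leq_trans (msize_mderiv _ _) _.
by apply: leq_trans (leq_pred _) _; apply: leq_trans rk _; rewrite leq_add2r.
Qed.

Section StandardMonomials.
Variables (n : nat) (K : fieldType) (V : lmodType (weyl n K)) (N : {pred V}).
Hypothesis charK : [pchar K] =i pred0.
Hypothesis subN : GRing.submod_closed N.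
Variable q : V.
Hypothesis qN : q \notin N.
Local Notation N2 := (n + n)%N.
Local Notation S := {mpoly K[n + n]}.

(* The other monomials index a basis of [A q] modulo [N], as in a Groebner basis. *)
Definition reducible_mnm (g : 'X_{1..n + n}) : Prop :=
  exists2 s : S, (forall m, m \in msupp s -> (m < g)%O) &
    weyl_op ('X_[g] - s) *: q \in N.

Lemma weyl_opZ_act c (s : S) (v : V) :
  weyl_op (c *: s) *: v = c%:A *: (weyl_op s *: v).
Proof. by rewrite linearZ /= scalerA mulr_algl. Qed.

Lemma weyl_op_actE (s : S) (v : V) : weyl_op s *: v =
  \sum_(m <- msupp s) (s@_m)%:A *: (weyl_op 'X_[m] *: v).
Proof.
rewrite {1}[s]mpolyE raddf_sum scaler_suml /=; apply: eq_bigr => m _.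
exact: weyl_opZ_act.
Qed.

(** Multiplying a relation on the left by a generator multiplies its leading monomial by a variable.
    The correction term for [d_i] has smaller total degree, hence is smaller in the monomial order,
    which refines the degree; noncommutativity is invisible on leading monomials. *)
Lemma reducible_mnmS j g : reducible_mnm g -> reducible_mnm (U_(j) + g)%MM.
Proof.
case=> s sg qN'.
have Xs m : m \in msupp ('X_j * s) -> (m < (U_(j) + g)%MM)%O.
  rewrite mulrC (perm_mem (msuppMX _ _)) => /mapP[m' /sg m'g ->].
  by rewrite ltmc_add2r.
case: (split_ordP j) Xs => i -> Xs.
  exists ('X_(lshift n i) * s) => //.
  by rewrite mpolyXD -mulrBr -weyl_x_op -scalerA; apply: submodZ.
exists ('X_(rshift n i) * s - ('X_[g] - s)^`M(lshift n i)).
  move=> m /msuppB_le; rewrite mem_cat => /orP[/Xs //|/msize_mdeg_lt mg].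
  apply: lt_mdeg_ltmc; rewrite mdegD mdeg1 add1n ltnS.
  rewrite -ltnS; apply: leq_trans mg (leq_trans (msize_mderiv _ _) _).
  rewrite -ltnS; case E : (msize _) => [|k] //=; rewrite -E.
  apply/msize_leP => m' /msuppB_le; rewrite mem_cat msuppX inE.
  case/orP=> [/eqP -> //|/sg /ltW/lemc_mdeg].
  by rewrite ltnS => /leq_trans; apply; rewrite leqnSn.
rewrite (_ : _ - _ = 'X_(rshift n i) * ('X_[g] - s) + ('X_[g] - s)^`M(lshift n i)).
  by rewrite raddfD /= -weyl_d_op -scalerA; apply: submodZ.
by rewrite mpolyXD mulrBr opprB addrA [RHS]addrAC.
Qed.

Lemma reducible_mnmD m g : reducible_mnm g -> reducible_mnm (m + g)%MM.
Proof.
move=> rg; rewrite [m]multinomUE_id; elim/big_rec: _ => [|i m' _ IH]; first by rewrite add0m.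
rewrite -addmA; elim: (m i) => [|k IHk]; first by rewrite mulm0n add0m.
by rewrite mulmS -addmA; apply: reducible_mnmS.
Qed.

Lemma reducible_lem m g : (g <= m)%MM -> reducible_mnm g -> reducible_mnm m.
Proof. by move=> /submK <-; apply: reducible_mnmD. Qed.

Let standard (s : S) := forall m, m \in msupp s -> ~ reducible_mnm m.

Let standardD s t : standard s -> standard t -> standard (s + t).
Proof. by move=> ss st m /msuppD_le; rewrite mem_cat => /orP[/ss|/st]. Qed.

Let standard_sum (I : Type) (r : seq I) (P : pred I) (F : I -> S) :
  (forall i, P i -> standard (F i)) -> standard (\sum_(i <- r | P i) F i).
Proof.
move=> FP; elim/big_rec: _ => [m|i s /FP Fi ss]; first by rewrite msupp0.
exact: standardD.
Qed.

Let standardZ c s : standard s -> standard (c *: s).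
Proof. by move=> ss m /msuppZ_le/ss. Qed.

Let normal_form_sum (s : S) k :
  (forall m, m \in msupp s -> exists t : S, [/\ standard t, (msize t <= k)%N &
     weyl_op ('X_[m] - t) *: q \in N]) ->
  exists t : S, [/\ standard t, (msize t <= k)%N & weyl_op (s - t) *: q \in N].
Proof.
move=> /(_ _ _)/cid-H.
pose f m := if pselect (m \in msupp s) is left ms then sval (H m ms) else 0.
have fP m (ms : m \in msupp s) : [/\ standard (f m), (msize (f m) <= k)%N &
    weyl_op ('X_[m] - f m) *: q \in N].
  by rewrite /f; case: pselect => // ms'; case: (H m ms').
exists (\sum_(m <- msupp s) s@_m *: f m); split.
- rewrite big_seq; apply: standard_sum => m ms; apply: standardZ.
  by have [] := fP m ms.
- rewrite big_seq; apply: msize_sum_le => m ms.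
  by apply: leq_trans (msizeZ_le _ _) _; have [] := fP m ms.
rewrite {1}[s]mpolyE -sumrB raddf_sum scaler_suml /= big_seq.
apply: submod_sum => // m ms; rewrite -scalerBr weyl_opZ_act.
by apply: submodZ => //; have [] := fP m ms.
Qed.

(** Division with remainder, by well-founded induction on the monomial order. As this order refines
    the degree, rewriting never raises the degree, so the count can be made at each filtration
    step. *)
Lemma standard_normal_form (s : S) :
  exists t : S, [/\ standard t, (msize t <= msize s)%N & weyl_op (s - t) *: q \in N].
Proof.
have H g : exists t : S, [/\ standard t, (msize t <= (mdeg g).+1)%N &
     weyl_op ('X_[g] - t) *: q \in N].
  move: g; apply: ltmwf => g IH; have [[s0 s0g s0N]|gN] := pselect (reducible_mnm g).
    have [t [st tk tN]] : exists t : S, [/\ standard t,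
        (msize t <= (mdeg g).+1)%N & weyl_op (s0 - t) *: q \in N].
      apply: normal_form_sum => m /s0g mg; have [t [st tk tN]] := IH m mg.
      exists t; split=> //; apply: leq_trans tk _; rewrite ltnS.
      exact/lemc_mdeg/ltW.
    exists t; split=> //; rewrite -(subrKA s0) raddfD /= scalerDl.
    exact: submodD.
  exists 'X_[g]; split; rewrite ?msizeX //.
    by move=> m; rewrite msuppX inE => /eqP ->.
  by rewrite subrr raddf0 scale0r; apply: submod0.
apply: normal_form_sum => m /msize_mdeg_lt ms; have [t [st tk tN]] := H m.
by exists t; split=> //; apply: leq_trans ms.
Qed.

(** Otherwise [s], made monic, would witness that its own leading monomial is reducible. *)
Lemma standard_op_notin (s : S) : s != 0 ->
  (forall m, m \in msupp s -> ~ reducible_mnm m) -> weyl_op s *: q \notin N.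
Proof.
move=> s0 ss; apply/negP=> sN; apply: (ss _ (mlead_supp s0)).
have c0 : mleadc s != 0 by rewrite mleadc_eq0.
exists ('X_[mlead s] - (mleadc s)^-1 *: s).
  move=> m; rewrite mcoeff_msupp mcoeffB mcoeffX mcoeffZ => mm.
  have ml : m != mlead s.
    by apply: contraNneq mm => ->; rewrite eqxx mulVf // subrr.
  rewrite [mlead s == m]eq_sym (negPf ml) sub0r oppr_eq0 mulf_eq0 negb_or in mm.
  by rewrite lt_neqAle ml msupp_le_mlead // mcoeff_msupp; case/andP: mm.
by rewrite subKr weyl_opZ_act; apply: submodZ.
Qed.

Definition standard_mnms k : {set 'X_{1..(n + n) < k.+1}} :=
  [set g : 'X_{1..(n + n) < k.+1} | `[< ~ reducible_mnm g >]].

(* Otherwise some nonzero operator of order at most [k] would annihilate,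
   modulo [N], every element of the [k]-th step of the filtration of [A q]. *)
Lemma bernstein_card k :
  (#|{: 'X_{1..(n + n) < k.+1}}| <= #|standard_mnms k| * #|standard_mnms (k + k)|)%N.
Proof.
rewrite leqNgt; apply/negP => ltk.
pose I := 'X_{1..(n + n) < k.+1}.
pose W := {g : I | g \in standard_mnms k}.
pose D := {g : 'X_{1..(n + n) < (k + k).+1} | g \in standard_mnms (k + k)}.
have T (m : I) (w : W) : exists t : S, [/\ standard t, (msize t <= (k + k).+1)%N
    & weyl_op 'X_[m] *: (weyl_op 'X_[val w] *: q) - weyl_op t *: q \in N].
  have mk : (msize ('X_[m] : S) <= k.+1)%N by rewrite msizeX bmdeg.
  have [r Er rk] := weyl_opM 'X_[val w] mk.
  have [t [st tk tN]] := standard_normal_form r.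
  exists t; split=> //; last by rewrite scalerA Er -scalerBl -raddfB.
  apply: leq_trans tk (leq_trans rk _); rewrite -addnS leq_add2l msizeX.
  exact: bmdeg.
pose f m w := sval (cid (T m w)).
have fP m w : [/\ standard (f m w), (msize (f m w) <= (k + k).+1)%N
    & weyl_op 'X_[m] *: (weyl_op 'X_[val w] *: q) - weyl_op (f m w) *: q \in N].
  by rewrite /f; case: cid.
have cardWD : (#|{: W * D}| < #|{: I}|)%N by rewrite card_prod !card_sig.
(* The unknowns are the coefficients of an operator of order at most [k]; each pair of a standard
   [w] and a standard [d] gives one equation, the vanishing at [d] of the normal form of the
   operator applied to [w]. *)
have [c [m cm] cP] := @linear_system_kernel K I (W * D)%type
  (fun m wd => (f m wd.1)@_(val wd.2)) cardWD.
pose s : S := \sum_(m : I) c m *: 'X_[m].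
have s0 : s != 0.
  apply: contraNneq cm => /(congr1 (mcoeff m)).
  rewrite raddf_sum mcoeff0 (bigD1 m) //= big1 => [|m' mm'].
    by rewrite addr0 mcoeffZ mcoeffX eqxx mulr1 => ->.
  by rewrite mcoeffZ mcoeffX -bmeqP (negPf mm') mulr0.
have sk : (msize s <= k.+1)%N.
  apply: msize_sum_le => i _; apply: leq_trans (msizeZ_le _ _) _.
  by rewrite msizeX bmdeg.
have sW (w : W) : weyl_op s *: (weyl_op 'X_[val w] *: q) \in N.
  have f0 : \sum_m c m *: f m w = 0.
    apply/mpolyP => d; rewrite raddf_sum mcoeff0 /=.
    have [dk|kd] := ltnP (mdeg d) (k + k).+1; last first.
      rewrite big1 // => m' _; rewrite mcoeffZ memN_msupp_eq0 ?mulr0 //.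
      by apply: msize_mdeg_ge; apply: leq_trans kd; have [] := fP m' w.
    have [rd|nrd] := pselect (reducible_mnm d).
      rewrite big1 // => m' _; rewrite mcoeffZ memN_msupp_eq0 ?mulr0 //.
      by have [ss _ _] := fP m' w; apply/negP => /ss.
    have dD : BMultinom dk \in standard_mnms (k + k) by rewrite inE; apply/asboolP.
    rewrite -[RHS](cP (w, (exist _ (BMultinom dk) dD : D))).
    by apply: eq_bigr => m' _; rewrite mcoeffZ.
  have op_comb (h : I -> S) (v : V) : weyl_op (\sum_m c m *: h m) *: v =
      \sum_m (c m)%:A *: (weyl_op (h m) *: v).
    by rewrite raddf_sum scaler_suml /=; apply: eq_bigr => m' _; apply: weyl_opZ_act.
  have := op_comb (f^~ w) q; rewrite f0 raddf0 scale0r => E0.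
  rewrite /s op_comb -[X in X \in N]subr0 [X in _ - X]E0 -sumrB.
  under eq_bigr do rewrite -scalerBr.
  by apply: submod_sum => // m' _; apply: submodZ => //; have [] := fP m' w.

have st t : (msize t <= k.+1)%N -> weyl_op s *: (weyl_op t *: q) \in N.
  move=> tk; have [t' [st' tk' tN]] := standard_normal_form t.
  apply: (submod_subK subN (v := weyl_op s *: (weyl_op t' *: q))).
    by rewrite -scalerBr -scalerBl -raddfB; apply: submodZ.
  rewrite (weyl_op_actE t') scaler_sumr big_seq.
  apply: submod_sum => // g gt; rewrite scalerA mulr_algr -mulr_algl -scalerA.
  apply: submodZ => //.
  have gk : (mdeg g < k.+1)%N.
    by apply: leq_trans (msize_mdeg_lt gt) (leq_trans tk' tk).
  have gW : BMultinom gk \in standard_mnms k by rewrite inE; apply/asboolP/st'.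
  exact: (sW (exist _ (BMultinom gk) gW : W)).
by move/negP: qN; apply; apply: (weyl_op_killing charK subN s0 sk st).
Qed.

End StandardMonomials.

(** * Counting monomials of bounded degree *)

Section Counting.
Local Open Scope nat_scope.

Lemma card_bmultinom n k : #|{: 'X_{1..n < k.+1}}| = 'C(n + k, n).
Proof.
rewrite -card_partial_ord_partitions.
pose f (m : 'X_{1..n < k.+1}) : n.-tuple 'I_k.+1 := [tuple inord (val m i) | i < n].
have mk (m : 'X_{1..n < k.+1}) i : val m i < k.+1.
  apply: leq_ltn_trans (bmdeg m).
  by rewrite mdegE (bigD1 i) //= leq_addr.
have f_inj : injective f.
  move=> m1 m2 E; apply/val_inj/mnmP => i.
  by have := congr1 (fun t => val (tnth t i)) E; rewrite !tnth_mktuple /= !inordK ?mk // => ->.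
rewrite -[LHS]cardsT -(card_imset _ f_inj); apply: eq_card => t.
rewrite inE; apply/imsetP/idP => [[m _ ->]|tk].
  rewrite big_tuple; under eq_bigr do rewrite tnth_mktuple inordK ?mk //.
  by rewrite -mdegE -ltnS bmdeg.
have tk' : mdeg [multinom tnth t i : nat | i < n] < k.+1.
  rewrite mdegE ltnS; apply: leq_trans tk; rewrite big_tuple.
  by apply: leq_sum => i _; rewrite mnmE.
exists (BMultinom tk') => //; apply: eq_from_tnth => i.
by apply: val_inj; rewrite tnth_mktuple /= mnmE inordK.
Qed.

Lemma card_bmultinom_ge n k : k.+1 ^ n <= n`! * #|{: 'X_{1..n < k.+1}}|.
Proof.
rewrite card_bmultinom mulnC bin_ffact ffact_prod -{1}(card_ord n) -prod_nat_const.
by apply: leq_prod => i _; have := ltn_ord i; lia.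
Qed.

Lemma card_bmultinom_le n k : n`! * #|{: 'X_{1..n < k.+1}}| <= (n + k) ^ n.
Proof.
rewrite card_bmultinom mulnC bin_ffact ffact_prod -[X in _ ^ X](card_ord n) -prod_nat_const.
by apply: leq_prod => i _; have := ltn_ord i; lia.
Qed.

(** A comparison of leading coefficients in [k], with the limit replaced by one large value. With
    [x = k.+1], the auxiliary estimate says that [(a x + e) ^ n] is at most
    [a ^ n * x ^ n + E * x ^ (n - 1)], multiplied by [x] to avoid a predecessor in the exponent. *)
Lemma leading_coef_le n a b e :
  (forall k, b * k.+1 ^ n <= (a * k.+1 + e) ^ n) -> b <= a ^ n.
Proof.
move=> H; have [E EP] : exists E, forall k,
    (a * k.+1 + e) ^ n * k.+1 <= (a ^ n * k.+1 + E) * k.+1 ^ n.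
  elim: n {H} => [|n [E IH]]; first by exists 0 => k; rewrite !expn0; lia.
  (* The coefficients below [x ^ 2] in [(a x + e) (a ^ n x + E)], the constant term [e * E] being
     bounded by [e * E * x]. *)
  exists (a * E + e * a ^ n + e * E) => k; have := IH k; rewrite !expnS.
  move=> /(leq_mul (leqnn (a * k.+1 + e))); rewrite mulnA => /leq_trans; apply.
  rewrite !mulnA leq_mul2r; apply/orP; right.
  have := leq_pmulr (e * E) (ltn0Sn k).
  by move: (a ^ n) k.+1 => A x; nia.
(* At [k = E] the error [E] is less than [x = E.+1], so it cannot make up for a difference of one
   between [b] and [a ^ n]. *)
rewrite leqNgt; apply/negP => lb; have := leq_trans (leq_mul (H E) (leqnn E.+1)) (EP E).
have x0 : 0 < E.+1 ^ n by rewrite expn_gt0.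
rewrite mulnAC leq_pmul2r //.
by move: lb; move: (a ^ n) => A; nia.
Qed.

(** For injective [t] each sum has at most one term, and the image is the coordinate orthant in the
    directions [t i]. *)
Definition mnm_embed (n N : nat) (t : 'I_n -> 'I_N) (a : 'X_{1..n}) : 'X_{1..N} :=
  [multinom \sum_(i | t i == j) a i | j < N].

Lemma mnm_embed_inj n N (t : 'I_n -> 'I_N) : injective t -> injective (mnm_embed t).
Proof.
move=> t_inj a b E; apply/mnmP => i; have /mnmP/(_ (t i)) := E.
have P1 : (fun k => t k == t i) =1 pred1 i by move=> k; rewrite /= (inj_eq t_inj).
by rewrite !mnmE !(eq_bigl _ _ P1) !big_pred1_eq.
Qed.

Lemma mdeg_embed n N (t : 'I_n -> 'I_N) a : mdeg (mnm_embed t a) = mdeg a.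
Proof.
rewrite !mdegE; under eq_bigr do rewrite mnmE.
rewrite (exchange_big_dep xpredT) //=; apply: eq_bigr => i _.
by rewrite (big_pred1 (t i)) // => j; rewrite /= eq_sym.
Qed.
End Counting.

Section Orthants.
Local Open Scope nat_scope.

(* Outside [red] fewer than [n] exponents are large. *)
Lemma card_order_ideal n N (red : 'X_{1..N} -> Prop) : 0 < n ->
  (forall m g, (g <= m)%MM -> red g -> red m) ->
  (forall t : 'I_n -> 'I_N, injective t -> exists a, red (mnm_embed t a)) ->
  exists C, forall k,
    #|[set g : 'X_{1..N < k.+1} | `[< ~ red g >]]| <= C * k.+1 ^ n.-1.
Proof.
move=> n0 redle H.
have H' (t : {ffun 'I_n -> 'I_N}) : exists a, injective t -> red (mnm_embed t a).
  have [ti|nti] := pselect (injective t); last by exists 0%MM.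
  by have [a ra] := H t ti; exists a.
pose al t := sval (cid (H' t)).
have alP (t : {ffun 'I_n -> 'I_N}) : injective t -> red (mnm_embed t (al t)).
  by rewrite /al; case: cid.
pose D := \sum_t mdeg (al t).
have few g : ~ red g -> #|[set j | D <= g j]| < n.
  move=> nr; rewrite ltnNge; apply/negP => nT.
  pose t := [ffun i : 'I_n => enum_val (widen_ord nT i)].
  have t_inj : injective t.
    by move=> i j; rewrite !ffunE => /enum_val_inj/(congr1 val)/= /val_inj.
  apply: nr; apply: redle (alP t t_inj); apply/mnm_lepP => j; rewrite mnmE.
  have [jT|jT] := boolP (j \in [set j | D <= g j]).
    rewrite inE in jT; apply: leq_trans jT.
    rewrite /D (bigD1 t) //= mdegE; apply: leq_trans (leq_addr _ _).
    by rewrite big_mkcond; apply: leq_sum => i _; case: ifP.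
  rewrite big1 // => i /eqP ij; move: jT; rewrite -ij ffunE.
  by move/negP; case; exact: enum_valP.
exists (2 ^ N * D.+1 ^ N) => k.
pose T (g : 'X_{1..N < k.+1}) := [set j | D <= val g j].
(* A code for [g]: the set of its large exponents, the small exponents, which fit below [D.+1], and
   the at most [n - 1] large ones in a list. Only the last component depends on [k], whence the
   exponent [n.-1]. Entries that do not fit, or lie beyond the end of the list, take default values
   and are never decoded. *)
pose f (g : 'X_{1..N < k.+1}) : {set 'I_N} * {ffun 'I_N -> 'I_D.+1} * {ffun 'I_n.-1 -> 'I_k.+1} :=
  (T g, [ffun j => inord (val g j)],
        [ffun i : 'I_n.-1 => inord (nth 0 [seq val g j | j <- enum (T g)] i)]).
have gk (g : 'X_{1..N < k.+1}) j : val g j < k.+1.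
  by apply: leq_ltn_trans (bmdeg g); rewrite mdegE (bigD1 j) //= leq_addr.
have f_inj : {in [set g : 'X_{1..N < k.+1} | `[< ~ red g >]] &, injective f}.
  move=> g h; rewrite inE => /asboolP/few gT _ [ET /ffunP E1 /ffunP E2].
  apply/val_inj/mnmP => j; have [jT|jT] := boolP (j \in T g).
    have lt : index j (enum (T g)) < n.-1.
      by rewrite -ltnS prednK //; apply: leq_ltn_trans gT; rewrite cardE index_mem mem_enum.
    have := E2 (Ordinal lt); rewrite !ffunE /= -ET.
    have jT' : index j (enum (T g)) < size (enum (T g)) by rewrite index_mem mem_enum.
    rewrite !(nth_map j) // nth_index ?mem_enum //.
    by move/(congr1 val); rewrite /= !inordK ?gk.
  have := E1 j; rewrite !ffunE; move: (jT); rewrite ET.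
  rewrite !inE -!ltnNge => gj; move: jT; rewrite inE -ltnNge => hj.
  by move/(congr1 val); rewrite /= !inordK ?ltnS ?(ltnW gj) ?(ltnW hj).
rewrite -(card_in_imset f_inj); apply: leq_trans (max_card _) _.
rewrite !card_prod !card_ffun !card_ord -cardsT -powersetT card_powerset cardsT card_ord.
by [].
Qed.
End Orthants.

Section Bernstein.
Variables (n : nat) (K : fieldType) (V : lmodType (weyl n K)) (N : {pred V}).
Hypothesis charK : [pchar K] =i pred0.
Hypothesis subN : GRing.submod_closed N.
Hypothesis n_gt0 : (0 < n)%N.

(** Without such an orthant there would be only [O(k ^ (n - 1))] standard monomials of degree at
    most [k]. The product in [bernstein_card] would then be [O(k ^ (2 n - 2))], too small for the
    operators of order at most [k], whose number grows like [k ^ (2 n)]. *)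
Lemma bernstein_orthant q : q \notin N -> exists2 t : 'I_n -> 'I_(n + n),
  injective t & forall a, ~ reducible_mnm N q (mnm_embed t a).
Proof.
move=> qN; apply: contrapT => H.
have [C CP] : exists C, forall k, (#|standard_mnms N q k| <= C * k.+1 ^ n.-1)%N.
  apply: card_order_ideal => // [m g|t t_inj]; first exact: reducible_lem.
  apply: contrapT => H'; apply: H; exists t => // a ra.
  by apply: H'; exists a.
(* Both the order at which the count is made and the constant in it: with [x = E.+1], the
   inequalities combine to [x ^ 2 <= E], which is absurd. *)
pose E := ((n + n)`! * (C * C * 2 ^ n.-1))%N.
have EE : E = ((n + n)`! * (C * C * 2 ^ n.-1))%N by [].
have := card_bmultinom_ge (n + n) E.
have := bernstein_card charK subN qN E.
have := CP E; have := CP (E + E)%N.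
set a := #|_|; set b := #|_|; set c := #|_| => Ha Hb Hc Hd.
have E2 : ((E + E).+1 ^ n.-1 <= 2 ^ n.-1 * E.+1 ^ n.-1)%N.
  rewrite -expnMn; case: (n.-1) => [|m]; first by rewrite !expn0.
  by rewrite leq_exp2r //; lia.
have n2 : (E.+1 ^ (n + n) = E.+1 * E.+1 * (E.+1 ^ n.-1 * E.+1 ^ n.-1))%N.
  by rewrite -{1 2}(prednK n_gt0) expnD !expnS mulnACA.
have x0 : (0 < E.+1 ^ n.-1 * E.+1 ^ n.-1)%N by rewrite muln_gt0 !expn_gt0.
suff : (E.+1 ^ (n + n) <= E * (E.+1 ^ n.-1 * E.+1 ^ n.-1))%N.
  by rewrite n2 leq_pmul2r //; lia.
clearbody E; apply: leq_trans Hd _; rewrite [X in (_ <= X * _)%N]EE -mulnA leq_mul2l.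
apply/orP; right.
apply: leq_trans Hc _; apply: leq_trans (leq_mul Hb (leq_trans Ha (leq_mul (leqnn C) E2))) _.
by move: (E.+1 ^ _)%N (2 ^ _)%N => X Y; lia.
Qed.
End Bernstein.

(** * Lengths of chains *)

Section FilteredModule.
Variables (n : nat) (K : fieldType) (V : lmodType (weyl n K)).
Hypothesis charK : [pchar K] =i pred0.
Hypothesis n_gt0 : (0 < n)%N.
Variables (p : V -> {mpoly K[n]}) (m : nat).
Hypothesis p_linear : forall c u v, p (c%:A *: u + v) = c *: p u + p v.
Hypothesis p_inj : forall u, p u = 0 -> u = 0.
Hypothesis p_growth : forall g v,
  (msize (p (weyl_op 'X_[g] *: v)) <= msize (p v) + m * mdeg g)%N.

Lemma embed0 : p 0 = 0.
Proof.
by have := p_linear (-1) 0 0; rewrite scaler0 addr0 scaleN1r addNr.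
Qed.

Lemma embed_sum (I : Type) (r : seq I) (P : pred I) (c : I -> K) (F : I -> V) :
  p (\sum_(i <- r | P i) (c i)%:A *: F i) = \sum_(i <- r | P i) c i *: p (F i).
Proof.
elim: r => [|i r IH]; first by rewrite !big_nil embed0.
by rewrite !big_cons; case: ifP => // _; rewrite p_linear IH.
Qed.

Lemma dependent_family (I : finType) (F : I -> V) k :
  (forall i, (msize (p (F i)) <= k)%N) -> (#|{: 'X_{1..n < k}}| < #|I|)%N ->
  exists2 c : I -> K, (exists i, c i != 0) & \sum_i (c i)%:A *: F i = 0.
Proof.
move=> Fk /(linear_system_kernel (fun i (a : 'X_{1..n < k}) => (p (F i))@_a)).
case=> c c0 cP; exists c => //; apply: p_inj; rewrite embed_sum.
apply/mpolyP => a; rewrite raddf_sum mcoeff0 /=.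
have [ak|ka] := ltnP (mdeg a) k.
  by rewrite -[RHS](cP (BMultinom ak)); apply: eq_bigr => i _; rewrite mcoeffZ.
rewrite big1 // => i _; rewrite mcoeffZ memN_msupp_eq0 ?mulr0 //.
exact/msize_mdeg_ge/(leq_trans (Fk i)).
Qed.

Lemma chain_length l (S : nat -> {pred V}) :
  (forall i, (i <= l)%N -> GRing.submod_closed (S i)) ->
  (forall i, (i < l)%N -> {subset S i <= S i.+1}) ->
  (forall i, (i < l)%N -> ~ {subset S i.+1 <= S i}) ->
  (l <= m ^ n)%N.
Proof.
move=> Ssub Sincr Sproper.
have Smono i j : (i <= j <= l)%N -> {subset S i <= S j}.
  case/andP=> /subnK <-; elim: (j - i)%N => [_ u //|d IHd dl u ui].
  by apply: Sincr => //; apply: IHd => //; apply: ltnW.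
have /boolp.choice[q qP] : forall i : 'I_l, exists x, x \in S i.+1 /\ x \notin S i.
  move=> i.
  apply: contrapT => H; apply: (Sproper i (ltn_ord i)) => u ui.
  by apply/negPn/negP => uN; apply: H; exists u.
have tP (i : 'I_l) : exists t : 'I_n -> 'I_(n + n),
    injective t /\ forall a, ~ reducible_mnm (S i) (q i) (mnm_embed t a).
  have [] := @bernstein_orthant _ _ _ (S i) charK (Ssub _ (ltnW (ltn_ord i))) n_gt0 (q i).
    by have [] := qP i.
  by move=> t t_inj tP; exists t.
have [{}t {}tP] := boolp.choice tP.
pose e := \max_i msize (p (q i)).
have card_le k : (l * #|{: 'X_{1..n < k.+1}}| <= #|{: 'X_{1..n < (e + m * k).+1}}|)%N.
  rewrite leqNgt; apply/negP => lt.
  pose F (ia : 'I_l * 'X_{1..n < k.+1}) := weyl_op 'X_[mnm_embed (t ia.1) ia.2] *: q ia.1.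
  have Fk ia : (msize (p (F ia)) <= (e + m * k).+1)%N.
    apply: leq_trans (p_growth _ _) (leqW _); apply: leq_add.
      exact: (leq_bigmax (F := fun i => msize (p (q i)))).
    by rewrite leq_mul2l mdeg_embed -ltnS bmdeg orbT.
  have [|c [[i0 a0] c0] c_eq] := dependent_family Fk; first by rewrite card_prod card_ord.
  (* The highest level of the chain at which the relation has a nonzero coefficient: the terms of
     lower levels lie in [S i], so the relation forces [weyl_op s *: q i] into [S i], although [s]
     is standard. *)
  have [i ci imax] := @arg_maxnP _ i0 (fun i => [exists a, c (i, a) != 0]) val
     (introT existsP (ex_intro _ a0 c0)).
  pose s : {mpoly K[n + n]} := \sum_(a : 'X_{1..n < k.+1}) c (i, a) *: 'X_[mnm_embed (t i) a].
  have [ti_inj ti_std] := tP i; have [_ /negP] := qP i.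
  have Si := Ssub _ (ltnW (ltn_ord i)).
  have sc a : s@_(mnm_embed (t i) (val a)) = c (i, a).
    rewrite raddf_sum (bigD1 a) //= big1 => [|b ba].
      by rewrite addr0 mcoeffZ mcoeffX eqxx mulr1.
    by rewrite mcoeffZ mcoeffX (inj_eq (mnm_embed_inj ti_inj)) -bmeqP (negPf ba) mulr0.
  have s0 : s != 0.
    have /existsP[a ca] := ci; apply: contraNneq ca => s0.
    by rewrite -sc s0 mcoeff0.
  have /negP : weyl_op s *: q i \notin S i.
    apply: (standard_op_notin Si) => // g /msupp_sum_le.
    case/flatten_mapP=> a _ /msuppZ_le; rewrite msuppX inE => /eqP ->.
    exact: ti_std.
  move=> sN _; apply: sN.
  have E j : \sum_(a : 'X_{1..n < k.+1}) (c (j, a))%:A *: F (j, a) =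
      weyl_op (\sum_(a : 'X_{1..n < k.+1}) c (j, a) *: 'X_[mnm_embed (t j) a]) *: q j.
    rewrite raddf_sum scaler_suml /=; apply: eq_bigr => a _.
    by rewrite weyl_opZ_act.
  have : \sum_j \sum_(a : 'X_{1..n < k.+1}) (c (j, a))%:A *: F (j, a) = 0.
    by rewrite pair_bigA -[RHS]c_eq; apply: eq_bigr => -[].
  rewrite (bigD1 i) //= E => /eqP; rewrite addr_eq0 => /eqP ->.
  rewrite -scaleN1r; apply: submodZ => //; apply: submod_sum => // j ji.
  have [ltij|leji] := ltnP i j.
    rewrite big1 ?submod0 // => a _.
    have [->|cj] := eqVneq (c (j, a)) 0; first by rewrite !scale0r.
    have := imax j (introT existsP (ex_intro _ a cj)).
    by rewrite /= leqNgt ltij.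
  have {ji leji} ltji : (j < i)%N by rewrite ltn_neqAle leji andbT.
  apply: (Smono j.+1) => //; first by rewrite ltji ltnW.
  have Sj := Ssub _ (ltn_ord j).
  rewrite E; apply: submodZ => //; by have [] := qP j.
apply: (@leading_coef_le n m l (n + e)) => k.
have := leq_mul (leqnn n`!) (card_le k).
have := leq_mul (leqnn l) (card_bmultinom_ge n k).
have := card_bmultinom_le n (e + m * k).
rewrite (mulnCA n`!); move=> H1 H2 H3.
apply: leq_trans (leq_trans H2 (leq_trans H3 H1)) _.
by rewrite leq_exp2r //; lia.
Qed.
End FilteredModule.

(** * Finite length and cyclicity *)

Section CompositionSeries.
Variables (A : nzRingType) (V : lmodType A).

Definition submodule_chain (l : nat) (S : nat -> {pred V}) : Prop :=
  [/\ forall i, (i <= l)%N -> GRing.submod_closed (S i),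
      forall i, (i < l)%N -> {subset S i <= S i.+1} &
      forall i, (i < l)%N -> ~ {subset S i.+1 <= S i}].

(** A longest chain from 0 to [V] is a composition series, since a submodule strictly between two
    consecutive terms could be inserted to lengthen it. *)
Lemma bounded_chains_finite_length L :
  (forall l S, submodule_chain l S -> (l <= L)%N) -> finite_length V.
Proof.
move=> chainL.
pose P l := `[< exists S, [/\ submodule_chain l S, S 0%N =i pred1 0 & S l =i predT] >].
have P_ex : exists l, P l.
  have sub0 : GRing.submod_closed (pred1 (0 : V)).
    by split=> [|a u v]; rewrite !inE // => /eqP -> /eqP ->; rewrite scaler0 addr0.
  have [[v v0]|V0] := pselect (exists v : V, v != 0).
    exists 1%N; apply/asboolP; exists (fun i => if i is 0%N then (pred1 0 : {pred V}) else predT).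
    split=> //; split=> [[|i] _ //|[|i] //|[|i] // _ H].
    by have := H v isT; rewrite inE (negPf v0).
  exists 0%N; apply/asboolP; exists (fun=> (pred1 0 : {pred V})); split=> // v.
  by rewrite !inE; apply/negPn/negP => v0; apply: V0; exists v.
have P_le l : P l -> (l <= L)%N by move=> /asboolP[S [/chainL]].
case: (ex_maxnP P_ex P_le) => l /asboolP[S [[Ssub Sincr Sprop] S0 Sl]] lmax.
exists l, S; split=> // i il N Nsub SN NS.
apply: contrapT => /not_orP[NSi SNi].
suff /lmax : P l.+1 by rewrite ltnn.
pose S' j := if (j <= i)%N then S j else if j == i.+1 then N else S j.-1.
apply/asboolP; exists S'; split=> //; last first.
  by rewrite /S' ltnNge ltnW //= eqSS gtn_eqF.
split=> [j jl|j jl|j jl].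
- rewrite /S'; case: leqP => [ji|ij]; first by apply: Ssub; apply: leq_trans ji (ltnW il).
  by case: eqP => // _; apply: Ssub; case: j jl ij.
- rewrite /S'; have [ji|ij|->] := ltngtP j i.
  + by apply: Sincr; apply: ltn_trans ji il.
  + rewrite eqSS (gtn_eqF ij) /=; case: eqP => [->//|ne].
    by case: j jl ij ne => // j jl ij ne; apply: Sincr.
  + by rewrite eqxx.
rewrite /S'; have [ji|ij|->] := ltngtP j i.
+ by apply: Sprop; apply: ltn_trans ji il.
+ rewrite eqSS (gtn_eqF ij) /=; case: eqP => [->//|ne].
  by case: j jl ij ne => // j jl ij ne; apply: Sprop.
by rewrite eqxx.
Qed.
End CompositionSeries.

Section Cyclic.
Variables (n : nat) (K : fieldType) (V : lmodType (weyl n K)).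
Hypothesis charK : [pchar K] =i pred0.

(* As the Weyl algebra is simple, adding to [u] a suitable element of [S i.+1]
   turns an annihilator of [u] into an operator that generates S i.+1 / S i. *)
Lemma finite_length_cyclic :
  (forall u : V, exists2 a : weyl n K, a != 0 & a *: u = 0) ->
  finite_length V -> cyclic_module V.
Proof.
move=> ann [l [S [Ssub S0 Sl Sincr Sprop Ssimple]]].
(* The vector [u] generates [V] modulo a term of the series, and this term is lowered one step at a
   time from [V] to 0. *)
suff H i : (i <= l)%N -> exists u, forall v, exists a, v - a *: u \in S (l - i)%N.
  have [u uP] := H l (leqnn l); exists u => v; have [a] := uP v.
  by rewrite subnn S0 inE subr_eq0 => /eqP; exists a.
elim: i => [|i IH] il; first by exists 0 => v; exists 0; rewrite subn0 Sl.
have [u uP] := IH (ltnW il).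
have jl : (l - i.+1 < l)%N by lia.
have Ej : (l - i = (l - i.+1).+1)%N by lia.
rewrite {}Ej in uP; move: (l - i.+1)%N jl uP => j jl uP {IH il}.
have [subS subS'] := (Ssub _ (ltnW jl), Ssub _ jl).
have [v vS vN] : exists2 v, v \in S j.+1 & v \notin S j.
  apply: contrapT => H; apply: (Sprop j jl) => v vS.
  by apply/negPn/negP => vN; apply: H; exists v.
have [a a0 au] := ann u.
have [b abv] : exists b, a *: (b *: v) \notin S j.
  apply: contrapT => H; move/negP: vN; apply.
  apply: (weyl_simple charK subS a0) => b.
  by apply/negPn/negP => abN; apply: H; exists b.
exists (u + b *: v) => w.
pose N : {pred V} := fun x => `[< exists c, x - c *: (u + b *: v) \in S j >].
have NP x : reflect (exists c, x - c *: (u + b *: v) \in S j) (x \in N) by apply: asboolP.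
have Nsub : GRing.submod_closed N.
  split=> [|c x y /NP[d xd] /NP[e ye]].
    by apply/NP; exists 0; rewrite scale0r subr0; apply: submod0.
  apply/NP; exists (c * d + e); rewrite scalerDl -scalerA opprD addrACA -scalerBr.
  by apply: subS.2.
have SN : {subset S j <= N} by move=> x xS; apply/NP; exists 0; rewrite scale0r subr0.
have SN' : {subset S j.+1 <= N}.
  (* The submodule [N] is generated by [u + b *: v] and [S j]. Since [a] kills [u], it contains
     [a *: (b *: v)], so [N'] is strictly larger than [S j], and the simple factor leaves only
     [S j.+1]. *)
  pose N' : {pred V} := fun x => (x \in N) && (x \in S j.+1).
  have N'sub : GRing.submod_closed N'.
    split=> [|c x y /andP[xN xS] /andP[yN yS]].
      by apply/andP; split; apply: submod0.
    by apply/andP; split; [apply: Nsub.2|apply: subS'.2].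
  have SN'' : {subset S j <= N'} by move=> x xS; apply/andP; split; [exact: SN|exact: Sincr].
  have NS' : {subset N' <= S j.+1} by move=> x /andP[].
  case: (Ssimple j jl N' N'sub SN'' NS') => [NS|SN0]; last by move=> x /SN0/andP[].
  have /NS abS : a *: (b *: v) \in N'.
    apply/andP; split; last by do 2! apply: submodZ => //.
    by apply/NP; exists a; rewrite scalerDr au add0r subrr; apply: submod0.
  by rewrite abS in abv.
have [c wc] := uP w.
have cN : c *: u \in N.
  apply: submodZ => //; apply/NP.
  have /NP[d vd] := SN' _ (submodZ subS' b vS); exists (1 - d).
  rewrite scalerBl scale1r opprB addrCA opprD addNKr -opprB -scaleN1r.
  exact: submodZ.
have : w \in N by rewrite -(subrK (c *: u) w); apply: submodD => //; apply: SN'.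
by move/NP.
Qed.
End Cyclic.

Section Annihilators.
Variables (n : nat) (K : fieldType) (V : lmodType (weyl n K)).
Hypothesis charK : [pchar K] =i pred0.
Hypothesis n_gt0 : (0 < n)%N.
Variables (p : V -> {mpoly K[n]}) (m : nat).
Hypothesis p_linear : forall c u v, p (c%:A *: u + v) = c *: p u + p v.
Hypothesis p_inj : forall u, p u = 0 -> u = 0.
Hypothesis p_growth : forall g v,
  (msize (p (weyl_op 'X_[g] *: v)) <= msize (p v) + m * mdeg g)%N.

(** Operators of order at most [k] form a space whose dimension grows like [k ^ (2 n)], whereas
    their values on [u] lie in a space of dimension [O(k ^ n)]; injectivity of [weyl_op] makes the
    resulting relation a nonzero operator. *)
Lemma annihilator_neq0 (u : V) : exists2 a : weyl n K, a != 0 & a *: u = 0.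
Proof.
pose e := msize (p u); pose k := ((n + n)`! * (n + e + m) ^ n)%N.
have kk (g : 'X_{1..(n + n) < k.+1}) : (msize (p (weyl_op 'X_[g] *: u)) <= (e + m * k).+1)%N.
  apply: leq_trans (p_growth _ _) (leqW _); rewrite leq_add2l leq_mul2l.
  by rewrite -ltnS bmdeg orbT.
have [|c [g0 c0] cP] := dependent_family p_linear p_inj kk.
  have H1 := card_bmultinom_ge (n + n) k; have := card_bmultinom_le n (e + m * k).
  set a := #|_|; set b := #|_| => H2.
  rewrite -(ltn_pmul2l (fact_gt0 (n + n))); apply: leq_trans H1.
  have x0 : (0 < k.+1 ^ n)%N by rewrite expn_gt0.
  have H3 : (a <= (n + e + m) ^ n * k.+1 ^ n)%N.
    apply: leq_trans (leq_pmull a (fact_gt0 n)) (leq_trans H2 _).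
    by rewrite -expnMn leq_exp2r // !mulnDl; nia.
  rewrite expnD; apply: leq_ltn_trans (leq_mul (leqnn _) H3) _.
  rewrite mulnA ltn_pmul2r //; apply: leq_trans (_ : k.+1 ^ 1 <= _)%N => //.
  have k0 : (0 < k)%N by rewrite muln_gt0 fact_gt0 expn_gt0 -addnA addn_gt0 n_gt0.
  by rewrite leq_exp2l.
pose s : {mpoly K[n + n]} := \sum_(g : 'X_{1..(n + n) < k.+1}) c g *: 'X_[g].
exists (weyl_op s); last first.
  rewrite -[RHS]cP raddf_sum scaler_suml /=; apply: eq_bigr => g _.
  exact: weyl_opZ_act.
rewrite -(raddf0 (@weyl_op n K)) (inj_eq (weyl_op_inj charK)).
apply: contraNneq c0 => /(congr1 (mcoeff g0)).
rewrite raddf_sum mcoeff0 (bigD1 g0) //= big1 => [|g gg].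
  by rewrite addr0 mcoeffZ mcoeffX eqxx mulr1 => ->.
by rewrite mcoeffZ mcoeffX -bmeqP (negPf gg) mulr0.
Qed.
End Annihilators.

(** * Degrees in the twisted module *)

Section JacobianDegrees.
Variables (n : nat) (K : fieldType).
Local Notation P := {mpoly K[n]}.

Lemma msize_prod_le (I : Type) (r : seq I) (F : I -> P) (b : I -> nat) :
  (forall i, msize (F i) <= (b i).+1)%N ->
  (msize (\prod_(i <- r) F i) <= (\sum_(i <- r) b i).+1)%N.
Proof.
move=> Fb; elim: r => [|i r IH]; first by rewrite !big_nil msize1.
by rewrite !big_cons; apply: msizeM_leq.
Qed.

Lemma msize_det_le (A : 'M[P]_n) (b : 'I_n -> nat) :
  (forall i j, msize (A i j) <= (b i).+1)%N ->
  (msize (\det A) <= (\sum_i b i).+1)%N.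
Proof.
move=> Ab; apply: msize_sum_le => s _.
rewrite -signr_odd; case: odd => /=; rewrite ?mulN1r ?mul1r ?mmeasureN;
  by apply: msize_prod_le => i; apply: Ab.
Qed.

Variable sigma : {lrmorphism P -> P}.
Hypothesis sJ : jacobian_map sigma.
Local Notation d := (endo_degree sigma).

Lemma msize_endo i : (msize (sigma 'X_i) <= d.+1)%N.
Proof.
have := leq_bigmax (F := fun i => (msize (sigma 'X_i)).-1) i.
by rewrite -/(endo_degree sigma); case: (msize _).
Qed.

Lemma endo_degree_gt0 : (0 < n)%N -> (0 < d)%N.
Proof.
move=> n0; rewrite lt0n; apply/eqP => d0.
have [c c0] := sJ; have -> : endo_jacobian_mx sigma = 0.
  apply/matrixP => k j; rewrite !mxE.
  have := msize_endo k; rewrite d0 => /msize1_polyC ->.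
  by rewrite mderivC.
by rewrite -[n](prednK n0) det0 => /esym/eqP; rewrite mpolyC_eq0 (negPf c0).
Qed.

Lemma msize_jacobian_der_var i j :
  (msize (jacobian_der sigma i 'X_j) <= ((n - 1) * (d - 1)).+1)%N.
Proof.
have [c c0 Ec] := sJ; rewrite /jacobian_der Ec.
have -> : (c%:MP)^-1 = (c^-1)%:MP :> P.
  rewrite -[LHS]mul1r; apply/(canLR (mulrK _)).
    by apply/unitrP; exists (c^-1)%:MP; rewrite -!mpolyCM mulVf // mulfV.
  by rewrite -mpolyCM mulVf.
rewrite mul_mpolyC; apply: leq_trans (msizeZ_le _ _) _.
have d0 := endo_degree_gt0 (leq_ltn_trans (leq0n i) (ltn_ord i)).
(* Row [i] contains the derivatives of a variable, which are constants; each of the other [n - 1]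
   rows contributes [d - 1]. *)
apply: leq_trans (msize_det_le (b := fun k => if k == i then 0%N else (d - 1)%N) _) _.
  move=> k l; rewrite mxE; case: eqP => _.
    by apply: leq_trans (msize_mderiv _ _) _; rewrite msizeX mdeg1.
  apply: leq_trans (msize_mderiv _ _) _.
  by have := msize_endo k; lia.
rewrite (bigD1 i) //= eqxx add0n.
rewrite (eq_bigr (fun=> (d - 1)%N)) => [|k /negPf -> //].
by rewrite sum_nat_const cardC1 card_ord !subn1.
Qed.

Lemma msize_jacobian_der i m (v : P) : ((n - 1) * (d - 1) <= m.+1)%N ->
  (msize (jacobian_der sigma i v) <= msize v + m)%N.
Proof.
move=> dm; rewrite jacobian_derE; apply: msize_sum_le => j _.
have [->|a0] := eqVneq (jacobian_der sigma i 'X_j) 0; first by rewrite mul0r mmeasure0.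
have [->|b0] := eqVneq v^`M(j) 0; first by rewrite mulr0 mmeasure0.
rewrite msizeM //; have := msize_jacobian_der_var i j; have := msize_mderiv j v.
move: ((n - 1) * (d - 1))%N dm => D dm.
have : (0 < msize v^`M(j))%N by rewrite lt0n mmeasure_poly_eq0.
move: (msize v^`M(j)) (msize v) (msize (jacobian_der sigma i 'X_j)) => a b c; lia.
Qed.
End JacobianDegrees.

Section TwistedModule.
Variables (n : nat) (K : fieldType).
Local Notation P := {mpoly K[n]}.
Variable sigma : {lrmorphism P -> P}.
Hypothesis sJ : jacobian_map sigma.
Local Notation d := (endo_degree sigma).
Local Notation M := (twisted (weyl_ext sJ) (polymod n K) : lmodType (weyl n K)).

Lemma twisted_x i (v : M) : weyl_x K i *: v = (sigma 'X_i * (v : P) : P).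
Proof.
rewrite -[LHS]/(weyl_ext sJ (weyl_x K i) *: (v : polymod n K)).
by rewrite weyl_ext_x polymod_poly.
Qed.

Lemma twisted_d i (v : M) : weyl_d K i *: v = (jacobian_der sigma i v : P).
Proof.
rewrite -[LHS]/(weyl_ext sJ (weyl_d K i) *: (v : polymod n K)).
by rewrite weyl_ext_d jacobian_der_eltE.
Qed.

Lemma twisted_alg c (v : M) : c%:A *: v = (c *: (v : P) : P).
Proof.
rewrite -[LHS]/(weyl_ext sJ c%:A *: (v : polymod n K)) linearZ /= rmorph1.
rewrite -[LHS]/(weyl_act (@poly_x n K) (@poly_d n K) (c%:A) v).
by rewrite (weyl_actZ (poly_operators n K)) (weyl_act1 (poly_operators n K)).
Qed.

(** The identity, in the role of the abstract map [p] of the lemmas on filtered modules. *)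
Definition twisted_poly (v : M) : P := v.

Lemma twisted_poly_linear c (u v : M) :
  twisted_poly (c%:A *: u + v) = c *: twisted_poly u + twisted_poly v.
Proof. by rewrite twisted_alg. Qed.

Lemma twisted_poly_inj (u : M) : twisted_poly u = 0 -> u = 0.
Proof. by []. Qed.

Lemma twisted_growth m : (d <= m)%N -> ((n - 1) * (d - 1) <= m.+1)%N ->
  forall g (v : M), (msize (twisted_poly (weyl_op 'X_[g] *: v)) <=
                     msize (twisted_poly v) + m * mdeg g)%N.
Proof.
move=> dm dm' g v; rewrite /weyl_op mmapX /mmap1 mdegE.
elim: (index_enum _) => [|i r IH]; first by rewrite !big_nil scale1r muln0 addn0.
rewrite !big_cons -scalerA mulnDr; move: IH; set w := _ *: v; move: w => w.
elim: (g i) => [|k IHk] wv; first by rewrite expr0 scale1r muln0.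
rewrite exprS -scalerA; move: (IHk wv); set u := _ *: w; move: u => u uw.
rewrite mulnS -addnA [X in (_ <= X)%N]addnCA addnC; apply: leq_trans (leq_add uw (leqnn m)).
rewrite /weyl_gen; case: split => j; last by rewrite twisted_d; apply: msize_jacobian_der.
rewrite twisted_x /twisted_poly; have [->|u0] := eqVneq (u : P) 0.
  by rewrite mulr0 mmeasure0.
have [->|s0] := eqVneq (sigma 'X_j) 0; first by rewrite mul0r mmeasure0.
rewrite msizeM //; have := msize_endo sigma j.
by move: (msize (sigma 'X_j)) (msize u) => a b; lia.
Qed.
End TwistedModule.

(** * Growth and Gelfand-Kirillov dimension *)

Section Growth.
Variable R : realType.

Lemma powR_unbounded (e C : R) : 0 < e ->
  exists N, forall i, (N <= i)%N -> C < powR i%:R e.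
Proof.
move=> e0; pose B := `|C| + 1; have B0 : 0 < B by rewrite ltr_wpDl.
pose x := powR B e^-1; exists (Num.Def.archi_bound x) => i xi.
apply: le_lt_trans (_ : B < _); first by rewrite ler_wpDr ?ler_norm.
have -> : B = powR x e.
  by rewrite -powRrM mulVf ?gt_eqF // powRr1 // ltW.
apply: gt0_ltr_powR; rewrite ?nnegrE ?powR_ge0 //.
apply: lt_le_trans (archi_boundP (powR_ge0 _ _)) _.
by rewrite ler_nat.
Qed.

Lemma growth_degree_le (f : nat -> nat) n C :
  (forall i, (f i <= C * i.+1 ^ n)%N) -> (growth_degree R f <= EFin n%:R)%O.
Proof.
move=> fC; apply/lee_addgt0Pr => e e0; rewrite -EFinD.
apply: ereal_inf_lbound; exists (n%:R + e) => //.
(* The factor [2 ^ n] pays for replacing [i.+1] by [2 * i], and the power [i ^ e] eventually absorbs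
   the constants. *)
have [N NP] := powR_unbounded (C * 2 ^ n)%:R e0.
exists N.+1 => i Ni; have i0 : (0 < i)%N by apply: leq_trans Ni.
rewrite powRD; last by rewrite pnatr_eq0 -lt0n i0 implybT.
rewrite powR_mulrn //; apply: le_trans (_ : ((C * 2 ^ n)%:R * i%:R ^+ n <= _)).
  rewrite -natrX -natrM ler_nat; apply: leq_trans (fC i) _.
  rewrite -mulnA leq_mul2l -expnMn; apply/orP; right.
  by case: (n) => // m; rewrite leq_exp2r //; lia.
rewrite mulrC ler_wpM2l ?exprn_ge0 // ltW //; apply: NP; exact: ltnW.
Qed.

Lemma growth_degree_ge (f : nat -> nat) n C :
  (forall i, (i ^ n <= C * f i)%N) -> (EFin n%:R <= growth_degree R f)%O.
Proof.
move=> fC; apply: le_ereal_inf_tmp => _ [r -> [N NP]]; rewrite lee_fin leNgt.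
apply/negP => rn; have e0 : 0 < n%:R - r by rewrite subr_gt0.
have [N' N'P] := powR_unbounded C%:R e0.
pose i := (N + N').+1; have i0 : 0 < i%:R :> R by rewrite ltr0n.
have : (i ^ n)%:R <= C%:R * powR i%:R r :> R.
  apply: le_trans (_ : (C * f i)%:R <= _); first by rewrite ler_nat.
  by rewrite natrM ler_wpM2l // NP // /i -addSn; lia.
rewrite leNgt => /negP; apply.
rewrite natrX -powR_mulrn ?ler0n // -(subrK r n%:R) powRD; last first.
  by rewrite (gt_eqF i0) implybT.
rewrite ltr_pM2r ?powR_gt0 //; apply: N'P; rewrite /i; lia.
Qed.
End Growth.

(** * Injectivity of Jacobian maps *)

Section JacobianMapInjective.
Variables (n : nat) (K : fieldType).
Hypothesis charK : [pchar K] =i pred0.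
Local Notation P := {mpoly K[n]}.
Variable sigma : {lrmorphism P -> P}.
Hypothesis sJ : jacobian_map sigma.
Local Notation der := (jacobian_der sigma).

Lemma jacobian_derD i p q : der i (p + q) = der i p + der i q.
Proof.
rewrite 3!jacobian_derE -big_split; apply: eq_bigr => j _ /=.
by rewrite mderivD mulrDr.
Qed.

Lemma jacobian_derZ i c p : der i (c *: p) = c *: der i p.
Proof.
rewrite 2!jacobian_derE scaler_sumr; apply: eq_bigr => j _.
by rewrite mderivZ scalerAr.
Qed.

Lemma jacobian_derM i p q : der i (p * q) = der i p * q + p * der i q.
Proof.
rewrite [LHS]jacobian_derE [X in X * q + _]jacobian_derE [X in _ + p * X]jacobian_derE.
rewrite mulr_suml mulr_sumr -big_split; apply: eq_bigr => j _ /=.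
by rewrite mderivM mulrDr; congr (_ + _); [apply: mulrA|apply: mulrCA].
Qed.

Lemma jacobian_derC i c : der i c%:MP = 0.
Proof. by rewrite jacobian_derE big1 // => j _; rewrite mderivC mulr0. Qed.

Lemma jacobian_der_endo i p : der i (sigma p) = sigma p^`M(i).
Proof.
elim/mpoly_gen_ind: p => [p q IHp IHq|c p IHp|p q IHp IHq||j].
- by rewrite mderivD !rmorphD /= jacobian_derD IHp IHq.
- by rewrite mderivZ !linearZ /= jacobian_derZ IHp.
- by rewrite mderivM rmorphD !rmorphM /= jacobian_derM IHp IHq.
- by rewrite rmorph1 -mpolyC1 mderivC rmorph0 jacobian_derC.
by rewrite jacobian_der_sigma // mderiv_var rmorph_nat eq_sym.
Qed.

Lemma lrmorph_mpolyC c : sigma c%:MP = c%:MP.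
Proof. by rewrite -alg_mpolyC linearZ /= rmorph1. Qed.

(** The kernel of [sigma] is closed under partial derivatives by [jacobian_der_endo]; in
    characteristic zero, differentiating a nonzero element of it would end at a nonzero constant,
    which [sigma] fixes. *)
Lemma jacobian_map_inj : injective sigma.
Proof.
suff H k p : (msize p <= k)%N -> sigma p = 0 -> p = 0.
  move=> p q /eqP; rewrite -subr_eq0 -rmorphB => /eqP/(H _ _ (leqnn _))/eqP.
  by rewrite subr_eq0 => /eqP.
elim: k p => [|k IHk] p pk sp; first by apply/eqP; rewrite -(mmeasure_poly_eq0 mdeg) -leqn0.
have [p1|/(mderiv_neq0 charK)[i /eqP[]]] := leqP (msize p) 1.
  move: sp; rewrite (msize1_polyC p1) lrmorph_mpolyC => /eqP.
  by rewrite mpolyC_eq0 => /eqP ->.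
apply: IHk; last by rewrite -jacobian_der_endo sp -[0]mpolyC0 jacobian_derC.
by apply: leq_trans (msize_mderiv _ _) _; rewrite -ltnS; case: (msize p) pk.
Qed.
End JacobianMapInjective.

Section TwistedDimension.
Variables (R : realType) (n : nat) (K : fieldType).
Hypothesis charK : [pchar K] =i pred0.
Local Notation P := {mpoly K[n]}.
Variable sigma : {lrmorphism P -> P}.
Hypothesis sJ : jacobian_map sigma.
Local Notation A := (weyl n K).
Local Notation M := (twisted (weyl_ext sJ) (polymod n K) : lmodType (weyl n K)).
Local Notation p := (@twisted_poly n K sigma sJ).

Lemma lin_indep_size (s : seq M) k :
  (forall v, v \in s -> (msize (p v) <= k)%N) -> lin_indep s ->
  (size s <= #|{: 'X_{1..n < k}}|)%N.
Proof.
move=> sk si; rewrite leqNgt; apply/negP => lt.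
have Fk (i : 'I_(size s)) : (msize (p s`_i) <= k)%N by apply: sk; apply: mem_nth.
have := dependent_family (@twisted_poly_linear n K sigma sJ)
  (@twisted_poly_inj n K sigma sJ) Fk.
rewrite card_ord => /(_ lt)[c [i ci] /si/(_ i) ci0].
by rewrite ci0 eqxx in ci.
Qed.

Lemma kdim_le (s : seq M) b :
  (forall s', subseq s' s -> lin_indep s' -> (size s' <= b)%N) -> (kdim s <= b)%N.
Proof. by move=> H; apply/bigmax_leqP => m /asboolP; apply/H/mask_subseq. Qed.

Lemma kdim_ge (s s' : seq M) : subseq s' s -> lin_indep s' -> (size s' <= kdim s)%N.
Proof.
move=> /subseqP[m /eqP sm ->] si.
by apply: (@leq_bigmax_cond _ _ (fun b : (size s).-tuple bool => size (mask b s)) (Tuple sm));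
  apply/asboolP.
Qed.

Lemma gk_filtration_msize (v : seq A) (s : seq M) :
  exists D e, forall i u, u \in gk_filtration v s i -> (msize (p u) <= e + D * i)%N.
Proof.
pose m := (endo_degree sigma + (n - 1) * (endo_degree sigma - 1))%N.
have growth := @twisted_growth n K sigma sJ m (leq_addr _ _) (leqW (leq_addl _ _)).
have op_growth (t : {mpoly K[n + n]}) (u : M) :
    (msize (p (weyl_op t *: u)) <= msize (p u) + m * msize t)%N.
  rewrite weyl_op_actE (embed_sum (@twisted_poly_linear n K sigma sJ)) big_seq.
  apply: msize_sum_le => g gt; apply: leq_trans (msizeZ_le _ _) _.
  apply: leq_trans (growth _ _) _; rewrite leq_add2l leq_mul2l.
  by rewrite ltnW ?orbT // msize_mdeg_lt.
have [t tP] := boolp.choice (@weyl_op_surj n K).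
exists (\max_(a <- v) (m * msize (t a)))%N, (\max_(u <- s) msize (p u))%N.
elim=> [|i IH] u /=; first by move=> us; rewrite muln0 addn0; apply: leq_bigmax_seq.
rewrite mulnS mem_cat => /orP[/IH ui|/allpairsP[[a w] /= [av wi ->]]].
  by apply: leq_trans ui _; rewrite leq_add2l leq_addl.
rewrite (tP a); apply: leq_trans (op_growth _ _) _.
rewrite addnCA addnC; apply: leq_add; last exact: IH.
exact: (leq_bigmax_seq (F := fun a => (m * msize (t a))%N)).
Qed.

Lemma twisted_gk_dim_le : (gk_dim M R <= EFin n%:R)%O.
Proof.
apply: ge_ereal_sup => _ [v [s ->]].
have [D [e H]] := gk_filtration_msize v s.
apply: (@growth_degree_le _ _ _ ((n + e + D) ^ n)) => i.
apply: kdim_le => s' /mem_subseq ss' si.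
have s'k u : u \in s' -> (msize (p u) <= (e + D * i).+1)%N by move=> /ss'/H/leqW.
apply: leq_trans (lin_indep_size s'k si) _.
apply: leq_trans (leq_pmull _ (fact_gt0 n)) _; apply: leq_trans (card_bmultinom_le _ _) _.
by rewrite -expnMn; case: (n) => // n'; rewrite leq_exp2r // !mulnDl; nia.
Qed.

(** With the generators [x_i] and the vector 1, step [i] of the filtration contains the images under
    [sigma] of all monomials of degree at most [i]; they are independent because [sigma] is
    injective. *)
Lemma twisted_gk_dim_ge : (EFin n%:R <= gk_dim M R)%O.
Proof.
pose v : seq A := [seq weyl_x K i | i : 'I_n]; pose s : seq M := [:: (1 : P)].
apply: (@le_trans _ _ (growth_degree R (fun i => kdim (gk_filtration v s i)))); last first.
  by apply: ereal_sup_ubound; exists v, s.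
apply: (@growth_degree_ge _ _ _ n`!) => i.
have mem_filt a : (mdeg a <= i)%N -> (sigma 'X_[a] : M) \in gk_filtration v s i.
  elim: i a => [|i IH] a ai.
    move: ai; rewrite leqn0 mdeg_eq0 => /eqP ->.
    by rewrite mpolyX0 rmorph1 inE.
  rewrite mem_cat; have [/IH -> //|ia] := leqP (mdeg a) i.
  have : (mdeg a != 0)%N by rewrite -lt0n; apply: leq_ltn_trans ia.
  rewrite mdegE sum_nat_eq0 negb_forall => /existsP[j] /=; rewrite -lt0n => aj.
  have Ea : (U_(j) + (a - U_(j)))%MM = a by rewrite addmC submK // lep1mP -lt0n.
  apply/orP; right; apply/allpairsP.
  exists (weyl_x K j, sigma 'X_[a - U_(j)] : M); split=> /=.
  - by apply: map_f; rewrite mem_enum.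
  - by apply: IH; move: ai; rewrite -{1}Ea mdegD mdeg1.
  by rewrite twisted_x -rmorphM /= -mpolyXD Ea.
pose L : seq M := [seq (sigma 'X_[val a] : M) | a : 'X_{1..n < i.+1}].
have Linj : injective (fun a : 'X_{1..n < i.+1} => sigma 'X_[val a] : M).
  move=> a b /(jacobian_map_inj charK sJ)/(congr1 (mcoeff (val a))).
  rewrite !mcoeffX eqxx eq_sym; case: eqP => [/val_inj //|_ /eqP].
  by rewrite oner_eq0.
have Luniq : uniq L by rewrite map_inj_uniq // enum_uniq.
(* [kdim] sees only subsequences of the spanning family, so the monomial images are reread in the
   order in which the filtration lists them, without repetition. *)
pose L' := undup [seq u <- gk_filtration v s i | u \in L].
have LL' : perm_eq L' L.
  apply: uniq_perm => //; first exact: undup_uniq.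
  move=> u; rewrite mem_undup mem_filter andb_idr // => /mapP[a _ ->].
  by apply: mem_filt; rewrite -ltnS bmdeg.
apply: leq_trans (_ : n`! * size L' <= _)%N; last first.
  rewrite leq_mul2l; apply/orP; right; apply: kdim_ge.
    exact: subseq_trans (undup_subseq _) (filter_subseq _ _).
  move=> c; under eq_bigr do rewrite twisted_alg.
  have aP (k : 'I_(size L')) : exists a : 'X_{1..n < i.+1}, sigma 'X_[val a] = (L'`_k : M).
    have : L'`_k \in L by rewrite -(perm_mem LL') mem_nth.
    by case/mapP=> a _ ->; exists a.
  have [f fP] := boolp.choice aP.
  under eq_bigr do rewrite -fP -linearZ /=.
  rewrite -raddf_sum /= -[X in _ = X](raddf0 sigma).
  move=> /(jacobian_map_inj charK sJ) E k.
  have := congr1 (mcoeff (f k)) E; rewrite raddf_sum mcoeff0 (bigD1 k) //= big1.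
    by rewrite addr0 mcoeffZ mcoeffX eqxx mulr1.
  move=> l lk; rewrite mcoeffZ mcoeffX; case: eqP => [fl|]; last by rewrite mulr0.
  have := congr1 (fun b => sigma 'X_[b] : M) fl; rewrite !fP => /eqP.
  by rewrite nth_uniq ?undup_uniq // => /eqP/val_inj/eqP; rewrite (negPf lk).
rewrite (perm_size LL') size_map -cardE; apply: leq_trans (card_bmultinom_ge n i).
by case: (n) => // n'; rewrite leq_exp2r.
Qed.
End TwistedDimension.

(** * Unique factorization *)

Section Factorial.
Variable R : idomainType.
Implicit Types a b p q u : R.

Definition divides p a := exists c, a = p * c.

Definition prime_elt p :=
  [/\ p != 0, p \isn't a GRing.unit & forall a b, divides p (a * b) -> divides p a \/ divides p b].

Definition factorization a (u : R) (s : seq R) :=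
  [/\ u \is a GRing.unit, (forall p, p \in s -> prime_elt p) & a = u * \prod_(p <- s) p].

Lemma divides_mulr p a b : divides p a -> divides p (a * b).
Proof. by case=> c ->; exists (c * b); rewrite mulrA. Qed.

Lemma divides_mull p a b : divides p b -> divides p (a * b).
Proof. by rewrite mulrC; apply: divides_mulr. Qed.

Lemma dividesD p a b : divides p a -> divides p b -> divides p (a + b).
Proof. by case=> c -> [d ->]; exists (c + d); rewrite mulrDr. Qed.

Lemma dividesN p a : divides p a -> divides p (- a).
Proof. by case=> c ->; exists (- c); rewrite mulrN. Qed.

Lemma divides_sum p (I : Type) (r : seq I) (P : pred I) (F : I -> R) :
  (forall i, P i -> divides p (F i)) -> divides p (\sum_(i <- r | P i) F i).
Proof.
move=> H; elim/big_rec: _ => [|i x /H]; first by exists 0; rewrite mulr0.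
exact: dividesD.
Qed.

Lemma prime_nunit_divides p u : prime_elt p -> u \is a GRing.unit -> ~ divides p u.
Proof.
by case=> _ np _ uu [c E]; move: uu; rewrite E unitrM (negPf np).
Qed.

Lemma prime_divides_prod p (s : seq R) : prime_elt p ->
  divides p (\prod_(q <- s) q) -> exists2 q, q \in s & divides p q.
Proof.
move=> pp; elim: s => [|q s IH].
  by rewrite big_nil => /(prime_nunit_divides pp); rewrite unitr1 => /(_ isT).
rewrite big_cons; case: pp => _ _ pp /pp[pq|/IH[r rs pr]].
  by exists q; rewrite ?mem_head.
by exists r; rewrite ?in_cons ?rs ?orbT.
Qed.

Lemma prime_divides_prime p q : prime_elt p -> prime_elt q -> divides p q ->
  exists2 w, w \is a GRing.unit & q = p * w.
Proof.
case=> p0 pn pp [q0 qn qq] [w E]; exists w => //.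
have /qq : divides q (p * w) by exists 1; rewrite mulr1.
case=> [[v Ev]|[v Ev]].
  apply/unitrPr; exists v; apply: (mulfI q0).
  by rewrite mulr1 [w * v]mulrC mulrA -Ev -E.
case/negP: pn; apply/unitrPr.
by exists v; apply: (mulfI q0); rewrite mulr1 mulrCA -Ev -E.
Qed.

Lemma factorization_cancel a b u s : prime_elt a -> factorization (a * b) u s ->
  exists v t, factorization b v t /\ (size t).+1 = size s.
Proof.
move=> pa [uu ps E].
have : divides a (u * \prod_(p <- s) p) by exists b.
have [a0 _ pa'] := pa; case/pa' => [/(prime_nunit_divides pa)//|].
case/(prime_divides_prod pa) => q qs /(prime_divides_prime pa (ps q qs))[w uw Eq].
exists (u * w), (rem q s); split; last by rewrite size_rem // prednK //; case: (s) qs.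
split; first by rewrite unitrM uu.
  by move=> r /mem_rem/ps.
apply: (mulfI a0); rewrite {}E (perm_big _ (perm_to_rem qs)) /= big_cons Eq.
by rewrite !mulrA [u * a]mulrC.
Qed.

(** Factors are required to be prime rather than irreducible, so uniqueness of factorizations is
    built in. *)
Definition factorial_ring := forall a, a != 0 -> exists u s, factorization a u s.

Lemma factorization_mul a b u v s t :
  factorization a u s -> factorization b v t -> factorization (a * b) (u * v) (s ++ t).
Proof.
case=> uu ps -> [vv pt ->]; split; first by rewrite unitrM uu.
  by move=> p; rewrite mem_cat => /orP[/ps|/pt].
by rewrite big_cat /= mulrACA.
Qed.

Lemma factorial_prime_divisor a : factorial_ring -> a != 0 -> a \isn't a GRing.unit ->
  exists2 p, prime_elt p & divides p a.
Proof.
move=> fR a0 an; have [u [[|p s] [uu ps E]]] := fR a a0.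
  by move: an; rewrite E big_nil mulr1 uu.
exists p; first by apply: ps; rewrite mem_head.
by exists (u * \prod_(q <- s) q); rewrite E big_cons mulrCA.
Qed.
End Factorial.

Lemma factorial_field (F : fieldType) : @factorial_ring F.
Proof.
move=> a a0; exists a, [::]; split=> //; first by rewrite unitfE.
by rewrite big_nil mulr1.
Qed.

Lemma factorial_iso (R S : idomainType) (f : {rmorphism R -> S}) (g : {rmorphism S -> R}) :
  cancel f g -> cancel g f -> @factorial_ring R -> @factorial_ring S.
Proof.
move=> fK gK fR a a0.
have ga0 : g a != 0 by apply: contraNneq a0 => ga; rewrite -[a]gK ga rmorph0.
have fdiv p b : divides p b -> divides (f p) (f b).
  by case=> c ->; exists (f c); rewrite rmorphM.
have gdiv p b : divides p b -> divides (g p) (g b).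
  by case=> c ->; exists (g c); rewrite rmorphM.
have [u [s [uu ps E]]] := fR _ ga0; exists (f u), (map f s); split.
- exact: rmorph_unit.
- move=> _ /mapP[p /ps[p0 pn pp] ->]; split.
  + by apply: contraNneq p0 => fp; rewrite -[p]fK fp rmorph0.
  + by apply: contraNN pn => /(rmorph_unit g); rewrite fK.
  move=> b c /gdiv; rewrite fK rmorphM => /pp[/fdiv|/fdiv]; rewrite !gK;
    by [left|right].
by rewrite -[a]gK E rmorphM rmorph_prod big_map.
Qed.

(** * The lemma of Gauss *)

Section FactorialPoly.
Variable R : idomainType.
Hypothesis fR : @factorial_ring R.
Implicit Types f g h : {poly R}.

Lemma divides_polyC (p : R) f : divides p%:P f <-> forall i, divides p f`_i.
Proof.
split=> [[c ->] i|H]; first by exists c`_i; rewrite coefCM.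
have [c cP] := boolp.choice H; exists (\poly_(i < size f) c i).
apply/polyP => i; rewrite coefCM coef_poly; case: ltnP => [_|si]; first exact: cP.
by rewrite mulr0 nth_default.
Qed.

(** If [i] and [j] are the least indices at which [p] fails to divide the coefficients of [f] and
    [g], the coefficient of [f * g] at [i + j] is [f_i * g_j] plus multiples of [p]. *)
Lemma prime_polyC (p : R) : prime_elt p -> prime_elt p%:P.
Proof.
move=> [p0 pn pp]; split; first by rewrite polyC_eq0.
  apply: contraNN pn; rewrite poly_unitE coefC eqxx => /andP[].
  by [].
move=> f g fg; apply: contrapT => /not_orP[nf ng].
have ex_nd h : ~ divides p%:P h -> exists i, `[< ~ divides p h`_i >].
  move=> nh; apply: contrapT => H; apply/nh/divides_polyC => i.
  by apply: contrapT => ni; apply: H; exists i; apply/asboolP.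
case: (ex_minnP (ex_nd f nf)) => i /asboolP ni imin.
case: (ex_minnP (ex_nd g ng)) => j /asboolP nj jmin.
have lo h k m : (forall l, `[< ~ divides p h`_l >] -> (k <= l)%N) -> (m < k)%N -> divides p h`_m.
  move=> H mk; apply: contrapT => nm; have := H m; rewrite leqNgt mk.
  by move=> /(_ (introT (asboolP _) nm)).
have ij : (i < (i + j).+1)%N by rewrite ltnS leq_addr.
have /divides_polyC/(_ (i + j)%N) := fg.
rewrite coefM (bigD1 (Ordinal ij)) //= addKn => H.
have : divides p (f`_i * g`_j).
  set X := f`_i * g`_j; set Y := \sum_(_ | _) _ in H *.
  rewrite -[X](addrK Y); apply: dividesD => //; apply: dividesN.
  apply: divides_sum => k ki; have [lt|le] := ltnP k i.
    by apply: divides_mulr; apply: lo imin _.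
  apply/divides_mull/(lo _ _ _ jmin).
  have ltik : (i < k)%N by rewrite ltn_neqAle le andbT eq_sym; exact: ki.
  by rewrite ltn_subLR ?ltn_add2r // -ltnS ltn_ord.
by case/pp.
Qed.

Definition primitive f := forall p : R, prime_elt p -> ~ divides p%:P f.

Lemma factorization_polyC (a u : R) s : factorization a u s ->
  factorization a%:P u%:P [seq p%:P | p <- s].
Proof.
move=> [uu ps ->]; split; first by rewrite rmorph_unit.
  by move=> _ /mapP[p /ps pp ->]; apply: prime_polyC.
by rewrite rmorphM rmorph_prod big_map.
Qed.

(** Every prime constant extracted from [f] also divides its leading coefficient, so the number of
    prime factors of the latter bounds the number of extractions. *)
Lemma primitive_part f : f != 0 ->
  exists (c : R) g, [/\ c != 0, primitive g & f = c%:P * g].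
Proof.
move=> f0; have lf0 : lead_coef f != 0 by rewrite lead_coef_eq0.
have [u [s E]] := fR lf0.
move: {2}(size s) (erefl (size s)) => k sk.
elim: k f u s f0 {lf0} E sk => [|k IH] f u s f0 E sk.
  exists 1, f; split; rewrite ?oner_eq0 ?mul1r // => p pp [g Eg].
  apply: (@prime_nunit_divides _ p u pp); first by case: E.
  case: E => _ _; rewrite (size0nil sk) big_nil mulr1 => <-.
  by rewrite Eg lead_coefM lead_coefC; exists (lead_coef g).
have [pf|] := pselect (primitive f); first by exists 1, f; rewrite oner_eq0 mul1r.
move=> /existsNP[p /not_implyP[pp /contrapT[g Eg]]].
have g0 : g != 0 by apply: contraNneq f0 => g0; rewrite Eg g0 mulr0.
move: E; rewrite Eg lead_coefM lead_coefC => /(factorization_cancel pp)[v [t [Et st]]].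
have tk : size t = k by apply/eqP; rewrite -eqSS st sk.
have [c [h [c0 hp Eh]]] := IH _ _ _ g0 Et tk.
exists (p * c), h; split=> //; last by rewrite Eh polyCM mulrA.
by rewrite mulf_neq0 //; case: pp.
Qed.

(** Each prime factor of [c] divides [g * h], hence [h] since [g] is primitive, and can be
    cancelled. *)
Lemma primitive_cancel (c : R) f g h : c != 0 -> primitive g -> c%:P * f = g * h -> divides g f.
Proof.
move=> /fR[u [s [uu ps ->]]] gp; elim: s h ps => [|p s IH] h ps.
  rewrite big_nil mulr1 => E; exists (u^-1%:P * h).
  by rewrite mulrCA -E mulrA -polyCM mulVr // mul1r.
rewrite big_cons mulrCA polyCM -mulrA => E.
have pp : prime_elt p by apply: ps; rewrite mem_head.
have [p0 _ pP] := prime_polyC pp.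
have : divides p%:P (g * h) by rewrite -E; exists ((u * \prod_(j <- s) j)%:P * f).
case/pP=> [/gp//|[h' Eh]]; apply: (IH h'); first by move=> q qs; apply: ps; rewrite in_cons qs orbT.
by apply: (mulfI p0); rewrite E Eh mulrCA.
Qed.

Lemma primitive_dvdp g f : primitive g -> (g %| f)%R -> divides g f.
Proof.
move=> gp /Pdiv.WeakIdomain.dvdpP[[c q] /= c0 E]; apply: primitive_cancel c0 gp _.
by rewrite mul_polyC E mulrC.
Qed.

(** [gcdp g x] is a greatest common divisor only up to constants, but its primitive part [h] divides
    [g] and [x] in the ring itself. Either the gcd is constant, and [g] divides [y], or
    irreducibility makes [g] a constant multiple of [h], and [g] divides [x]. *)
Lemma primitive_irreducible_prime g : (1 < size g)%N -> primitive g ->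
  (forall a b, g = a * b -> size a = 1 \/ size b = 1) -> prime_elt g.
Proof.
move=> g1 gp gi; have g0 : g != 0 by rewrite -size_poly_gt0 ltnW.
split=> //; first by rewrite poly_unitE gtn_eqF.
move=> x y [q Exy]; have gxy : g %| x * y by rewrite Exy dvdp_mulr.
have [h1|h1] := eqVneq (size (gcdp g x)) 1.
  right; apply: (primitive_dvdp gp); move: gxy; rewrite Gauss_dvdpr //.
  by rewrite coprimep_def h1.
left; have h0 : gcdp g x != 0 by rewrite gcdp_eq0 negb_and g0.
have [c [h [c0 hp Eh]]] := primitive_part h0.
have hsub z : gcdp g x %| z -> divides h z.
  move=> hz; apply: (primitive_dvdp hp); apply: dvdp_trans hz.
  by rewrite Eh dvdp_mull.
have [k Ek] := hsub _ (dvdp_gcdl g x); have [z Ez] := hsub _ (dvdp_gcdr g x).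
have sh : size h != 1.
  by move: h1; rewrite Eh mul_polyC size_scale.
case: (gi _ _ Ek) => [/eqP|/eqP]; first by rewrite (negPf sh).
case/size_poly1P=> e e0 Ee; apply: (primitive_cancel (h := z) e0 gp).
by rewrite Ez Ek Ee mulrCA mulrA.
Qed.

Lemma factorial_poly : @factorial_ring {poly R}.
Proof.
move=> f; move: {2}(size f) (leqnn (size f)) => k; elim: k f => [|k IH] f fk f0.
  by rewrite -size_poly_eq0 -leqn0 fk in f0.
have [c [g [c0 gp Ef]]] := primitive_part f0.
have [u [s Ec]] := fR c0.
suff [v [t Eg]] : exists v t, factorization g v t.
  by exists (u%:P * v), ([seq p%:P | p <- s] ++ t); rewrite Ef;
    apply: factorization_mul => //; apply: factorization_polyC.
have g0 : g != 0 by apply: contraNneq f0 => g0; rewrite Ef g0 mulr0.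
have gk : (size g <= k.+1)%N by move: fk; rewrite Ef mul_polyC size_scale.
have [g1|g1] := leqP (size g) 1.
  have {g1}/size_poly1P[e e0 Ee] : size g == 1%N by rewrite eqn_leq g1 size_poly_gt0.
  have [v [t Et]] := fR e0; exists v%:P, [seq p%:P | p <- t].
  by rewrite Ee; apply: factorization_polyC.
have [gi|] := pselect (forall a b, g = a * b -> size a = 1%N \/ size b = 1%N).
  exists 1, [:: g]; split; rewrite ?unitr1 //; last by rewrite big_seq1 mul1r.
  by move=> p; rewrite inE => /eqP ->; apply: primitive_irreducible_prime.
move=> /existsNP[a /existsNP[b /not_implyP[Eg /not_orP[a1 b1]]]].
have [a0 b0] : a != 0 /\ b != 0.
  by apply/andP; rewrite -negb_or -mulf_eq0 -Eg.
have big h : h != 0 -> size h <> 1%N -> (1 < size h)%N.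
  by move=> h0 h1; rewrite ltn_neqAle size_poly_gt0 h0 andbT eq_sym; apply/eqP.
have {}a1 := big _ a0 a1; have {}b1 := big _ b0 b1.
have sab : (size a + size b <= k.+2)%N.
  by move: gk; rewrite Eg size_mul //; case: (size a + size b)%N.
have ak : (size a <= k)%N.
  by rewrite -(leq_add2r 2); apply: leq_trans (leq_add (leqnn _) b1) _; rewrite addn2.
have bk : (size b <= k)%N.
  by rewrite -(leq_add2l 2); apply: leq_trans (leq_add a1 (leqnn _)) _; rewrite add2n.
have [[v [t Ea]] [w [r Eb]]] := (IH a ak a0, IH b bk b0).
by exists (v * w), (t ++ r); rewrite Eg; apply: factorization_mul.
Qed.
End FactorialPoly.

Lemma comp_mpolyM (n k : nat) (K : fieldType) (t : n.-tuple {mpoly K[k]}) :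
  {morph comp_mpoly t : p q / p * q}.
Proof. exact: rmorphM. Qed.

(** * One distinguished variable *)

Section OneVariable.
Variables (n : nat) (K : fieldType) (j : 'I_n.+1).
Local Notation C := {mpoly K[n]}.
Local Notation B := {mpoly K[n.+1]}.

(** The index [j] of the distinguished variable is arbitrary, since a prime [p] will dictate it: [p]
    must not divide [der j p]. *)
Definition mpoly_of_poly : {poly C} -> B :=
  horner_eval 'X_j \o map_poly (comp_mpoly [tuple ('X_(lift j k) : B) | k < n]).
HB.instance Definition _ := GRing.RMorphism.on mpoly_of_poly.

Let poly_var (i : 'I_n.+1) : {poly C} :=
  if unlift j i is Some k then ('X_k)%:P else 'X.

Definition poly_of_mpoly : B -> {poly C} := mmap (polyC \o @mpolyC n K) poly_var.
HB.instance Definition _ := GRing.RMorphism.on poly_of_mpoly.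

Lemma mpoly_of_polyD : {morph mpoly_of_poly : p q / p + q}.
Proof. exact: rmorphD. Qed.
Lemma mpoly_of_polyM : {morph mpoly_of_poly : p q / p * q}.
Proof. exact: rmorphM. Qed.
Lemma poly_of_mpolyD : {morph poly_of_mpoly : p q / p + q}.
Proof. exact: rmorphD. Qed.
Lemma poly_of_mpolyM : {morph poly_of_mpoly : p q / p * q}.
Proof. exact: rmorphM. Qed.
Lemma mpoly_of_poly1 : mpoly_of_poly 1 = 1.
Proof. exact: rmorph1. Qed.
Lemma poly_of_mpoly1 : poly_of_mpoly 1 = 1.
Proof. exact: rmorph1. Qed.

Lemma mpoly_of_polyC c :
  mpoly_of_poly c%:P = c \mPo [tuple ('X_(lift j k) : B) | k < n].
Proof. by rewrite /mpoly_of_poly /= map_polyC /horner_eval hornerC. Qed.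

Lemma mpoly_of_polyX : mpoly_of_poly 'X = 'X_j.
Proof. by rewrite /mpoly_of_poly /= map_polyX /horner_eval hornerX. Qed.

Lemma mpoly_of_poly_var k : mpoly_of_poly ('X_k)%:P = 'X_(lift j k).
Proof. by rewrite mpoly_of_polyC comp_mpolyXU -tnth_nth tnth_mktuple. Qed.

Lemma poly_of_mpolyC c : poly_of_mpoly c%:MP = c%:MP%:P.
Proof. by rewrite /poly_of_mpoly mmapC. Qed.

Lemma poly_of_mpolyX i : poly_of_mpoly 'X_i = poly_var i.
Proof. by rewrite /poly_of_mpoly mmapX mmap1U. Qed.

Lemma poly_of_mpolyK : cancel poly_of_mpoly mpoly_of_poly.
Proof.
elim/mpoly_gen_ind=> [p q IHp IHq|c p IHp|p q IHp IHq||i].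
- by rewrite poly_of_mpolyD mpoly_of_polyD; apply: (congr2 +%R IHp IHq).
- rewrite -mul_mpolyC poly_of_mpolyM mpoly_of_polyM; apply: (congr2 *%R _ IHp).
  by rewrite poly_of_mpolyC mpoly_of_polyC comp_mpolyC.
- by rewrite poly_of_mpolyM mpoly_of_polyM; apply: (congr2 *%R IHp IHq).
- by rewrite poly_of_mpoly1 mpoly_of_poly1.
rewrite poly_of_mpolyX /poly_var; case: unliftP => [k ->|->].
  exact: mpoly_of_poly_var.
exact: mpoly_of_polyX.
Qed.

Lemma mpoly_of_polyK : cancel mpoly_of_poly poly_of_mpoly.
Proof.
have polyC_K c : poly_of_mpoly (mpoly_of_poly c%:P) = c%:P.
  elim/mpoly_gen_ind: c => [p q IHp IHq|c p IHp|p q IHp IHq||i].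
  - by rewrite polyCD mpoly_of_polyD poly_of_mpolyD; apply: (congr2 +%R IHp IHq).
  - rewrite -mul_mpolyC polyCM mpoly_of_polyM poly_of_mpolyM; apply: (congr2 *%R _ IHp).
    by rewrite mpoly_of_polyC comp_mpolyC poly_of_mpolyC.
  - by rewrite polyCM mpoly_of_polyM poly_of_mpolyM; apply: (congr2 *%R IHp IHq).
  - by rewrite polyC1 mpoly_of_poly1 poly_of_mpoly1.
  by rewrite mpoly_of_poly_var poly_of_mpolyX /poly_var liftK.
elim/poly_ind => [|q c IH]; first by rewrite -polyC0 polyC_K.
rewrite mpoly_of_polyD mpoly_of_polyM poly_of_mpolyD poly_of_mpolyM.
apply: (congr2 +%R (congr2 *%R IH _) (polyC_K c)).
by rewrite mpoly_of_polyX poly_of_mpolyX /poly_var unlift_none.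
Qed.

Lemma mderiv_comp_lift (c : C) k :
  (c \mPo [tuple ('X_(lift j k) : B) | k < n])^`M(lift j k) =
  c^`M(k) \mPo [tuple ('X_(lift j k) : B) | k < n].
Proof.
elim/mpoly_gen_ind: c => [p q IHp IHq|c p IHp|p q IHp IHq||i].
- by rewrite !(comp_mpolyD, mderivD); apply: (congr2 +%R IHp IHq).
- by rewrite !(comp_mpolyZ, mderivZ); apply: (congr1 _ IHp).
- rewrite mderivM comp_mpolyD 3!comp_mpolyM mderivM.
  apply: (congr2 +%R (congr2 *%R IHp _) (congr2 *%R _ IHq)); by [].
- by rewrite comp_mpoly1 -!mpolyC1 !mderivC comp_mpoly0.
rewrite mderiv_var comp_mpolyXU -tnth_nth tnth_mktuple mderiv_var.
by rewrite (inj_eq lift_inj) rmorph_nat.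
Qed.

Lemma mderiv_comp_lift0 (c : C) :
  (c \mPo [tuple ('X_(lift j k) : B) | k < n])^`M(j) = 0.
Proof.
elim/mpoly_gen_ind: c => [p q IHp IHq|c p IHp|p q IHp IHq||i].
- by rewrite comp_mpolyD mderivD (congr2 +%R IHp IHq) addr0.
- by rewrite comp_mpolyZ mderivZ IHp scaler0.
- rewrite comp_mpolyM mderivM [X in X * _ + _]IHp [X in _ + _ * X]IHq.
  by rewrite mul0r mulr0 addr0.
- by rewrite comp_mpoly1 -mpolyC1 mderivC.
by rewrite comp_mpolyXU -tnth_nth tnth_mktuple mderiv_var eq_sym (negPf (neq_lift _ _)).
Qed.
End OneVariable.

Lemma factorial_mpoly n (K : fieldType) : @factorial_ring {mpoly K[n]}.
Proof.
elim: n => [|n IH].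
  have c0K : cancel (@mpolyC 0 K) (mcoeff 0%MM) by move=> c; rewrite mcoeffC eqxx mulr1.
  have cK : cancel (mcoeff 0%MM) (@mpolyC 0 K) by move=> p; rewrite -nvar0_mpolyC.
  exact: (factorial_iso c0K cK (@factorial_field K)).
apply: (@factorial_iso {poly {mpoly K[n]}} {mpoly K[n.+1]}
  (@mpoly_of_poly n K ord0 : {rmorphism _ -> _}) (@poly_of_mpoly n K ord0 : {rmorphism _ -> _})).
- exact: mpoly_of_polyK.
- exact: poly_of_mpolyK.
exact: factorial_poly.
Qed.

(** * Birational Jacobian maps are surjective *)

Lemma mpoly_unitP n (K : fieldType) (p : {mpoly K[n]}) :
  (p \is a GRing.unit) = (msize p == 1%N).
Proof.
apply/unitrP/eqP => [[q [qp pq]]|p1].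
  have p0 : p != 0 by apply/eqP => p0; move: pq; rewrite p0 mul0r => /esym/eqP; rewrite oner_eq0.
  have q0 : q != 0 by apply/eqP => q0; move: pq; rewrite q0 mulr0 => /esym/eqP; rewrite oner_eq0.
  have := congr1 (mmeasure mdeg) pq; rewrite msizeM // msize1.
  have : (0 < msize p)%N by rewrite lt0n mmeasure_poly_eq0.
  have : (0 < msize q)%N by rewrite lt0n mmeasure_poly_eq0.
  by move: (msize p) (msize q) => a b; lia.
have [c c0 ->] : exists2 c, c != 0 & p = c%:MP by apply/msize_poly1P; rewrite p1.
by exists (c^-1)%:MP; rewrite -!mpolyCM mulVf // mulfV.
Qed.

Section Birational.
Variables (n : nat) (K : fieldType).
Hypothesis charK : [pchar K] =i pred0.
Local Notation B := {mpoly K[n.+1]}.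
Local Notation C := {mpoly K[n]}.
Variable sigma : {lrmorphism B -> B}.
Hypothesis sJ : jacobian_map sigma.
Local Notation der := (jacobian_der sigma).

(** The relations [der i (sigma 'X_k) = (i == k)%:R] make the coefficient matrix of the derivations
    a left inverse of the transposed Jacobian matrix; for square matrices it is also a right
    inverse, which expresses the partial derivatives through the [der i]. *)
Lemma mderiv_jacobian_der l f :
  f^`M(l) = \sum_i (sigma 'X_i)^`M(l) * der i f.
Proof.
pose J := endo_jacobian_mx sigma; pose D : 'M[B]_n.+1 := \matrix_(i, k) der i 'X_k.
have DJ : D *m J^T = 1%:M.
  apply/matrixP => i k; rewrite !mxE -(jacobian_der_sigma sJ) jacobian_derE.
  by apply: eq_bigr => m _; rewrite !mxE.
have /matrixP JD := mulmx1C DJ.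
under [RHS]eq_bigr do rewrite jacobian_derE mulr_sumr.
rewrite exchange_big /=; transitivity (\sum_k (l == k)%:R * f^`M(k)).
  rewrite (bigD1 l) //= eqxx mul1r big1 ?addr0 // => k /negPf.
  by rewrite eq_sym => ->; rewrite mul0r.
apply: eq_bigr => k _; under [RHS]eq_bigr do rewrite mulrA; rewrite -mulr_suml.
congr (_ * _); have := JD l k; rewrite !mxE => <-.
by apply: eq_bigr => i _; rewrite !mxE.
Qed.

(** Otherwise [p] would divide all its partial derivatives, one of which is nonzero and of smaller
    degree. *)
Lemma prime_der_ndivides p : prime_elt p -> exists j, ~ divides p (der j p).
Proof.
move=> [p0 pn _]; apply: contrapT => /forallNP H.
have p1 : (1 < msize p)%N.
  by rewrite ltn_neqAle eq_sym -mpoly_unitP pn lt0n mmeasure_poly_eq0.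
have [l lp] := mderiv_neq0 charK p1.
have : divides p p^`M(l).
  rewrite mderiv_jacobian_der; apply: divides_sum => i _; apply: divides_mull.
  exact: contrapT (H i).
case=> c Ec; have c0 : c != 0 by apply: contraNneq lp => c0; rewrite Ec c0 mulr0.
have := msize_mderiv l p; rewrite Ec msizeM //.
have : (0 < msize c)%N by rewrite lt0n mmeasure_poly_eq0.
by move: (msize p) (msize c) p1 => a b; lia.
Qed.

Section PrimeAndVariable.
Variables (p : B) (j : 'I_n.+1).
Hypothesis prime_p : prime_elt p.
Hypothesis der_p : ~ divides p (der j p).
Local Notation T := [tuple ('X_(lift j k) : B) | k < n].

(* The derivation [der j p * der i - der i p * der j] preserves the ideal (p)
   and acts on the constants [c] as [der j p] times a partial derivative. *)
Lemma constant_ndivides (c : C) : c != 0 -> ~ divides p (sigma (c \mPo T)).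
Proof.
move: {2}(msize c) (leqnn (msize c)) => k; elim: k c => [|k IH] c ck c0.
  by rewrite leqn0 mmeasure_poly_eq0 (negPf c0) in ck.
have [c1|/(mderiv_neq0 charK)[i ci]] := leqP (msize c) 1.
  apply: prime_nunit_divides => //; rewrite mpoly_unitP.
  move: c0; rewrite (msize1_polyC c1) mpolyC_eq0; set a := _@__ => a0.
  by rewrite comp_mpolyC lrmorph_mpolyC mmeasureC a0.
move=> [h Eh]; apply: (IH _ _ ci).
  by apply: leq_trans (msize_mderiv _ _) _; rewrite -ltnS; case: (msize c) ck.
have [_ _ pP] := prime_p.
pose E f := der j p * der (lift j i) f - der (lift j i) p * der j f.
have : divides p (E (sigma (c \mPo T))).
  rewrite Eh /E !jacobian_derM.
  exists (der j p * der (lift j i) h - der (lift j i) p * der j h).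
  move: (der j p) (der (lift j i) p) (der j h) (der (lift j i) h) => a b x y.
  by clear; ring.
rewrite /E (jacobian_der_endo sJ) mderiv_comp_lift (jacobian_der_endo sJ) mderiv_comp_lift0.
by rewrite (rmorph0 sigma) mulr0 subr0 => /pP[].
Qed.

(* [W] has least degree among the nonzero polynomials whose image is divisible
   by [p]; constants are excluded by [constant_ndivides]. *)
Lemma common_factor (V U : {poly C}) : V != 0 ->
  divides p (sigma (mpoly_of_poly j V)) -> divides p (sigma (mpoly_of_poly j U)) ->
  exists (c : C) (W V1 U1 : {poly C}),
    [/\ c != 0, (1 < size W)%N, c *: V = W * V1 & c *: U = W * U1].
Proof.
move=> V0 pV pU; have [_ _ pP] := prime_p.
pose Q (q : {poly C}) := divides p (sigma (mpoly_of_poly j q)).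
have exQ : exists k, `[< exists q, [/\ q != 0, Q q & size q = k] >].
  by exists (size V); apply/asboolP; exists V.
case: (ex_minnP exQ) => k /asboolP[W [W0 QW sW]] Wmin.
have W1 : (1 < size W)%N.
  rewrite ltnNge; apply/negP => W1; move: W0 QW; rewrite (size1_polyC W1) polyC_eq0.
  by rewrite /Q mpoly_of_polyC => /constant_ndivides.
have redQ q : Q q -> exists2 c : C, c != 0 & exists q1, c *: q = W * q1.
  move=> Qq; have := Pdiv.WeakIdomain.divp_eq q W; set c := _ ^+ _; set r := _ %% _ => Eq.
  have c0 : c != 0 by rewrite expf_neq0 // lead_coef_eq0.
  exists c => //; exists (q %/ W); rewrite Eq mulrC [RHS]mulrC mulrC.
  have [->|r0] := eqVneq r 0; first by rewrite addr0.
  suff /Wmin : `[< exists q, [/\ q != 0, Q q & size q = size r] >].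
    by rewrite leqNgt -sW ltn_modpN0.
  apply/asboolP; exists r; split=> //.
  have -> : r = c%:P * q + (- (q %/ W)) * W by rewrite mul_polyC Eq mulNr addrC addKr.
  rewrite /Q mpoly_of_polyD 2!mpoly_of_polyM rmorphD !rmorphM /=.
  by apply: dividesD; apply: divides_mull.
have [[a a0 [V1 EV]] [b b0 [U1 EU]]] := (redQ V pV, redQ U pU).
exists (a * b), W, (b *: V1), (a *: U1); split=> //; first by rewrite mulf_neq0.
  by rewrite -scalerAr -EV scalerA mulrC.
by rewrite -scalerAr -EU scalerA.
Qed.
End PrimeAndVariable.

(** The denominators [I] of [x] form an ideal, and by unique factorization an element [v] of least
    degree divides all of them. If [v] were not constant, a prime [p] dividing [sigma v] would
    divide [sigma u] too, and [common_factor] would allow a factor [W] to be cancelled from [u / v],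
    up to elements free of the variable [j]. The new denominator has smaller degree in that
    variable, yet is divisible by [v]. *)
Lemma rational_in_image x v u : v != 0 -> sigma v * x = sigma u -> exists w, x = sigma w.
Proof.
move=> v0 Ex; pose I v := exists u, sigma v * x = sigma u.
have sinj := jacobian_map_inj charK sJ.
have exI : exists k, `[< exists v, [/\ v != 0, I v & msize v = k] >].
  by exists (msize v); apply/asboolP; exists v; split=> //; exists u.
move: v u v0 Ex exI => _ _ _ _ exI.
case: (ex_minnP exI) => k /asboolP[v [v0 [u Eu] sv]] vmin.
have s0 a : a != 0 -> sigma a != 0 by apply: contraNneq => E; apply/eqP/sinj; rewrite E rmorph0.
have [v1|nv1] := boolP (v \is a GRing.unit).
  exists (v^-1 * u); rewrite rmorphM /= -Eu mulrA -rmorphM mulVr //=.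
  by rewrite rmorph1 mul1r.
have primitive_uv q : prime_elt q -> divides q v -> ~ divides q u.
  move=> [q0 qn _] [v' Ev] [u' Eu'].
  have v'0 : v' != 0 by apply: contraNneq v0 => E; rewrite Ev E mulr0.
  have Iv' : I v'.
    exists u'; apply: (mulfI (s0 _ q0)).
    by rewrite mulrA -!rmorphM /= -Ev -Eu'.
  have /vmin : `[< exists w, [/\ w != 0, I w & msize w = msize v'] >].
    by apply/asboolP; exists v'.
  rewrite -sv Ev msizeM //; apply/negP; rewrite -ltnNge.
  move: qn; rewrite mpoly_unitP; have : (0 < msize q)%N by rewrite lt0n mmeasure_poly_eq0.
  have : (0 < msize v')%N by rewrite lt0n mmeasure_poly_eq0.
  by move: (msize q) (msize v') => a b; lia.
(* No prime factor of [v] divides [u], by minimality, so in [v * z = w * u] all of them go into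
   [w]. *)
have Iv w : I w -> divides v w.
  move=> [z Ez]; have : v * z = w * u.
    by apply: sinj; rewrite !rmorphM /= -Ez -Eu mulrCA mulrA.
  have [a [s [ua ps Ev]]] := @factorial_mpoly _ K v v0.
  have us q : q \in s -> ~ divides q u.
    move=> qs; apply: primitive_uv; first exact: ps.
    by rewrite Ev (big_rem _ qs) /= mulrCA; eexists.
  rewrite {}Ev {v v0 nv1 primitive_uv Eu sv vmin Ez}; elim: s w z ps us => [|q s IH] w z ps us E.
    by exists (a^-1 * w); rewrite big_nil mulr1 mulrA mulrV // mul1r.
  have pq : prime_elt q by apply: ps; rewrite mem_head.
  have [q0 _ qP] := pq.
  have qw : divides q (w * u) by rewrite -E big_cons mulrCA -mulrA; eexists.
  case/qP: qw => [[w' Ew]|/us]; last by rewrite mem_head => /(_ isT).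
  have [|||e Ee] := IH w' z.
  - by move=> r rs; apply: ps; rewrite in_cons rs orbT.
  - by move=> r rs; apply: us; rewrite in_cons rs orbT.
  - apply: (mulfI q0); rewrite [RHS]mulrA -Ew -E big_cons.
    by move: (\prod_(_ <- _) _) => y; ring.
  by exists e; rewrite Ew Ee big_cons; move: (\prod_(_ <- _) _) => y; ring.
have nsv : sigma v \isn't a GRing.unit.
  apply: contraNN nv1; rewrite mpoly_unitP => /msize_poly1P[c c0].
  rewrite -(lrmorph_mpolyC sigma) => /sinj ->; rewrite mpoly_unitP.
  by apply/msize_poly1P; exists c.
have [p pp pv] := factorial_prime_divisor (@factorial_mpoly _ K) (s0 _ v0) nsv.
have [j pj] := prime_der_ndivides pp.
pose V := poly_of_mpoly j v; pose U := poly_of_mpoly j u.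
have V0 : V != 0.
  by apply: contraNneq v0 => E; rewrite -(poly_of_mpolyK j v) -/V E rmorph0.
have pu : divides p (sigma u) by rewrite -Eu; apply: divides_mulr.
have [||c [W [V1 [U1 [c0 W1 EV EU]]]]] := common_factor pp pj (V := V) (U := U) V0;
  rewrite ?poly_of_mpolyK //.
have V10 : V1 != 0.
  by apply: contraNneq V0 => E; move: EV; rewrite E mulr0 => /eqP;
    rewrite -mul_polyC mulf_eq0 polyC_eq0 (negPf c0).
have W0 : W != 0 by rewrite -size_poly_gt0 ltnW.
have : I (mpoly_of_poly j V1).
  exists (mpoly_of_poly j U1).
  have cWV : mpoly_of_poly j c%:P * v = mpoly_of_poly j W * mpoly_of_poly j V1.
    by rewrite -{1}(poly_of_mpolyK j v) -!mpoly_of_polyM mul_polyC EV.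
  have cWU : mpoly_of_poly j c%:P * u = mpoly_of_poly j W * mpoly_of_poly j U1.
    by rewrite -{1}(poly_of_mpolyK j u) -!mpoly_of_polyM mul_polyC EU.
  have W0' : mpoly_of_poly j W != 0.
    by apply: contraNneq W0 => E; rewrite -(mpoly_of_polyK j W) E rmorph0.
  apply: (mulfI (s0 _ W0')).
  have sM a b : sigma (a * b) = sigma a * sigma b by exact: rmorphM.
  by rewrite mulrA -!sM -cWV -cWU !sM -mulrA Eu.
move=> /Iv[e Ee].
have EV1 : V1 = V * poly_of_mpoly j e.
  by have := mpoly_of_polyK j V1; rewrite Ee poly_of_mpolyM => <-.
clearbody V U; have e0 : poly_of_mpoly j e != 0.
  by apply: contraNneq V10 => E; rewrite EV1 E mulr0.
(* With [c *: V = W * V * e] and [c] constant in the variable [j], comparing degrees contradicts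
   [1 < size W]. *)
have := congr1 (fun q : {poly C} => size q) EV; rewrite /= size_scale // EV1.
rewrite mulrCA size_mul ?mulf_neq0 // size_mul //.
have : (0 < size (poly_of_mpoly j e))%N by rewrite size_poly_gt0.
have : (0 < size V)%N by rewrite size_poly_gt0.
by move: (size V) (size W) (size (poly_of_mpoly j e)) W1 => x1 x2 x3; lia.
Qed.
End Birational.

(** * Quadratic Jacobian maps are birational *)

Section FractionMap.
Variables (R S : idomainType) (f : {rmorphism R -> S}).
Hypothesis f_inj : injective f.
Local Notation "x %:F" := (FracField.tofrac x).

Lemma fraction_rep (T : idomainType) (x : {fraction T}) :
  exists ab : T * T, ab.2 != 0 /\ x = ab.1%:F / ab.2%:F.
Proof.
elim/quotW: x => x; exists (\n_x, \d_x); split; first exact: denom_ratioP.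
unlock FracField.tofrac; rewrite /= -[_^-1]FracField.pi_inv -[RHS]FracField.pi_mul.
rewrite /FracField.mulf /FracField.invf !numden_Ratio ?oner_eq0 ?denom_ratioP //.
by rewrite mulr1 mul1r Ratio_numden.
Qed.

Definition fraction_map of injective f := fun x : {fraction R} =>
  let ab := sval (cid (fraction_rep x)) in (f ab.1)%:F / (f ab.2)%:F : {fraction S}.
Local Notation fmap := (fraction_map f_inj).

Let f_neq0 a : a != 0 -> (f a)%:F != 0.
Proof.
move=> a0; rewrite tofrac_eq0; apply: contraNneq a0 => fa.
by apply/eqP/f_inj; rewrite fa rmorph0.
Qed.

Lemma fraction_mapE a b : b != 0 ->
  fmap (a%:F / b%:F) = (f a)%:F / (f b)%:F.
Proof.
move=> b0; rewrite /fraction_map; case: cid => -[c d] /= [d0 /eqP].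
have t0 x : x != 0 -> x%:F != 0 :> {fraction R} by rewrite tofrac_eq0.
rewrite eqr_div ?t0 // -!tofracM tofrac_eq => /eqP E.
apply/eqP; rewrite eqr_div ?f_neq0 // -!tofracM -!rmorphM /= tofrac_eq -E.
by [].
Qed.

Lemma fraction_map_tofrac a : fmap a%:F = (f a)%:F.
Proof.
by have := fraction_mapE a (oner_neq0 R); rewrite !rmorph1 !divr1.
Qed.

Lemma fraction_map_is_zmod : zmod_morphism fmap.
Proof.
move=> x y; have [[a b] /= [b0 ->]] := fraction_rep x.
have [[c d] /= [d0 ->]] := fraction_rep y.
have t0 z : z != 0 -> z%:F != 0 :> {fraction R} by rewrite tofrac_eq0.
rewrite -mulNr addf_div ?t0 // -tofracN -!tofracM -tofracD !fraction_mapE ?mulf_neq0 //.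
by rewrite -[in RHS]mulNr addf_div ?f_neq0 // !(rmorphD, rmorphM, rmorphN).
Qed.

Lemma fraction_map_is_monoid : monoid_morphism fmap.
Proof.
split=> [|x y]; first by rewrite -[1]/(1%:F) fraction_map_tofrac rmorph1.
have [[a b] /= [b0 ->]] := fraction_rep x; have [[c d] /= [d0 ->]] := fraction_rep y.
rewrite mulf_div -!tofracM !fraction_mapE ?mulf_neq0 // mulf_div.
by rewrite -!tofracM !rmorphM.
Qed.

HB.instance Definition _ :=
  GRing.isZmodMorphism.Build {fraction R} {fraction S} fmap fraction_map_is_zmod.
HB.instance Definition _ :=
  GRing.isMonoidMorphism.Build {fraction R} {fraction S} fmap fraction_map_is_monoid.
End FractionMap.

(** Comparing coefficients gives a linear system over [k], and its solvability is a rank condition,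
    insensitive to field extension. *)
Lemma descent_combination (k E : fieldType) (f : {rmorphism k -> E}) n (I : finType)
    (r : I -> {mpoly k[n]}) (b : {mpoly k[n]}) (c : I -> E) :
  map_mpoly f b = \sum_i c i *: map_mpoly f (r i) ->
  exists c' : I -> k, b = \sum_i c' i *: r i.
Proof.
move=> Eb; pose N := maxn (msize b) (\max_i msize (r i)).
pose J := 'X_{1..n < N}.
pose W : 'M[k]_(#|I|, #|{: J}|) := \matrix_(i, j) (r (enum_val i))@_(val (enum_val j)).
pose v : 'rV[k]_#|{: J}| := \row_j b@_(val (enum_val j)).
have : (map_mx f v <= map_mx f W)%MS.
  apply/submxP; exists (\row_i c (enum_val i)); apply/rowP => j; rewrite !mxE.
  have := congr1 (mcoeff (val (enum_val j))) Eb.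
  rewrite mcoeff_map_mpoly raddf_sum /= => ->.
  rewrite (reindex (@enum_val I predT)); last exact: onW_bij (enum_val_bij I).
  by apply: eq_bigr => i _; rewrite !mxE mcoeffZ mcoeff_map_mpoly.
rewrite map_submx => /submxP[u /rowP uW]; exists (fun i => u 0 (enum_rank i)).
apply/mpolyP => m; rewrite raddf_sum /=.
have [mN|Nm] := ltnP (mdeg m) N.
  have := uW (enum_rank (BMultinom mN : J)); rewrite !mxE enum_rankK /= => ->.
  rewrite [RHS](reindex (@enum_val I predT)); last exact: onW_bij (enum_val_bij I).
  by apply: eq_bigr => i _; rewrite !mxE mcoeffZ enum_valK enum_rankK.
rewrite (memN_msupp_eq0 (msize_mdeg_ge (leq_trans (leq_maxl _ _) Nm))).
rewrite big1 // => i _; rewrite mcoeffZ memN_msupp_eq0 ?mulr0 //.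
apply: msize_mdeg_ge; apply: leq_trans Nm; apply: leq_trans (leq_maxr _ _).
exact: (leq_bigmax (F := fun i => msize (r i))).
Qed.

(** The midpoint rule is exact for the integral of the derivative of a quadratic polynomial along a
    segment. On a product of two variables it reads [Y_a Y_b - X_a X_b = M_b (Y_a - X_a) + M_a (Y_b
    - X_b)], with [M] the midpoint. *)
Lemma quadratic_midpoint n (K : fieldType) (S : comNzRingType) (e : {rmorphism K -> S})
    (X Y : 'I_n -> S) (g : {mpoly K[n]}) : 2%:R != 0 :> K -> (msize g <= 3)%N ->
  mmap e Y g - mmap e X g =
  \sum_j mmap e (fun i => e (2%:R^-1) * (X i + Y i)) g^`M(j) * (Y j - X j).
Proof.
move=> two0 g3; pose M i := e (2%:R^-1) * (X i + Y i); rewrite -/M [g]mpolyE.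
pose T p := mmap e Y p - mmap e X p = \sum_j mmap e M p^`M(j) * (Y j - X j).
have ev0 Z : mmap e Z (0 : {mpoly K[n]}) = 0 by exact: raddf0.
have ev1 Z : mmap e Z (1 : {mpoly K[n]}) = 1 by exact: rmorph1.
have evD Z (p q : {mpoly K[n]}) : mmap e Z (p + q) = mmap e Z p + mmap e Z q.
  exact: raddfD.
have evM Z (p q : {mpoly K[n]}) : mmap e Z (p * q) = mmap e Z p * mmap e Z q.
  exact: rmorphM.
have T0 : T 0.
  by rewrite /T !ev0 subrr big1 // => j _; rewrite mderiv0 ev0 mul0r.
have TD p q : T p -> T q -> T (p + q).
  rewrite /T => Tp Tq; rewrite !evD opprD addrACA Tp Tq -big_split /=.
  by apply: eq_bigr => j _; rewrite mderivD evD mulrDl.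
have TZ c p : T p -> T (c *: p).
  rewrite /T => Tp; rewrite !mmapZ -mulrBr Tp mulr_sumr.
  by apply: eq_bigr => j _; rewrite mderivZ mmapZ mulrA.
rewrite -/(T (\sum_(m <- msupp g) g@_m *: 'X_[m])) big_seq.
elim/big_ind: _ => // m /msize_mdeg_lt gm; apply: TZ.
have {g3 gm} : (mdeg m < 3)%N by apply: leq_trans g3.
have dU a j : mmap e M ('X_a)^`M(j) = (a == j)%:R.
  by rewrite mderiv_var; case: eqP => _; rewrite ?ev1 ?ev0.
have pick (Z : 'I_n -> S) a : \sum_j (a == j)%:R * Z j = Z a.
  rewrite (bigD1 a) //= eqxx mul1r big1 ?addr0 // => j /negPf.
  by rewrite eq_sym => ->; rewrite mul0r.
have sub1 a : (0 < m a)%N -> exists m', m = (U_(a) + m')%MM.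
  by move=> ma; exists (m - U_(a))%MM; rewrite addmC submK // lep1mP -lt0n.
have [m0 _|] := eqVneq (mdeg m) 0%N.
  move/eqP: m0; rewrite mdeg_eq0 => /eqP ->; rewrite /T mpolyX0 !ev1 subrr.
  by rewrite big1 // => j _; rewrite -mpolyC1 mderivC ev0 mul0r.
rewrite mdegE sum_nat_eq0 negb_forall => /existsP[a] /=; rewrite -lt0n => /sub1[m' ->].
rewrite -mdegE mdegD mdeg1 add1n ltnS ltnS leq_eqVlt ltnS leqn0 => /orP[/mdeg1P[b /eqP ->]|].
  rewrite /T mpolyXD !evM !mmapX !mmap1U.
  under eq_bigr do rewrite mderivM evD !evM !dU !mmapX !mmap1U mulrDl -!mulrA.
  rewrite big_split /= pick.
  rewrite (eq_bigr (fun i => (b == i)%:R * (M a * (Y i - X i)))) => [|i _]; last first.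
    by rewrite /M !mulrA; congr (_ * _); rewrite mulrC !mulrA.
  rewrite pick /M.
  have e2 : e (2%:R^-1) * 2%:R = 1 by rewrite -(rmorph_nat e) -rmorphM mulVf ?rmorph1.
  rewrite -[LHS]mul1r -e2; move: (e _) => h; ring.
rewrite mdeg_eq0 => /eqP ->; rewrite /T addm0 !mmapX !mmap1U.
by under eq_bigr do rewrite dU; rewrite pick.
Qed.

Section Quadratic.
Variables (n : nat) (K : fieldType).
Hypothesis charK : [pchar K] =i pred0.
Local Notation B := {mpoly K[n]}.
Variable sigma : {lrmorphism B -> B}.
Hypothesis sJ : jacobian_map sigma.
Hypothesis deg2 : forall i, (msize (sigma 'X_i) <= 3)%N.
Local Notation "x %:F" := (FracField.tofrac x).

(* As [sigma] is quadratic, F(Y) - F(X) = J((X + Y) / 2) (Y - X), and the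
   matrix J((X + Y) / 2) is invertible. *)
Lemma quadratic_injectivity (S : comUnitRingType) (e : {rmorphism K -> S})
    (X Y : 'I_n -> S) : exists H : 'I_n -> 'I_n -> S,
  forall i, Y i - X i =
    \sum_j H i j * (mmap e Y (sigma 'X_j) - mmap e X (sigma 'X_j)).
Proof.
have two0 : 2%:R != 0 :> K by have /pcharf0P -> := charK.
pose M i := e (2%:R^-1) * (X i + Y i).
pose ev : {rmorphism B -> S} := mmap e M.
pose JM := map_mx ev (endo_jacobian_mx sigma).
have JM_unit : JM \in unitmx.
  have [c c0 Ec] := sJ; rewrite unitmxE det_map_mx Ec.
  have -> : ev c%:MP = e c by exact: mmapC.
  by apply: rmorph_unit; rewrite unitfE.
exists (fun i j => invmx JM i j) => i.
pose z : 'cV_n := \col_j (Y j - X j).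
have -> : Y i - X i = (invmx JM *m (JM *m z)) i 0 by rewrite mulKmx // mxE.
rewrite mxE; apply: eq_bigr => j _; congr (_ * _).
rewrite (quadratic_midpoint e X Y two0 (deg2 j)) mxE.
by apply: eq_bigr => l _; rewrite !mxE.
Qed.

Local Notation E := {fraction B}.
Local Notation phi := (fraction_map (jacobian_map_inj charK sJ)).

Definition frac_const : {rmorphism K -> E} := @FracField.tofrac B \o @mpolyC n K.

Lemma mmap_tofrac p :
  mmap (@mpolyC n E \o frac_const) (fun i => (('X_i)%:F)%:MP) p = (p%:F)%:MP :> {mpoly E[n]}.
Proof.
elim/mpoly_gen_ind: p => [p q IHp IHq|c p IHp|p q IHp IHq||i].
- by rewrite tofracD mpolyCD -IHp -IHq; apply: raddfD.
- by rewrite mmapZ IHp -mul_mpolyC tofracM mpolyCM.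
- by rewrite tofracM mpolyCM -IHp -IHq; apply: rmorphM.
- by rewrite tofrac1 mpolyC1; apply: rmorph1.
by rewrite mmapX mmap1U.
Qed.

Lemma mmap_var p :
  mmap (@mpolyC n E \o frac_const) (fun i => 'X_i) p = map_mpoly frac_const p.
Proof. by []. Qed.

(* As coefficients, [E] stands for the field K(F_1, ..., F_n) here, and [phi]
   for its inclusion in K(x_1, ..., x_n). *)
Definition generic_fibre j : {mpoly E[n]} :=
  map_mpoly frac_const (sigma 'X_j) - (('X_j)%:F)%:MP.

Lemma map_generic_fibre j : map_mpoly phi (generic_fibre j) =
  map_mpoly frac_const (sigma 'X_j) - ((sigma 'X_j)%:F)%:MP.
Proof.
rewrite /generic_fibre raddfB /=; apply: (congr2 (fun a b => a - b)); last first.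
  apply: etrans (map_mpolyC _ _ _) _.
  exact: (congr1 (@mpolyC n E) (fraction_map_tofrac _ _)).
apply/mpolyP => m; apply: etrans (mcoeff_map_mpoly _ _ _) _.
apply: etrans (congr1 phi (mcoeff_map_mpoly _ _ _)) _.
apply: etrans _ (esym (mcoeff_map_mpoly _ _ _)).
apply: etrans (fraction_map_tofrac _ _) _.
exact: (congr1 (@FracField.tofrac B) (lrmorph_mpolyC sigma _)).
Qed.

(** Evaluation at the tautological point [(x_1, ..., x_n)], which lies on the generic fibre after
    scalars are extended by [phi]. *)
Definition fibre_eval (q : {mpoly E[n]}) : E :=
  (map_mpoly phi q).@[fun l => ('X_l)%:F].

Lemma fibre_eval_is_zmod : zmod_morphism fibre_eval.
Proof. by move=> p q; rewrite /fibre_eval !raddfB. Qed.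
HB.instance Definition _ :=
  GRing.isZmodMorphism.Build {mpoly E[n]} E fibre_eval fibre_eval_is_zmod.

Lemma fibre_evalM p q : fibre_eval (p * q) = fibre_eval p * fibre_eval q.
Proof. by rewrite /fibre_eval !rmorphM. Qed.

Lemma fibre_evalZ c p : fibre_eval (c *: p) = phi c * fibre_eval p.
Proof. by rewrite /fibre_eval map_mpolyZ mevalZ. Qed.

Lemma meval_tofrac p : (map_mpoly frac_const p).@[fun l => ('X_l)%:F] = p%:F.
Proof.
elim/mpoly_gen_ind: p => [p q IHp IHq|c p IHp|p q IHp IHq||i].
- by rewrite tofracD -IHp -IHq raddfD /= mevalD.
- by rewrite map_mpolyZ mevalZ IHp -mul_mpolyC tofracM.
- by rewrite tofracM -IHp -IHq rmorphM /= mevalM.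
- by rewrite tofrac1 rmorph1 meval1.
by rewrite map_mpolyX mevalXU.
Qed.

Lemma fibre_eval_generic j : fibre_eval (generic_fibre j) = 0.
Proof.
rewrite /fibre_eval map_generic_fibre mevalB mevalC meval_tofrac.
exact: subrr.
Qed.

(** [quadratic_injectivity] writes ['X_i] as a constant of K(x) plus an element of the ideal of the
    generic fibre. That ideal is defined over K(F), so the constant may be taken in K(F) by descent,
    and evaluation at the tautological point identifies it with [x_i]. *)
Lemma quadratic_rational i : exists v u, v != 0 /\ sigma v * 'X_i = sigma u.
Proof.
have [H EH] : exists H : 'I_n -> {mpoly E[n]},
    'X_i - (('X_i)%:F)%:MP = \sum_j H j * map_mpoly phi (generic_fibre j).
  have [H EH] := @quadratic_injectivity {mpoly E[n]} (@mpolyC n E \o frac_const)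
    (fun i => (('X_i)%:F)%:MP) (fun i => 'X_i).
  exists (H i); rewrite (EH i); apply: eq_bigr => j _.
  apply: (congr1 (fun z => H i j * z)); apply/esym; apply: etrans (map_generic_fibre j) _.
  apply: (congr2 (fun a b => a - b)); first exact/esym/mmap_var.
  exact/esym/mmap_tofrac.
pose N := \max_j msize (H j).
(* Expanding each [H j] into monomials turns the ideal membership into a finite linear combination;
   the left summand indexes the constant 1. *)
pose I := ('I_1 + 'I_n * 'X_{1..n < N})%type.
pose r (a : I) : {mpoly E[n]} := if a is inr jm then 'X_[jm.2] * generic_fibre jm.1 else 1.
pose c (a : I) : E := if a is inr jm then (H jm.1)@_(jm.2) else ('X_i)%:F.
have : map_mpoly phi ('X_i : {mpoly E[n]}) = \sum_a c a *: map_mpoly phi (r a).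
  have -> : map_mpoly phi ('X_i : {mpoly E[n]}) = 'X_i by exact: map_mpolyX.
  rewrite big_sumType big_ord1 /= -[LHS](subrK (('X_i)%:F)%:MP) addrC EH.
  congr (_ + _); last first.
    apply: etrans (esym (alg_mpolyC _ _)) _; congr (_ *: _).
    exact/esym/rmorph1.
  rewrite -(pair_bigA _ (fun j m =>
    (H j)@_(val m) *: map_mpoly phi ('X_[val m] * generic_fibre j))) /=.
  apply: eq_bigr => j _.
  have HN : (msize (H j) <= N)%N by exact: (leq_bigmax (F := fun j => msize (H j))).
  rewrite {1}(mpolywE HN) mulr_suml; apply: eq_bigr => m _.
  rewrite -scalerAl; congr (_ *: _); rewrite rmorphM /=; congr (_ * _).
  exact/esym/map_mpolyX.
case/descent_combination=> c' /(congr1 fibre_eval).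
rewrite raddf_sum big_sumType big_ord1 /= [X in _ + X]big1 ?addr0; last first.
  by move=> a _; rewrite fibre_evalZ fibre_evalM fibre_eval_generic !mulr0.
rewrite fibre_evalZ {1 2}/fibre_eval rmorph1 meval1 mulr1 map_mpolyX mevalXU.
have [[u v] /= [v0 ->]] := fraction_rep (c' (inl ord0)).
rewrite (fraction_mapE _ _ v0) => E1.
have sv0 : (sigma v)%:F != 0 :> E.
  rewrite tofrac_eq0; apply: contraNneq v0 => E0.
  by apply/eqP/(jacobian_map_inj charK sJ); rewrite E0 rmorph0.
exists v, u; split=> //; apply/eqP; rewrite -tofrac_eq tofracM mulrC.
by rewrite E1 divfK.
Qed.
End Quadratic.

(** * The theorem *)

Lemma quadratic_surjective (n : nat) (K : fieldType)
    (sigma : {lrmorphism {mpoly K[n]} -> {mpoly K[n]}}) :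
  [pchar K] =i pred0 -> jacobian_map sigma -> (0 < n)%N -> (endo_degree sigma <= 2)%N ->
  forall p, exists q, p = sigma q.
Proof.
case: n sigma => // n sigma charK sJ _ d2.
have deg2 i : (msize (sigma 'X_i) <= 3)%N.
  exact: leq_trans (msize_endo sigma i) _.
elim/mpoly_gen_ind=> [p q [p' ->] [q' ->]|c p [p' ->]|p q [p' ->] [q' ->]||i].
- by exists (p' + q'); rewrite rmorphD.
- by exists (c *: p'); rewrite linearZ.
- by exists (p' * q'); rewrite rmorphM.
- by exists 1; rewrite rmorph1.
have [v [u [v0 E]]] := quadratic_rational charK sJ deg2 i.
exact: (rational_in_image charK sJ v0 E).
Qed.

(** * Simplicity in the surjective case *)

Section SurjectiveSimple.
Variables (n : nat) (K : fieldType).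
Hypothesis charK : [pchar K] =i pred0.
Local Notation P := {mpoly K[n]}.
Variable sigma : {lrmorphism P -> P}.
Hypothesis sJ : jacobian_map sigma.
Hypothesis sigma_surj : forall p, exists q, p = sigma q.
Local Notation M := (twisted (weyl_ext sJ) (polymod n K) : lmodType (weyl n K)).

(** A surjective [sigma] identifies the untwisted module with the twisted one. There,
    differentiation takes any nonzero polynomial to a nonzero constant, and multiplication by
    polynomials then gives everything. *)
Lemma surjective_twisted_simple (N : {pred M}) (v : M) :
  GRing.submod_closed N -> v \in N -> v != 0 -> forall w, w \in N.
Proof.
move=> subN vN v0.
have N1 : (1 : P) \in N.
  have [f Ef] := sigma_surj v; rewrite {v}Ef in vN v0.
  move: {2}(msize f) (leqnn (msize f)) => k; elim: k f vN v0 => [|k IH] f fN f0 fk.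
    move: f0; rewrite leqn0 mmeasure_poly_eq0 in fk.
    by rewrite (eqP fk) rmorph0 eqxx.
  have [f1|/(mderiv_neq0 charK)[i fi]] := leqP (msize f) 1.
    move: fN f0; rewrite (msize1_polyC f1) lrmorph_mpolyC; set c := _@__ => cN.
    rewrite mpolyC_eq0 => c0; apply: (submodZK subN c0).
    by rewrite twisted_alg alg_mpolyC.
  apply: (IH f^`M(i)).
  - by rewrite -(jacobian_der_endo sJ) -(twisted_d i (sigma f : M)); apply: (submodZ subN).
  - by apply: contraNneq fi => E; apply/eqP/(jacobian_map_inj charK sJ); rewrite E rmorph0.
  by apply: leq_trans (msize_mderiv _ _) _; rewrite -ltnS; case: (msize f) fk.
move=> w; have [g ->] := sigma_surj w.
suff H g' (u : M) : u \in N -> (sigma g' * (u : P) : M) \in N.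
  by have := H g _ N1; rewrite mulr1.
elim/mpoly_gen_ind: g' u => [p q IHp IHq|c p IHp|p q IHp IHq||i] u uN.
- by rewrite rmorphD mulrDl; apply: (submodD subN); [apply: IHp|apply: IHq].
- rewrite linearZ /= -scalerAl -(twisted_alg c (sigma p * (u : P) : M)).
  exact: (submodZ subN _ (IHp u uN)).
- by rewrite rmorphM /= -mulrA; apply/IHp/IHq.
- by rewrite rmorph1 mul1r.
by rewrite -(twisted_x i u); apply: (submodZ subN).
Qed.

Lemma surjective_twisted_length l : has_length M l -> (l <= 1)%N.
Proof.
move=> [S [Ssub S0 Sl Sincr Sprop _]]; rewrite leqNgt; apply/negP => l1.
apply: (Sprop _ l1) => w _; apply: contrapT => wS.
apply: (Sprop _ (ltnW l1)) => v vS; rewrite S0 inE; apply/negPn/negP => v0.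
exact/wS/(surjective_twisted_simple (Ssub _ (ltnW l1)) vS v0).
Qed.
End SurjectiveSimple.

(** The passage from the natural growth bound [(n - 1) * (d - 1)] to the power in the statement; it
    fails for [k = 1] and [N > 1], that is, for [d = 2] and [n > 2]. *)
Lemma mul_le_exp k N : (1 < k)%N -> (N * k <= k ^ N)%N.
Proof.
move=> k1; elim: N => // -[|N] IH; first by rewrite mul1n expn1.
rewrite [(k ^ _.+2)%N]expnS; apply: leq_trans (leq_mul (leqnn k) IH).
by rewrite mulnA leq_mul2r; apply/orP; right; nia.
Qed.

Section MainTheorem.
Variables (n : nat) (K : fieldType).
Hypothesis charK : [pchar K] =i pred0.
Hypothesis n_gt0 : (0 < n)%N.
Variable sigma : {lrmorphism {mpoly K[n]} -> {mpoly K[n]}}.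
Hypothesis sJ : jacobian_map sigma.
Local Notation M := (twisted (weyl_ext sJ) (polymod n K) : lmodType (weyl n K)).
Local Notation d := (endo_degree sigma).

Lemma twisted_chain_length m l (S : nat -> {pred M}) :
  (d <= m)%N -> ((n - 1) * (d - 1) <= m.+1)%N ->
  submodule_chain l S -> (l <= m ^ n)%N.
Proof.
move=> dm dm' [Ssub Sincr Sprop].
exact: (chain_length charK n_gt0 (@twisted_poly_linear n K sigma sJ)
  (@twisted_poly_inj n K sigma sJ) (twisted_growth (sJ := sJ) dm dm') Ssub Sincr Sprop).
Qed.

(** Finite length and cyclicity need only some growth constant, and this one satisfies both degree
    conditions for every [d]. *)
Let m0 := (d + (n - 1) * (d - 1))%N.
Let dm0 : (d <= m0)%N := leq_addr _ _.
Let dm0' : ((n - 1) * (d - 1) <= m0.+1)%N := leqW (leq_addl _ _).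

Lemma twisted_finite_length : finite_length M.
Proof.
by apply: (@bounded_chains_finite_length _ _ (m0 ^ n)) => l S; apply: twisted_chain_length.
Qed.

Lemma twisted_cyclic : cyclic_module M.
Proof.
apply: (finite_length_cyclic charK) twisted_finite_length => u.
exact: (annihilator_neq0 charK n_gt0 (@twisted_poly_linear n K sigma sJ)
  (@twisted_poly_inj n K sigma sJ) (twisted_growth (sJ := sJ) dm0 dm0')).
Qed.

Lemma twisted_holonomic (R : realType) : holonomic R M.
Proof.
split; last by apply: le_anti; rewrite twisted_gk_dim_le // twisted_gk_dim_ge.
have [u uP] := twisted_cyclic; exists [:: u] => v; have [a ->] := uP v.
by exists (fun=> a); rewrite big_ord1.
Qed.

Lemma twisted_length l : has_length M l ->
  (l <= (maxn d ((d - 1) ^ (n - 1) - 1)) ^ n)%N.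
Proof.
set m := maxn _ _ => lM; have d_gt0 := endo_degree_gt0 sJ n_gt0.
have dm : (d <= m)%N := leq_maxl _ _.
(* For [d = 2], and likewise for [d = 1], surjectivity makes the length at most one, and [m ^ n] is
   positive because [m >= d >= 1]. *)
have [d2|d2] := leqP d 2.
  apply: leq_trans (surjective_twisted_length charK (quadratic_surjective charK sJ n_gt0 d2) lM) _.
  by rewrite expn_gt0 (leq_trans d_gt0 dm).
have dm' : ((n - 1) * (d - 1) <= m.+1)%N.
  have d1 : (1 < d - 1)%N by rewrite ltn_subRL.
  apply: leq_trans (mul_le_exp (n - 1) d1) _.
  by have := leq_maxr d ((d - 1) ^ (n - 1) - 1); rewrite -/m subn1 -ltnS; case: (_ ^ _)%N.
case: lM => S [Ssub _ _ Sincr Sprop _].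
exact: (twisted_chain_length dm dm' (And3 Ssub Sincr Sprop)).
Qed.
End MainTheorem.

Theorem theorem6 (R : realType) (K : fieldType) (n : nat)
    (charK : [pchar K] =i pred0) (n_gt0 : (0 < n)%N)
    (sigma : {lrmorphism {mpoly K[n]} -> {mpoly K[n]}})
    (sigmaJ : jacobian_map sigma) :
  let M : lmodType (weyl n K) := twisted (weyl_ext sigmaJ) (polymod n K) in
  let d := endo_degree sigma in
  let m := maxn d ((d - 1) ^ (n - 1) - 1)%N in
  [/\ holonomic R M, finite_length M & cyclic_module M] /\
  (forall l : nat, has_length M l -> (l <= m ^ n)%N).
Proof.
move=> M d m; split; last exact: twisted_length.
split; [exact: twisted_holonomic|exact: twisted_finite_length|exact: twisted_cyclic].
Qed.
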